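(* Let $\Omega\subset\mathbb{D}$ be an open set that is bounded with respect to the hyperbolic metric. Let $\mathcal{G}$ be a geodesic in $\mathbb{D}$ and let $\mathcal{H}$ be an associated polarizer. Then $$\tau_h(\Omega)\le \tau_h\bigl(P_{\mathcal{H}}(\Omega)\bigr).$$ Moreover, equality holds if and only if $|P_{\mathcal{H}}(\Omega)\,\triangle\,\Omega|=0$ or $|P_{\mathcal{H}}(\Omega)\,\triangle\,\sigma_{\mathcal{G}}(\Omega)|=0$, where $\triangle$ denotes the symmetric difference of sets and $|\cdot|$ denotes the Lebesgue area measure.
   Context: $\mathbb{D}=\{z\in\mathbb{C}:|z|<1\}$ is the Poincaré disk with hyperbolic distance $d_h(z,w)=2\tanh^{-1}[z,w]$, where $[z,w]=\left|\frac{z-w}{1-\overline{z}w}\right|$ is the pseudo-hyperbolic distance. Let $d\mu(w)=\frac{1}{\pi}\frac{dA(w)}{(1-|w|^2)^2}$ with $dA$ the Lebesgue area measure. For an open hyperbolically bounded $\Omega\subset\mathbb{D}$, $L^2(\Omega)$ is the space of (real-valued) functions square integrable on $\Omega$ with respect to $\mu$. The hyperbolic logarithmic potential operator on $L^2(\Omega)$ is $\mathcal{L}_h u(z)=\frac12\int_\Omega \log\frac{1}{[z,w]}\,u(w)\,d\mu(w)$, and its largest eigenvalue is $$\tau_h(\Omega)=\sup\left\{\frac12\int_\Omega\int_\Omega \log\frac{1}{[z,w]}u(z)u(w)\,d\mu(z)\,d\mu(w): u\in L^2(\Omega),\ \int_\Omega u^2\,d\mu=1\right\}.$$ A geodesic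 $\mathcal{G}$ in $\mathbb{D}$ is the intersection with $\mathbb{D}$ of either a Euclidean line through the origin or a Euclidean circle orthogonal to the unit circle. A polarizer $\mathcal{H}$ associated with $\mathcal{G}$ is one of the two (open) sides of $\mathcal{G}$, i.e. one of the two connected components of $\mathbb{D}\setminus\mathcal{G}$. Reflection $\sigma_{\mathcal{G}}:\mathbb{D}\to\mathbb{D}$: if $\mathcal{G}$ lies on the line through the origin making angle $\theta\in[0,\pi)$ (anticlockwise) with the real axis, then $\sigma_{\mathcal{G}}(z)=\overline{z}\,e^{2i\theta}$. Otherwise, choose $\theta\in\mathbb{R}$ such that $e^{i\theta}\mathcal{G}$ is symmetric with respect to the real axis and meets the real axis exactly in a point $a\in(0,1)$; with $T(z)=\frac{z-a}{1-az}$, set $\sigma_{\mathcal{G}}(z)=e^{-i\theta}\,T^{-1}\bigl(-\overline{T(e^{i\theta}z)}\bigr)$. The polarization of $\Omega\subset\mathbb{D}$ with respect to $\mathcal{H}$ is $$P_{\mathcal{H}}(\Omega)=\bigl[(\Omega\cup\sigma_{\mathcal{G}}(\Omega))\cap\mathcal{H}\bigr]\cup\bigl[\Omega\cap\sigma_{\mathcal{G}}(\Omega)\bigr].$$ *)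

(* Defs.v *)
From HB Require Import structures.
From mathcomp Require Import all_boot all_order all_algebra.
From mathcomp Require Import complex.
From mathcomp Require Import all_classical all_reals all_analysis.
From mathcomp Require Import measurable_realfun.

Set Implicit Arguments.
Unset Strict Implicit.
Unset Printing Implicit Defensive.
Import Order.TTheory GRing.Theory Num.Theory.
Import numFieldNormedType.Exports.

Local Open Scope classical_set_scope.
Local Open Scope ring_scope.

(* [measurableTypeR R] is [R] with the Borel sigma-algebra on which
   [lebesgue_measure] is defined. The plane carries the topology and the measure;
   [cplx] and [pt] pass to [R[i]] and back for complex arithmetic. *)
Notation plane R := (measurableTypeR R * measurableTypeR R)%type.

Section hyperbolic_disk.
Variable R : realType.

Definition cplx (z : plane R) : R[i] := Complex z.1 z.2.

Definition pt (z : R[i]) : plane R := (complex.Re z, complex.Im z).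

Definition modulus (z : R[i]) : R := ComplexField.Normc.normc z.

Definition cis (t : R) : R[i] := Complex (cos t) (sin t).

Definition area : {measure set (plane R) -> \bar R} :=
  (@lebesgue_measure R \x @lebesgue_measure R)%E.

Definition disk : set (plane R) := [set z | modulus (cplx z) < 1].

Definition pseudo_dist (z w : plane R) : R :=
  modulus ((cplx z - cplx w) / (1 - conjc (cplx z) * cplx w)).

Definition artanh (x : R) : R := ln ((1 + x) / (1 - x)) / 2.

Definition hyp_dist (z w : plane R) : R := 2 * artanh (pseudo_dist z w).

Definition hyp_bounded (A : set (plane R)) : Prop :=
  exists M : R, forall z w, A z -> A w -> hyp_dist z w <= M.

Definition hyp_density (w : plane R) : R :=
  pi^-1 * ((1 - modulus (cplx w) ^+ 2) ^+ 2)^-1.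

Definition hyp_measure (A : set (plane R)) : \bar R :=
  (\int[area]_(w in A `&` disk) (hyp_density w)%:E)%E.

Lemma modulus_sqr (z : plane R) : modulus (cplx z) ^+ 2 = z.1 ^+ 2 + z.2 ^+ 2.
Proof. by rewrite /modulus /= sqr_sqrtr// addr_ge0// sqr_ge0. Qed.

Lemma hyp_density_ge0 w : 0 <= hyp_density w.
Proof. by rewrite mulr_ge0// invr_ge0 ?pi_ge0// sqr_ge0. Qed.

Lemma measurable_modulus_sqr :
  measurable_fun setT (fun z : plane R => modulus (cplx z) ^+ 2).
Proof.
rewrite (_ : (fun _ => _) = (fun z : plane R => z.1 ^+ 2 + z.2 ^+ 2)); last first.
  by apply/funext => z; exact: modulus_sqr.
by apply: measurable_funD; apply: measurable_funX;
  [exact: measurable_fst|exact: measurable_snd].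
Qed.

Lemma measurable_disk : measurable disk.
Proof.
rewrite (_ : disk =
    setT `&` (fun z => modulus (cplx z) ^+ 2) @^-1` `]-oo, 1[); last first.
  rewrite setTI; apply/seteqP; split => z /=;
    by rewrite in_itv/= expr_lt1// sqrtr_ge0.
by apply: measurable_modulus_sqr => //; exact: measurable_itv.
Qed.

Lemma measurable_hyp_density : measurable_fun setT hyp_density.
Proof.
apply: measurable_funM; first exact: measurable_cst.
rewrite (_ : (fun _ => _) = (fun w =>
    ((1 - modulus (cplx w) ^+ 2) ^+ 2) `^ (-1))); last first.
  by apply/funext => w; rewrite powR_inv1// sqr_ge0.
apply: (measurableT_comp (measurable_powR (-1))).
apply: measurable_funX; apply: measurable_funB; first exact: measurable_cst.
exact: measurable_modulus_sqr.
Qed.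

Let hyp_measure0 : hyp_measure set0 = 0%E.
Proof. by rewrite /hyp_measure set0I integral_set0. Qed.

Let hyp_measure_ge0 A : (0 <= hyp_measure A)%E.
Proof. by apply: integral_ge0 => w _; rewrite lee_fin hyp_density_ge0. Qed.

Let hyp_measure_sigma_additive : semi_sigma_additive hyp_measure.
Proof.
move=> /= F mF tF mUF; rewrite /hyp_measure setI_bigcupl.
rewrite ge0_integral_bigcup//=.
- apply: is_cvg_ereal_nneg_natsum_cond => n _ _; exact: hyp_measure_ge0.
- by move=> k; apply: measurableI => //; exact: measurable_disk.
- apply: measurable_funTS; apply/measurable_EFinP; exact: measurable_hyp_density.
- by move=> w _; rewrite lee_fin hyp_density_ge0.
- exact: trivIset_setIr.
Qed.

HB.instance Definition _ := isMeasure.Build _ _ _ hyp_measure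
  hyp_measure0 hyp_measure_ge0 hyp_measure_sigma_additive.

(* Representatives of the classes in L^2 of the hyperbolic measure on [A]. *)
Definition hyp_L2 (A : set (plane R)) : set (plane R -> R) :=
  [set u : plane R -> R | measurable_fun A u /\
           hyp_measure.-integrable A (fun z => (u z ^+ 2)%:E)].

(* On the diagonal, a null set, the kernel takes the junk value [0]. *)
Definition log_energy (A : set (plane R)) (u : plane R -> R) : \bar R :=
  ((2^-1)%:E * \int[hyp_measure]_(z in A) \int[hyp_measure]_(w in A)
     (ln ((pseudo_dist z w)^-1) * u z * u w)%:E)%E.

(* For [A] null there is no admissible [u] and the value is [-oo]. *)
Definition tau_h (A : set (plane R)) : \bar R :=
  ereal_sup [set e | exists u : plane R -> R,
    [/\ hyp_L2 A u,
        (\int[hyp_measure]_(z in A) (u z ^+ 2)%:E = 1)%E &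
        e = log_energy A u]].

Definition line0 (t : R) : set (plane R) :=
  [set z | exists s : R, z = (s * cos t, s * sin t)].

Definition circle (c : plane R) (r : R) : set (plane R) :=
  [set z | modulus (cplx z - cplx c) = r].

(* The circles meet, and their radii are perpendicular at each common point. *)
Definition orthogonal_circles (c d : plane R) (r s : R) : Prop :=
  circle c r `&` circle d s !=set0 /\
  forall p, circle c r p -> circle d s p ->
    (p.1 - c.1) * (p.1 - d.1) + (p.2 - c.2) * (p.2 - d.2) = 0.

Definition geodesic (G : set (plane R)) : Prop :=
  (exists t : R, G = disk `&` line0 t) \/
  (exists (c : plane R) (r : R),
     [/\ 0 < r, orthogonal_circles c (0, 0) r 1 & G = disk `&` circle c r]).

Definition polarizer (G H : set (plane R)) : Prop :=
  exists2 x, (disk `\` G) x & H = connected_component (disk `\` G) x.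

Definition rot (t : R) (z : plane R) : plane R := pt (cis t * cplx z).

Definition mobius (a : R) (z : R[i]) : R[i] :=
  (z - Complex a 0) / (1 - Complex a 0 * z).

Definition diameter_angle (G : set (plane R)) : set R :=
  [set t | 0 <= t < pi /\ G = disk `&` line0 t].

Definition normalizing (G : set (plane R)) : set (plane R) :=
  [set p | let: (t, a) := p in
    [/\ 0 < a < 1,
        forall z, (rot t @` G) z -> (rot t @` G) (z.1, - z.2) &
        (rot t @` G) `&` [set z | z.2 = 0] = [set (a, 0)]]].

(* [mobius (- a)] is the inverse of [mobius a] on the disk. *)
Definition reflection (G : set (plane R)) (z : plane R) : plane R :=
  if `[< diameter_angle G !=set0 >] then
    pt (conjc (cplx z) * cis (2 * xget 0 (diameter_angle G)))
  else
    let: (t, a) := xget (0, 0) (normalizing G) in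
    pt (cis (- t) * mobius (- a) (- conjc (mobius a (cis t * cplx z)))).

Definition polarization (G H A : set (plane R)) : set (plane R) :=
  ((A `|` reflection G @` A) `&` H) `|` (A `&` reflection G @` A).

End hyperbolic_disk.

(* Main.v *)
Require Import Defs.
From HB Require Import structures.
From mathcomp Require Import all_boot all_order all_algebra.
From mathcomp Require Import complex.
From mathcomp Require Import all_classical all_reals all_analysis.
From mathcomp Require Import measurable_realfun.
From mathcomp Require Import ring lra.

Set Implicit Arguments.
Unset Strict Implicit.
Unset Printing Implicit Defensive.
Import Order.TTheory GRing.Theory Num.Theory.
Import numFieldNormedType.Exports.

Local Open Scope classical_set_scope.
Local Open Scope ring_scope.

(** Replace a competitor u >= 0 by its polarization Pu, which carries the larger
    of u(z), u(sigma z) to the polarizer. The kernel only depends on the distance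
    and points on the same side of the geodesic are closer than points on
    opposite sides, so the rearrangement inequality for the four points z,
    sigma z, w, sigma w gives E(u) <= E(Pu), with the same L^2 norm.

    For the equality case no eigenfunction is needed. If both
    B1 = {z in H : z notin Omega, sigma z in Omega} and
    B2 = {z in H : z in Omega, sigma z notin Omega} have positive measure, then
    E(Pu) - E(u) is at least a constant times the product of two weighted
    integrals of u, over sigma(B1) and B2. These are bounded below uniformly over
    near-maximizers: testing the quadratic form tau |.|^2 - E >= 0 on u + t v gives
    a lower bound of <u, v> in terms of the integral of u, and the latter is at
    least a multiple of E(u) since u is mapped to a bounded function.

    The invariance of the measure is a change of variables: an inversion
    preserves the slope y / x, and on each line through the origin it acts as
    x |-> k / x, so that two one-dimensional substitutions suffice. *)

(** * Measures with a density and one-dimensional substitutions *)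

(** The suprema could agree even if every single competitor gained strictly, so strictness needs a
    gain bounded below along maximizing sequences. That uniform gain stands in for a maximizer, and
    hence for compactness. A near-maximizer u cannot be almost orthogonal to a test function v: on a
    hyperbolically bounded Omega the kernel stays above some k > 0, so the cross term of E(u + t v)
    has order t times the product of the integrals of u and v, whereas a small <u, v> would leave
    only terms of order t^2 to pay for it. The weights are heights over the geodesic: reflecting one
    of two points adds the product of their heights to the squared distance, up to a factor, so the
    gain decays linearly at the geodesic. The normal (n, v) treats diameters and circles at once.
    Functions are nonnegative and extended by zero to the plane, so Tonelli and monotonicity apply
    in the extended reals without integrability; signed functions occur only in the passage from u
    to |u|. *)

Section integral_density.
Local Open Scope ereal_scope.
Context d (T : measurableType d) (R : realType).
Variables (mu nu : {measure set T -> \bar R}) (rho : T -> R).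
Hypothesis mrho : measurable_fun setT rho.
Hypothesis rho0 : forall x, (0 <= rho x)%R.
Hypothesis nuE : forall A, measurable A -> nu A = \int[mu]_(x in A) (rho x)%:E.

Import HBNNSimple.

Let integral_density_nnsfun (f : {nnsfun T >-> R}) :
  \int[nu]_x (f x)%:E = \int[mu]_x ((f x)%:E * (rho x)%:E).
Proof.
under [LHS]eq_integral do rewrite fimfunE -fsumEFin//.
rewrite [LHS]ge0_integral_fsum//; last 2 first.
  - by move=> r; exact/measurable_EFinP/measurableT_comp.
  - by move=> n x _; rewrite EFinM nnfun_muleindic_ge0.
under [RHS]eq_integral.
  move=> x xD; rewrite fimfunE -fsumEFin// muleC ge0_mule_fsumr; last first.
    by move=> r; rewrite EFinM nnfun_muleindic_ge0.
  over.
rewrite [RHS]ge0_integral_fsum//; last 2 first.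
  - move=> r; apply: emeasurable_funM; first exact/measurable_EFinP.
    by apply/measurable_EFinP; do 2 apply/measurableT_comp => //.
  - move=> n x _; rewrite mule_ge0//; first by rewrite lee_fin.
    by rewrite EFinM nnfun_muleindic_ge0.
apply: eq_fsbigr => r; rewrite inE => -[t _ <-{r}].
have ft0 : (0 <= f t)%R by [].
rewrite integralZl_indic_nnsfun// integral_indic// setIT nuE//.
rewrite [in LHS]integral_mkcond -ge0_integralZl//.
- apply: eq_integral => x _; rewrite /= patchE indicE EFinM.
  case: ifPn => _; first by rewrite mule1 muleC.
  by rewrite !mule0.
- exact/(measurable_restrictT _ _).1/measurable_funTS/measurable_EFinP.
- by move=> x _; apply: erestrict_ge0 => *; rewrite lee_fin.
Qed.

(** Both sides are linear on simple functions, where the hypothesis on measurable sets applies, and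
    both pass to increasing limits. *)
Lemma ge0_integral_density (f : T -> \bar R) :
  measurable_fun setT f -> (forall x, 0 <= f x) ->
  \int[nu]_x f x = \int[mu]_x (f x * (rho x)%:E).
Proof.
move=> mf f0.
pose f_ := nnsfun_approx measurableT mf.
transitivity (lim (\int[nu]_x (f_ n x)%:E @[n --> \oo])).
  rewrite -monotone_convergence//=.
  - apply: eq_integral => ? /[!inE] xD; apply/esym/cvg_lim => //=.
    exact: cvg_nnsfun_approx.
  - by move=> n; exact/measurable_EFinP/measurable_funTS.
  - by move=> n ? _; rewrite lee_fin.
  - by move=> ? _ ? ? mn; rewrite lee_fin; exact/lefP/nd_nnsfun_approx.
transitivity (lim (\int[mu]_x ((f_ n x)%:E * (rho x)%:E) @[n --> \oo])).
  by apply: congr_lim; apply/funext => n /=; exact: integral_density_nnsfun.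
rewrite -monotone_convergence//=.
- apply: eq_integral => x /[!inE] xD.
  apply/cvg_lim => //; apply: cvgeZr => //.
  exact: cvg_nnsfun_approx.
- move=> n; apply: emeasurable_funM; last exact/measurable_EFinP.
  exact/measurable_EFinP/measurable_funTS.
- by move=> n x _; rewrite mule_ge0// lee_fin.
- move=> x _ m n mn; apply: lee_wpmul2r; first by rewrite lee_fin.
  by rewrite lee_fin; exact/lefP/nd_nnsfun_approx.
Qed.
End integral_density.

Section density_measure.
Local Open Scope ereal_scope.
Context d (T : measurableType d) (R : realType).
Variables (mu : {measure set T -> \bar R}) (rho : T -> R).
Hypothesis mrho : measurable_fun setT rho.
Hypothesis rho0 : forall x, (0 <= rho x)%R.

Definition with_density (A : set T) : \bar R := \int[mu]_(x in A) (rho x)%:E.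

Let with_density0 : with_density set0 = 0.
Proof. exact: integral_set0. Qed.

Let with_density_ge0 A : 0 <= with_density A.
Proof. by apply: integral_ge0 => x _; rewrite lee_fin. Qed.

Let with_density_sigma_additive : semi_sigma_additive with_density.
Proof.
move=> /= F mF tF mUF; rewrite /with_density ge0_integral_bigcup//=.
- by apply: is_cvg_ereal_nneg_natsum_cond => n _ _; exact: with_density_ge0.
- exact/measurable_funTS/measurable_EFinP.
- by move=> w _; rewrite lee_fin.
Qed.

HB.instance Definition _ := isMeasure.Build _ _ _ with_density
  with_density0 with_density_ge0 with_density_sigma_additive.

Definition density_measure : {measure set T -> \bar R} := with_density.

End density_measure.

Section line_substitution.
Local Open Scope ereal_scope.
Context (R : realType).
Local Notation lam := (@lebesgue_measure R).

Lemma ge0_integral_oppr (f : R -> \bar R) :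
  measurable_fun setT f -> (forall x, 0 <= f x) ->
  \int[lam]_x f (- x)%R = \int[lam]_x f x.
Proof.
move=> mf f0.
have mN : measurable_fun setT (-%R : measurableTypeR R -> measurableTypeR R).
  exact: measurable_funN.
transitivity (\int[pushforward lam (-%R : measurableTypeR R -> measurableTypeR R)]_x f x).
  by rewrite (ge0_integral_pushforward mN).
by apply: eq_measure_integral => A mA _; exact: lebesgue_measureN.
Qed.

(** The pushforward of Lebesgue measure under x |-> a x + b, scaled by a, gives each ]c, d] its
    length, so it is Lebesgue measure by uniqueness. *)
Let affine_pos (a b : R) (f : R -> \bar R) : (0 < a)%R ->
  measurable_fun setT f -> (forall x, 0 <= f x) ->
  a%:E * \int[lam]_x f (a * x + b)%R = \int[lam]_x f x.
Proof.
move=> a0 mf f0.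
pose phi : measurableTypeR R -> measurableTypeR R := fun x => (a * x + b)%R.
have mphi : measurable_fun setT phi.
  by apply: measurable_funD => //; exact: measurable_funM.
pose m : {measure set (measurableTypeR R) -> \bar R} :=
  mscale (NngNum (ltW a0))
    (measure_function_pushforward__canonical__measure_function_Measure lam mphi).
transitivity (\int[m]_x f x).
  by rewrite ge0_integral_mscale// (ge0_integral_pushforward mphi).
apply: eq_measure_integral => A mA _; apply/esym/lebesgue_measure_unique => //.
move=> _ [[c d]] _ <-.
rewrite /m /= /mscale /= /pushforward.
have -> : phi @^-1` `]c, d] = `](c - b) / a, (d - b) / a]%classic%R.
  apply/seteqP; split => x /=; rewrite /phi !in_itv/= ltr_pdivrMr// ler_pdivlMr//; lra.
rewrite !lebesgue_measure_itv/= !lte_fin ltr_pM2r ?invr_gt0// ltrD2r.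
case: ifPn => _; last by rewrite mule0.
by rewrite -!EFinB -EFinM; congr EFin; field; rewrite gt_eqF.
Qed.

Lemma ge0_integral_affine (a b : R) (f : R -> \bar R) : a != 0%R ->
  measurable_fun setT f -> (forall x, 0 <= f x) ->
  `|a|%:E * \int[lam]_x f (a * x + b)%R = \int[lam]_x f x.
Proof.
move=> a0 mf f0; case: (ltrgt0P a) => [ap|an|]; last by move/eqP: a0.
  exact: affine_pos.
have ap : (0 < - a)%R by rewrite oppr_gt0.
rewrite -(affine_pos b ap mf f0); congr (_ * _).
rewrite -(ge0_integral_oppr (f := fun x => f (a * x + b)%R))//.
  by apply: eq_integral => x _; rewrite mulrN mulNr.
apply: measurableT_comp => //.
by apply: measurable_funD => //; exact: measurable_funM.
Qed.

Lemma measurable_invr : measurable_fun setT (@GRing.inv R).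
Proof.
(* [powR] with exponent -1 is the inverse only on nonnegative reals, hence the square; at 0 both
   sides are 0. *)
rewrite (_ : @GRing.inv R = (fun x : R => x * (x ^+ 2) `^ (-1))%R).
  apply: measurable_funM => //; apply: (measurableT_comp (measurable_powR (-1))).
  exact: measurable_funX.
apply/funext => x; rewrite powR_inv1 ?sqr_ge0//.
have [->|x0] := eqVneq x 0%R; first by rewrite invr0 mul0r.
by field.
Qed.

Lemma measurable_funV d (T : measurableType d) (D : set T) (f : T -> R) :
  measurable_fun D f -> measurable_fun D (fun x => (f x)^-1%R).
Proof. move=> mf; exact: (measurableT_comp measurable_invr). Qed.


End line_substitution.

(** * The substitution x |-> k / x on the real line *)

Section inversion.
Context (R : realType).
Local Notation lam := (@lebesgue_measure R).
Variables (k : R) (k_gt0 : 0 < k).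

Let F (x : R) : R := - (k * x^-1).

Let dF (x : R) : x != 0 -> is_derive x (1 : R) F (k / x ^+ 2).
Proof.
move=> x0; have dV := is_deriveV x0 (is_derive_id x (1 : R)).
have dN := is_deriveN (is_deriveZ k dV).
apply: is_derive_eq; rewrite /GRing.scale/=; field => //.
Qed.

Let cF (x : R) : x != 0 -> {for x, continuous F}.
Proof.
move=> /dF[d _]; exact/differentiable_continuous/derivable1_diffP.
Qed.

Let cf (x : R) : x != 0 -> {for x, continuous (fun x : R => k / x ^+ 2)}.
Proof.
move=> x0; apply: continuousM; first exact: cvg_cst.
by apply: continuousV; [rewrite expf_neq0|exact: exprn_continuous].
Qed.

Let integral_cc (a b : R) : 0 < a -> a < b ->
  (\int[lam]_(x in `[a, b]) (k / x ^+ 2)%:E = (k / a - k / b)%:E)%E.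
Proof.
move=> a0 ab.
have pos x : x \in `[a, b] -> x != 0.
  by rewrite in_itv/= => /andP[ax _]; rewrite gt_eqF// (lt_le_trans a0).
rewrite (@continuous_FTC2 _ _ F)//.
- by rewrite -EFinB /F opprK addrC.
- apply: continuous_in_subspaceT => x /[!inE] xab; apply: cf; exact: pos.
- split.
  + move=> x xab; have [] := @dF x _ => //; apply: pos.
    exact: subset_itv_oo_cc xab.
  + by apply: cvg_at_right_filter; apply: cF; rewrite gt_eqF.
  + by apply: cvg_at_left_filter; apply: cF; rewrite gt_eqF// (lt_trans a0).
- move=> x xab; rewrite derive1E; apply: derive_val.
  by apply: dF; apply: pos; exact: subset_itv_oo_cc xab.
Qed.

Let integral_cy (a : R) : 0 < a ->
  (\int[lam]_(x in `[a, +oo[) (k / x ^+ 2)%:E = (k / a)%:E)%E.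
Proof.
move=> a0.
rewrite (@ge0_continuous_FTC2y _ _ F _ 0).
- by rewrite -EFinB /F sub0r opprK.
- by move=> x ax; rewrite divr_ge0 ?sqr_ge0// ltW.
- apply: continuous_in_subspaceT => x /[!inE] /=; rewrite in_itv/= andbT => ax.
  by apply: cf; rewrite gt_eqF// (lt_le_trans a0).
- rewrite -oppr0; apply: cvgN; rewrite -(mulr0 k); apply: cvgM; first exact: cvg_cst.
  have /(gtr0_cvgV0 (f := id)) H : \forall x \near +oo%R, (0 < x :> R) by exact: nbhs_pinfty_gt.
  by apply/H; exact: cvg_id.
- move=> x ax; have [] := @dF x _ => //; by rewrite gt_eqF// (lt_trans a0).
- by apply: cvg_at_right_filter; apply: cF; rewrite gt_eqF.
- move=> x; rewrite in_itv/= andbT => ax; rewrite derive1E; apply: derive_val.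
  by apply: dF; rewrite gt_eqF// (lt_trans a0).
Qed.

Let hp : set R := `]0, +oo[%classic.
Let hn : set R := `]-oo, 0]%classic.

Let rho (x : R) : R := k / x ^+ 2 * \1_hp x.

Let mk2 : measurable_fun setT (fun x : R => k / x ^+ 2).
Proof.
by apply: measurable_funM => //; apply: measurable_funV; exact: measurable_funX.
Qed.

Let mrho : measurable_fun setT rho.
Proof.
apply: measurable_funM => //; apply: measurable_indic; exact: measurable_itv.
Qed.

Let rho0 x : 0 <= rho x.
Proof. by rewrite mulr_ge0// divr_ge0 ?sqr_ge0// ltW. Qed.

Let phi : measurableTypeR R -> measurableTypeR R := fun x => k / x.

Let mphi : measurable_fun setT phi.
Proof. by apply: measurable_funM => //; exact: measurable_funV. Qed.

(** The density k / x^2 on the positive half-line; its pushforward [Q] under x |-> k / x is to be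
    recognized as Lebesgue measure there. *)
Let P : {measure set (measurableTypeR R) -> \bar R} := density_measure lam mrho rho0.
Let Q : {measure set (measurableTypeR R) -> \bar R} :=
  measure_function_pushforward__canonical__measure_function_Measure P mphi.

Let QE A : measurable A ->
  Q A = (\int[lam]_(x in phi @^-1` A `&` hp) (k / x ^+ 2)%:E)%E.
Proof.
move=> mA; rewrite /Q/= /pushforward /P/= /with_density integral_mkcondr.
apply: eq_integral => x _; rewrite patchE /rho indicE.
by case: ifPn => _; rewrite ?mulr1 ?mulr0.
Qed.


Let Q_itv (a b : R) : a < b -> 
  Q `]a, b]%classic = (Num.max 0 b - Num.max 0 a)%:E.
Proof.
move=> ab; rewrite QE//.
have [b0|b0] := leP b 0.
  have a0 : a <= 0 by rewrite (le_trans (ltW ab)).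
  rewrite (max_idPl _)// subrr /hp (_ : _ `&` _ = set0) ?integral_set0//.
  rewrite -subset0 => x [/=]; rewrite /phi !in_itv/= andbT => /andP[_ xb] x0.
  have := divr_gt0 k_gt0 x0; lra.
have [a0|a0] := leP a 0.
  rewrite /hp (_ : _ `&` _ = `[k / b, +oo[%classic); last first.
    apply/seteqP; split=> x /=; rewrite /phi !in_itv/= !andbT.
      by move=> [/andP[_ +] x0]; rewrite ler_pdivrMr// mulrC -ler_pdivrMr.
    move=> kx; have x0 : 0 < x by rewrite (lt_le_trans _ kx)// divr_gt0.
    split => //; rewrite (le_lt_trans a0) ?divr_gt0//=.
    by rewrite ler_pdivrMr// mulrC -ler_pdivrMr.
  rewrite integral_cy ?divr_gt0//; congr EFin; field.
  by rewrite (gt_eqF b0) (gt_eqF k_gt0).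
rewrite /hp (_ : _ `&` _ = `[k / b, k / a[%classic); last first.
  apply/seteqP; split=> x /=; rewrite /phi !in_itv/= !andbT.
    move=> [/andP[ax xb] x0].
    by rewrite ler_pdivrMr// mulrC -ler_pdivrMr// xb/= ltr_pdivlMr// mulrC -ltr_pdivlMr.
  move=> /andP[kx xk]; have x0 : 0 < x by rewrite (lt_le_trans _ kx)// divr_gt0.
  split => //; rewrite ltr_pdivlMr// mulrC -ltr_pdivlMr// xk/=.
  by rewrite ler_pdivrMr// mulrC -ler_pdivrMr.
rewrite integral_itv_bndo_bndc; last exact/measurable_funTS/measurable_EFinP.
rewrite integral_cc ?divr_gt0//.
  congr EFin; field; rewrite (gt_eqF b0) (gt_eqF k_gt0) (gt_eqF a0)//.
by rewrite ltr_pM2l// ltf_pV2.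
Qed.

(** Uniqueness of Lebesgue measure is a statement on the whole line, so [Q] is completed by Lebesgue
    measure on the nonpositive half-line; the sum then has the right value on every ]a, b]. *)
Let Q_pos A : measurable A -> Q (A `&` hp) = lam (A `&` hp).
Proof.
move=> mA.
have mhn : measurable hn by exact: measurable_itv.
have mhp : measurable hp by exact: measurable_itv.
pose m : {measure set (measurableTypeR R) -> \bar R} :=
  measure_add Q (mrestr lam mhn).
have mE B : measurable B -> m B = (Q B + lam (B `&` hn))%E.
  by move=> mB; rewrite -[RHS]/(Q B + mrestr lam mhn B)%E -measure_addE.
have lm : forall B, measurable B -> lam B = m B.
  apply: lebesgue_measure_unique => _ [[a b]] _ <-; rewrite mE//.
  have [ba|ab] := leP b a.
    by rewrite set_itv_ge ?set0I ?measure0 ?adde0// -leNgt.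
  rewrite [X in X + _]Q_itv//.
  have -> : `]a, b]%classic `&` hn = `]a, Num.min b 0]%classic.
    rewrite /hn; by apply/seteqP; split=> x /=; rewrite !in_itv/= le_min; [move=> [/andP[-> ->] ->]|move=> /and3P[-> -> ->]].
  rewrite !lebesgue_measure_itv/= !lte_fin ab lt_min ab/=.
  case: (ltP a 0) => a0; rewrite ?adde0 -!EFinB -?EFinD; congr EFin;
    by case: (ltP 0 b) => b0; lra.
rewrite [RHS]lm; last exact: measurableI.
rewrite mE; last exact: measurableI.
rewrite [X in lam X](_ : _ = set0) ?measure0 ?adde0//.
by rewrite -subset0 /hp /hn => x [[_ /=]]; rewrite !in_itv/= andbT => + ?; lra.
Qed.

Let inversion_pos (f : R -> \bar R) :
  measurable_fun setT f -> (forall x, 0 <= f x)%E ->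
  (\int[lam]_(x in hp) (f (k / x)%R * (k / x ^+ 2)%:E) = \int[lam]_(x in hp) f x)%E.
Proof.
move=> mf f0.
have mhp : measurable hp by exact: measurable_itv.
have <- : (\int[Q]_(x in hp) f x = \int[lam]_(x in hp) f x)%E.
  apply: eq_measure_integral => A mA AS.
  by have := Q_pos mA; rewrite setIidl.
have mfp : measurable_fun setT (f \_ hp).
  by apply/(measurable_restrictT _ _).1 => //; exact: measurable_funTS.
rewrite [RHS]integral_mkcond (ge0_integral_pushforward mphi)//; last first.
  by move=> x _; exact: erestrict_ge0.
rewrite preimage_setT (@ge0_integral_density _ _ _ lam P rho)//.
- rewrite [LHS]integral_mkcond; apply: eq_integral => x _.
  rewrite /= !patchE /rho indicE /hp !mem_setE/= !in_itv/= !andbT.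
  case: (ltP 0 x) => x0; last by rewrite mulr0 mule0.
  by rewrite divr_gt0// mulr1.
- exact: measurableT_comp.
- by move=> x; exact: erestrict_ge0.
Qed.

Lemma ge0_integral_inversion (f : R -> \bar R) :
  measurable_fun setT f -> (forall x, 0 <= f x)%E ->
  (\int[lam]_x (f (k / x)%R * (k / x ^+ 2)%:E) = \int[lam]_x f x)%E.
Proof.
(* Since x |-> k / x commutes with negation, folding the line at 0 reduces the claim to the positive
   half-line. *)
have sym (g : R -> \bar R) : measurable_fun setT g -> (forall x, 0 <= g x)%E ->
    (\int[lam]_x g x = \int[lam]_(x in hp) (g x + g (- x)%R))%E.
  move=> mg g0.
  have mhp : measurable hp by exact: measurable_itv.
  have mgN : measurable_fun setT (fun x : R => g (- x)).
    by apply: measurableT_comp => //; exact: measurable_funN.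
  rewrite ge0_integralD//; try exact: measurable_funTS.
  rewrite -(setvU hp) ge0_integral_setU//.
  - rewrite addeC; congr (_ + _)%E.
    have -> : ~` hp = `]-oo, 0]%classic.
      by rewrite /hp -setCitvl setCK.
    rewrite -integral_itv_bndo_bndc; last exact: measurable_funTS.
    rewrite [LHS]integral_mkcond [RHS]integral_mkcond -[LHS]ge0_integral_oppr//.
    + apply: eq_integral => x _; rewrite !patchE /hp !mem_setE/= !in_itv/= andbT.
      by rewrite oppr_lt0.
    + by apply/(measurable_restrictT _ _).1 => //; exact: measurable_funTS.
    + by move=> x; exact: erestrict_ge0.
  - exact: measurableC.
  - by rewrite setvU.
  - by apply/disj_setPCr.
move=> mf f0.
have mk : measurable_fun setT (fun x : R => k / x) by exact: mphi.
have mN : measurable_fun setT (fun x : R => f (- x)).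
  by apply: measurableT_comp => //; exact: measurable_funN.
rewrite sym; last 2 first.
- by apply: emeasurable_funM; [exact: measurableT_comp|exact/measurable_EFinP].
- by move=> x; rewrite mule_ge0// lee_fin divr_ge0 ?sqr_ge0// ltW.
rewrite [RHS]sym// -[RHS]inversion_pos.
- apply: eq_integral => x _; rewrite sqrrN invrN mulrN -ge0_muleDl//.
- exact: emeasurable_funD.
- by move=> x; rewrite adde_ge0.
Qed.

End inversion.

(** * Change of variables in the plane *)
Ltac measurability := repeat lazymatch goal with
  | |- measurable_fun _ (fun _ => ?c) => exact: measurable_cst
  | |- measurable_fun _ (fun x => @?f x + @?g x)%R => apply: measurable_funD
  | |- measurable_fun _ (fun x => - @?f x)%R => apply: measurable_funN
  | |- measurable_fun _ (fun x => @?f x * @?g x)%R => apply: measurable_funM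
  | |- measurable_fun _ (fun x => @?f x ^+ _)%R => apply: measurable_funX
  | |- measurable_fun _ (fun x => (@?f x)^-1)%R => apply: measurable_funV
  | |- measurable_fun _ (@GRing.inv _) => apply: measurable_funV
  | |- measurable_fun _ (fun x => (@?f x, @?g x)) => apply: measurable_fun_pair
  | |- _ => first [assumption | exact: measurable_fst | exact: measurable_snd
                  | exact: measurable_id]
  end.

Section plane_substitution.
Local Open Scope ereal_scope.
Context (R : realType).
Local Notation lam := (@lebesgue_measure R).
Implicit Types f g : plane R -> \bar R.

Lemma ge0_integral_area f : measurable_fun setT f -> (forall z, 0 <= f z) ->
  \int[area R]_z f z = \int[lam]_x \int[lam]_y f (x, y).
Proof. by move=> mf f0; rewrite /area fubini_tonelli1. Qed.

(** The substitution y = x m in the inner integral has Jacobian |x|; Tonelli then puts the slope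
    outside, so that an inversion only touches the inner variable. *)
Lemma ge0_integral_slope f : measurable_fun setT f -> (forall z, 0 <= f z) ->
  \int[area R]_z f z =
  \int[lam]_m \int[lam]_x (`|x|%:E * f (x, x * m)%R).
Proof.
move=> mf f0; rewrite ge0_integral_area//.
have mF : measurable_fun setT (fun z : plane R => `|z.1|%:E * f (z.1, z.1 * z.2)%R).
  apply: emeasurable_funM.
    by apply/measurable_EFinP; apply: measurableT_comp => //; measurability.
  by apply: measurableT_comp => //; measurability.
rewrite -(fubini_tonelli _ mF)/=; last by move=> z; rewrite mule_ge0.
apply: ge0_ae_eq_integral => //.
- exact: (measurable_fun_fubini_tonelli_F f mf f0).
- by apply: (measurable_fun_fubini_tonelli_F _ mF) => z; rewrite mule_ge0.
- by move=> x _; exact: integral_ge0.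
- by move=> x _; apply: integral_ge0 => y _; rewrite mule_ge0.
(* The substitution degenerates at x = 0 only, a null set. *)
exists [set 0%R]; split => //; first exact: lebesgue_measure_set1.
move=> x /=; apply: contra_notP => /eqP x0 _.
have mfx : measurable_fun setT (fun y : R => f (x, y)).
  by apply: measurableT_comp => //; measurability.
rewrite ge0_integralZl//; last first.
  by apply: measurableT_comp => //; measurability.
rewrite -(ge0_integral_affine 0 x0 (f := fun y => f (x, y)))//.
by under [in RHS]eq_integral do rewrite -[(x * _)%R]addr0.
Qed.

Lemma ge0_integral_area_inversion f :
  measurable_fun setT f -> (forall z, 0 <= f z) ->
  \int[area R]_z (f (z.1 / (z.1 ^+ 2 + z.2 ^+ 2), z.2 / (z.1 ^+ 2 + z.2 ^+ 2))%R
     * ((z.1 ^+ 2 + z.2 ^+ 2) ^- 2)%R%:E) = \int[area R]_z f z.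
Proof.
move=> mf f0; rewrite [RHS]ge0_integral_slope// ge0_integral_slope; last 2 first.
- apply: emeasurable_funM.
    by apply: measurableT_comp => //; measurability.
  by apply/measurable_EFinP; measurability.
- by move=> z; rewrite mule_ge0// lee_fin invr_ge0 sqr_ge0.
apply: eq_integral => m _.
(* On the line of slope m, |z|^2 = x^2 (1 + m^2), so z / |z|^2 has first coordinate k / x with this
   k. *)
have k0 : (0 < (1 + m ^+ 2)^-1 :> R)%R by rewrite invr_gt0 ltr_pwDl// sqr_ge0.
rewrite -(ge0_integral_inversion k0 (f := fun x => `|x|%:E * f (x, x * m)%R))//.
- apply: eq_integral => x _ /=.
  have [->|x0] := eqVneq x 0%R.
    by rewrite normr0 mul0e expr0n/= invr0 !mulr0 mule0.
  have m0 : (1 + m ^+ 2 != 0 :> R)%R by rewrite -invr_eq0 gt_eqF.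
  have sE : (x ^+ 2 + (x * m) ^+ 2 = x ^+ 2 * (1 + m ^+ 2) :> R)%R by ring.
  have s0 : (x ^+ 2 + (x * m) ^+ 2 != 0 :> R)%R by rewrite sE mulf_neq0// expf_neq0.
  have -> : (x / (x ^+ 2 + (x * m) ^+ 2) = (1 + m ^+ 2)^-1 / x :> R)%R.
    by rewrite sE; field; rewrite x0.
  have -> : (x * m / (x ^+ 2 + (x * m) ^+ 2) = (1 + m ^+ 2)^-1 / x * m :> R)%R.
    by rewrite sE; field; rewrite x0.
  rewrite muleCA [in RHS]muleAC muleC; congr (_ * _).
  rewrite -!EFinM; congr EFin.
  rewrite normrM (gtr0_norm k0) normfV sE.
  have nx : (`|x| != 0)%R by rewrite normr_eq0.
  have -> : (x ^+ 2 = `|x| ^+ 2)%R by rewrite real_normK// num_real.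
  by field; rewrite nx.
- apply: emeasurable_funM.
    by apply/measurable_EFinP; exact: normr_measurable.
  by apply: measurableT_comp => //; measurability.
- by move=> x; rewrite mule_ge0.
Qed.

End plane_substitution.

Section hyperbolic_reflection.
Context (R : realType).
Implicit Types (n z w : plane R) (v : R).

(* [(n, v)] is the unit normal of a geodesic in the hyperboloid model, i.e.
   |n|^2 = 1 + v^2; the geodesic is the zero set of [height n v]. Diameters have
   v = 0, and the circle of centre c and radius r has n = c / r, v = 1 / r. *)
Definition height n v z : R :=
  2 * (n.1 * z.1 + n.2 * z.2) - v * (1 + z.1 ^+ 2 + z.2 ^+ 2).

(** Equals 1 - v h(z) under the normalization of (n, v), by [refl_denE]; as a sum of squares it is
    visibly nonnegative. *)
Definition refl_den n v z : R := (n.1 - v * z.1) ^+ 2 + (n.2 - v * z.2) ^+ 2.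

(** The Lorentz reflection X |-> X - 2 <X, N> N with N = (v; n), read in the disk: z corresponds to
    X = (1 + |z|^2; 2 z) / (1 - |z|^2), and <X, N> is [height] divided by 1 - |z|^2. *)
Definition refl n v z : plane R :=
  ((z.1 - height n v z * n.1) / refl_den n v z,
   (z.2 - height n v z * n.2) / refl_den n v z).

Lemma measurable_height n v : measurable_fun setT (height n v).
Proof. by rewrite /height; measurability. Qed.

Lemma measurable_refl_den n v : measurable_fun setT (refl_den n v).
Proof. by rewrite /refl_den; measurability. Qed.

Lemma measurable_refl n v : measurable_fun setT (refl n v).
Proof.
have mh := measurable_height n v; have md := measurable_refl_den n v.
by rewrite /refl; measurability.
Qed.

End hyperbolic_reflection.

Section area_substitution.
Local Open Scope ereal_scope.
Context (R : realType).
Local Notation lam := (@lebesgue_measure R).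
Implicit Types f g : plane R -> \bar R.

Lemma ge0_integral_area_swap f : measurable_fun setT f -> (forall z, 0 <= f z) ->
  \int[area R]_z f z = \int[lam]_y \int[lam]_x f (x, y).
Proof. by move=> mf f0; rewrite /area fubini_tonelli2. Qed.

Lemma ge0_integral_area_affine (a p q : R) f : a != 0%R ->
  measurable_fun setT f -> (forall z, 0 <= f z) ->
  (a ^+ 2)%:E * \int[area R]_z f (a * z.1 + p, a * z.2 + q)%R = \int[area R]_z f z.
Proof.
move=> a0 mf f0.
have mx (x : R) : measurable_fun setT (fun y : R => f (x, y)).
  by apply: measurableT_comp => //; measurability.
have mF : measurable_fun setT (fun x : R => \int[lam]_y f (x, y)).
  exact: (measurable_fun_fubini_tonelli_F f mf f0).
rewrite [in RHS]ge0_integral_area// ge0_integral_area//; last first.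
  by apply: measurableT_comp => //; measurability.
rewrite -(ge0_integral_affine p a0 mF); last first.
  by move=> x; exact: integral_ge0.
have -> : (a ^+ 2)%:E = `|a|%:E * `|a|%:E.
  by rewrite -EFinM -normrM -expr2 ger0_norm ?sqr_ge0.
rewrite -muleA; congr (_ * _).
have mG : measurable_fun setT (fun z : plane R => f (a * z.1 + p, a * z.2 + q)%R).
  by apply: measurableT_comp => //; measurability.
rewrite -ge0_integralZl//.
- apply: eq_integral => x _ /=.
  by rewrite -(ge0_integral_affine q a0 (f := fun y => f (a * x + p, y)%R)).
- exact: (measurable_fun_fubini_tonelli_F _ mG).
- by move=> x _; exact: integral_ge0.
Qed.

(** A linear isometry as two one-variable substitutions: x' = a x + b y at fixed y turns b x - a y
    into (b / a) x' - y / a, which is affine in y at fixed x'. The Jacobians 1 / |a| and |a| cancel.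
    For a = 0 the map swaps the coordinates up to sign. *)
Lemma ge0_integral_area_reflection (a b : R) f : (a ^+ 2 + b ^+ 2 = 1)%R ->
  measurable_fun setT f -> (forall z, 0 <= f z) ->
  \int[area R]_z f (a * z.1 + b * z.2, b * z.1 - a * z.2)%R = \int[area R]_z f z.
Proof.
move=> ab mf f0.
have mG : measurable_fun setT
    (fun z : plane R => f (a * z.1 + b * z.2, b * z.1 - a * z.2)%R).
  by apply: measurableT_comp => //; measurability.
have [a0|a0] := eqVneq a 0%R.
  rewrite ge0_integral_area// ge0_integral_area_swap//.
  have b2 : (b ^+ 2 = 1)%R by rewrite -ab a0 expr0n add0r.
  have b1 : `|b|%R = 1%R by apply/eqP; rewrite -sqrp_eq1// real_normK ?num_real// b2.
  have b0 : b != 0%R by rewrite -normr_eq0 b1 oner_neq0.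
  have mF : measurable_fun setT (fun y : R => \int[lam]_x f (x, y)).
    exact: (measurable_fun_fubini_tonelli_G f mf f0).
  rewrite -(ge0_integral_affine 0 b0 mF); last by move=> x; exact: integral_ge0.
  rewrite b1 mul1e; apply: eq_integral => x _ /=.
  rewrite -(ge0_integral_affine 0 b0 (f := fun y => f (y, b * x + 0)%R))//; last first.
    by apply: measurableT_comp => //; measurability.
  by rewrite b1 mul1e; apply: eq_integral => y _; rewrite a0 !mul0r add0r subr0 !addr0.
(* shear in x, then in y *)
pose g (z : plane R) := f (z.1, b / a * z.1 - a^-1 * z.2)%R.
have mg : measurable_fun setT g.
  by apply: measurableT_comp => //; measurability.
rewrite ge0_integral_area_swap//.
transitivity (`|a^-1|%:E * \int[lam]_y \int[lam]_x g (x, y)).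
  rewrite -ge0_integralZl//; last 2 first.
  - exact: (measurable_fun_fubini_tonelli_G _ mg (fun z => f0 _)).
  - by move=> y _; apply: integral_ge0 => x _; exact: f0.
  apply: eq_integral => y _.
  rewrite -(ge0_integral_affine (b * y) a0 (f := fun x => g (x, y))); last 2 first.
  - by apply: measurableT_comp => //; measurability.
  - by move=> x; exact: f0.
  rewrite muleA -EFinM -normrM mulVf// normr1 mul1e.
  apply: eq_integral => x _; rewrite /g/=; congr (f (_, _)).
  have -> : (a^-1 * y = (a ^+ 2 + b ^+ 2) / a * y)%R by rewrite ab mul1r.
  by field.
rewrite -(fubini_tonelli _ mg (fun z => f0 _)) -ge0_integralZl//; last 2 first.
- exact: (measurable_fun_fubini_tonelli_F _ mg (fun z => f0 _)).
- by move=> y _; apply: integral_ge0 => x _; exact: f0.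
rewrite ge0_integral_area//; apply: eq_integral => x _; rewrite /g/=.
have aN0 : (- a^-1 != 0)%R by rewrite oppr_eq0 invr_eq0.
rewrite -(ge0_integral_affine (b / a * x) aN0 (f := fun y => f (x, y)))//; last first.
  by apply: measurableT_comp => //; measurability.
rewrite normrN; congr (_ * _).
by apply: eq_integral => y _; congr (f (_, _)); rewrite addrC mulNr.
Qed.

(** For v = 0 this is the Euclidean reflection with matrix I - 2 n n^T; otherwise it is an inversion
    in a circle, conjugate to z |-> z / |z|^2 by affine maps. *)
Lemma ge0_integral_area_refl (n : plane R) (v : R) f :
  (n.1 ^+ 2 + n.2 ^+ 2 = 1 + v ^+ 2)%R ->
  measurable_fun setT f -> (forall z, 0 <= f z) ->
  \int[area R]_z (f (refl n v z) * ((refl_den n v z) ^- 2)%R%:E) = \int[area R]_z f z.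
Proof.
move=> nv mf f0.
have [v0|v0] := eqVneq v 0%R.
  rewrite -[RHS](@ge0_integral_area_reflection (1 - 2 * n.1 ^+ 2) (- 2 * n.1 * n.2))//.
    apply: eq_integral => z _; rewrite /refl.
    have -> : refl_den n v z = 1%R.
      by rewrite /refl_den v0 !mul0r !subr0 nv v0 expr0n addr0.
    rewrite expr1n invr1 mule1 !mulr1 /height v0 mul0r subr0.
    congr (f (_, _)); first by ring.
    have -> : (n.1 ^+ 2 = 1 - n.2 ^+ 2)%R by apply/eqP; rewrite eq_sym subr_eq nv v0 expr0n addr0.
    by ring.
  have -> : ((1 - 2 * n.1 ^+ 2) ^+ 2 + (- 2 * n.1 * n.2) ^+ 2 =
      1 + 4 * n.1 ^+ 2 * (n.1 ^+ 2 + n.2 ^+ 2 - 1))%R by ring.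
  by rewrite nv v0 expr0n addr0 subrr mulr0 addr0.
(* The circle has centre c = n / v and squared radius v^-2, so the reflection is z |-> c + v^-2 (z -
   c) / |z - c|^2. *)
pose c1 := (n.1 / v)%R; pose c2 := (n.2 / v)%R.
have v2 : (v ^- 2 != 0)%R by rewrite invr_eq0 expf_neq0.
rewrite -(ge0_integral_area_affine c1 c2 v2 mf f0).
pose g (z : plane R) := f (v ^- 2 * z.1 + c1, v ^- 2 * z.2 + c2)%R.
have mg : measurable_fun setT g.
  by apply: measurableT_comp => //; measurability.
rewrite -(ge0_integral_area_inversion mg); last by move=> z; exact: f0.
set G := (fun z : plane R => g _ * _).
have mG : measurable_fun setT G.
  apply: emeasurable_funM; first by apply: measurableT_comp => //; measurability.
  by apply/measurable_EFinP; measurability.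
have G0 z : 0 <= G z.
  by apply: mule_ge0; [exact: f0|rewrite lee_fin invr_ge0 sqr_ge0].
rewrite -(ge0_integral_area_affine (- c1) (- c2) (oner_neq0 R) mG G0).
rewrite expr1n mul1e -ge0_integralZl//; last 2 first.
- by apply: measurableT_comp => //; measurability.
- by rewrite lee_fin sqr_ge0.
apply: eq_integral => z _; rewrite /G/= /g /= !mul1r.
have dE : refl_den n v z = (v ^+ 2 * ((z.1 - c1) ^+ 2 + (z.2 - c2) ^+ 2))%R.
  by rewrite /refl_den /c1 /c2; field.
have [s0|s0] := eqVneq ((z.1 - c1) ^+ 2 + (z.2 - c2) ^+ 2)%R 0%R.
  by rewrite dE s0 mulr0 expr0n/= invr0 !mule0.
have n1 : n.1 = (c1 * v)%R by rewrite /c1 divfK.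
have n2 : n.2 = (c2 * v)%R by rewrite /c2 divfK.
(* The two formulas for the reflection differ by a multiple of this expression, which vanishes by
   the normalization of (n, v). *)
have vE : (1 + v ^+ 2 - v ^+ 2 * (c1 ^+ 2 + c2 ^+ 2) = 0 :> R)%R.
  by rewrite -nv n1 n2; ring.
rewrite muleCA -EFinM /refl dE /height n1 n2; congr (f (_, _) * EFin _).
- transitivity (v ^- 2 * ((z.1 - c1) / ((z.1 - c1) ^+ 2 + (z.2 - c2) ^+ 2)) + c1
    + (1 + v ^+ 2 - v ^+ 2 * (c1 ^+ 2 + c2 ^+ 2))
      * (c1 / (v ^+ 2 * ((z.1 - c1) ^+ 2 + (z.2 - c2) ^+ 2))))%R.
    by field; rewrite v0 s0.
  by rewrite vE mul0r addr0.
- transitivity (v ^- 2 * ((z.2 - c2) / ((z.1 - c1) ^+ 2 + (z.2 - c2) ^+ 2)) + c2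
    + (1 + v ^+ 2 - v ^+ 2 * (c1 ^+ 2 + c2 ^+ 2))
      * (c2 / (v ^+ 2 * ((z.1 - c1) ^+ 2 + (z.2 - c2) ^+ 2))))%R.
    by field; rewrite v0 s0.
  by rewrite vE mul0r addr0.
- by field; rewrite v0 s0.
Qed.

End area_substitution.

(** * Reflections and the kernel in coordinates *)
Section reflection_algebra.
Context (R : realType).
Implicit Types (n z w : plane R) (v : R).

Definition defect z : R := 1 - z.1 ^+ 2 - z.2 ^+ 2.

Definition sqdist z w : R := (z.1 - w.1) ^+ 2 + (z.2 - w.2) ^+ 2.

Lemma diskE z : disk z <-> 0 < defect z.
Proof.
rewrite /disk/= /defect -(@expr_lt1 _ 2)// ?sqrtr_ge0// modulus_sqr.
by split=> ?; lra.
Qed.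

Lemma sqdist_ge0 z w : 0 <= sqdist z w.
Proof. by rewrite addr_ge0// sqr_ge0. Qed.

Lemma sqdist_eq0 z w : sqdist z w = 0 -> z = w.
Proof.
move=> /eqP; rewrite paddr_eq0 ?sqr_ge0// !sqrf_eq0 !subr_eq0 => /andP[/eqP a /eqP b].
by case: z w a b => [? ?] [? ?] /= -> ->.
Qed.

Lemma sqdist_gt0 z w : z <> w -> 0 < sqdist z w.
Proof.
by move=> zw; rewrite lt0r sqdist_ge0 andbT; apply/eqP => /sqdist_eq0.
Qed.

Lemma sqdist_lt4 z w : disk z -> disk w -> sqdist z w < 4.
Proof.
move=> /diskE + /diskE; rewrite /defect /sqdist => z1 w1.
have := sqr_ge0 (z.1 + w.1); have := sqr_ge0 (z.2 + w.2).
nra.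
Qed.

Lemma defect_le1 z : defect z <= 1.
Proof.
by rewrite /defect; have := sqr_ge0 z.1; have := sqr_ge0 z.2; lra.
Qed.

Variables (n : plane R) (v : R).
Hypothesis nv : n.1 ^+ 2 + n.2 ^+ 2 = 1 + v ^+ 2.

Local Notation h := (height n v).
Local Notation den := (refl_den n v).
Local Notation sigma := (refl n v).

Lemma refl_denE z : den z = 1 - v * h z.
Proof.
transitivity (n.1 ^+ 2 + n.2 ^+ 2 - v ^+ 2 - v * h z); last by rewrite nv; ring.
by rewrite /refl_den /height; ring.
Qed.

(** The denominator |n - v z|^2 could vanish only at the inversion centre n / v, and there |n|^2 = 1
    + v^2 contradicts |z| < 1. *)
Lemma refl_den_gt0 z : disk z -> 0 < den z.
Proof.
move=> /diskE dz.
have d0 : 0 <= den z by rewrite addr_ge0// sqr_ge0.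
rewrite lt0r d0 andbT; apply/eqP => /eqP.
rewrite paddr_eq0 ?sqr_ge0// !sqrf_eq0 !subr_eq0 => /andP[/eqP a /eqP b].
move: nv dz; rewrite a b /defect => e dz.
have := mulr_ge0 (sqr_ge0 v) (ltW dz); nra.
Qed.

Section pointwise.
Variable z : plane R.
Hypothesis dz : den z != 0.

Lemma defect_refl : defect (sigma z) = defect z / den z.
Proof.
have d0 : 1 - v * h z != 0 by rewrite -refl_denE.
rewrite /defect /refl/= refl_denE.
transitivity (((1 - v * h z) ^+ 2 - (z.1 ^+ 2 + z.2 ^+ 2)
   + 2 * (n.1 * z.1 + n.2 * z.2) * h z - (n.1 ^+ 2 + n.2 ^+ 2) * h z ^+ 2)
     / (1 - v * h z) ^+ 2).
  by field.
rewrite nv.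
have -> : 2 * (n.1 * z.1 + n.2 * z.2) = h z + v * (1 + z.1 ^+ 2 + z.2 ^+ 2).
  by rewrite /height; ring.
by field.
Qed.

(** In the hyperboloid <X, N> changes sign; the denominator comes from dividing by the defect, which
    transforms by [defect_refl]. *)
Lemma height_refl : h (sigma z) = - h z / den z.
Proof.
have d0 : 1 - v * h z != 0 by rewrite -refl_denE.
have E : h (sigma z) = (2 * (n.1 * z.1 + n.2 * z.2) - 2 * (n.1 ^+ 2 + n.2 ^+ 2) * h z) / (1 - v * h z)
   - 2 * v + v * defect (sigma z).
  rewrite {1}/height /defect /refl/= refl_denE; field => //.
rewrite E defect_refl nv refl_denE.
have -> : 2 * (n.1 * z.1 + n.2 * z.2) = h z + v * (1 + z.1 ^+ 2 + z.2 ^+ 2).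
  by rewrite /height; ring.
by rewrite /defect; field.
Qed.

Lemma refl_den_refl : den (sigma z) = (den z)^-1.
Proof.
rewrite refl_denE height_refl refl_denE; field.
by rewrite -refl_denE.
Qed.

Lemma refl_involutive : sigma (sigma z) = z.
Proof.
have d0 : 1 - v * h z != 0 by rewrite -refl_denE.
rewrite {1}/refl refl_den_refl height_refl invrK /refl/= refl_denE.
by rewrite [RHS]surjective_pairing; congr (_, _); field.
Qed.

(** The Lorentz identity <X - 2 <X, N> N, Y> = <X, Y> - 2 <X, N> <Y, N> in disk coordinates. The
    sign of the product of heights decides whether w is nearer to z or to its mirror image. *)
Lemma sqdist_refl_r w : sqdist w (sigma z) = (sqdist w z + h w * h z) / den z.
Proof.
have d0 : 1 - v * h z != 0 by rewrite -refl_denE.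
rewrite /sqdist /refl/= refl_denE.
transitivity ((w.1 ^+ 2 + w.2 ^+ 2)
   - 2 * ((w.1 * z.1 + w.2 * z.2) - h z * (n.1 * w.1 + n.2 * w.2)) / (1 - v * h z)
   + (1 - defect (sigma z))).
  by rewrite /defect /refl/= refl_denE; field.
rewrite defect_refl refl_denE /defect.
have -> : h w = 2 * (n.1 * w.1 + n.2 * w.2) - v * (1 + w.1 ^+ 2 + w.2 ^+ 2) by [].
by field.
Qed.

End pointwise.

Lemma disk_refl z : disk z -> disk (sigma z).
Proof.
move=> dz; have d0 := refl_den_gt0 dz; apply/diskE.
by rewrite defect_refl ?gt_eqF// divr_gt0//; apply/diskE.
Qed.

Lemma sqdist_refl z w : disk z -> disk w ->
  sqdist (sigma z) (sigma w) = sqdist z w / (den z * den w).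
Proof.
move=> dz dw.
have z0 : den z != 0 by rewrite gt_eqF// refl_den_gt0.
have w0 : den w != 0 by rewrite gt_eqF// refl_den_gt0.
rewrite sqdist_refl_r//.
have -> : sqdist (sigma z) w = sqdist w (sigma z) by rewrite /sqdist; ring.
rewrite sqdist_refl_r// height_refl//.
have -> : sqdist w z = sqdist z w by rewrite /sqdist; ring.
by field; rewrite z0 w0.
Qed.

End reflection_algebra.

Section kernel.
Context (R : realType).
Implicit Types (n z w : plane R) (v : R).

(* On the diagonal both sides of [ln_pseudo_dist] take the junk value 0. *)
Definition kern z w : R := ln (1 + defect z * defect w / sqdist z w) / 2.

Lemma pseudo_dist_sqr z w :
  pseudo_dist z w ^+ 2 = sqdist z w / (sqdist z w + defect z * defect w).
Proof.
rewrite /pseudo_dist /modulus ComplexField.Normc.normcM exprMn.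
have -> : ComplexField.Normc.normc (cplx z - cplx w) ^+ 2 = sqdist z w.
  by rewrite /= sqr_sqrtr// addr_ge0// sqr_ge0.
rewrite ComplexField.Normc.normcV exprVn; congr (_ / _).
rewrite /cplx/= sqr_sqrtr ?addr_ge0 ?sqr_ge0//.
by rewrite /sqdist /defect; ring.
Qed.

Lemma ln_pseudo_dist z w : disk z -> disk w ->
  ln ((pseudo_dist z w)^-1) = kern z w.
Proof.
move=> dz dw.
have p0 : 0 <= pseudo_dist z w by exact: sqrtr_ge0.
have q0 : 0 < defect z * defect w by rewrite mulr_gt0//; exact/diskE.
have s0 := sqdist_ge0 z w.
have E := pseudo_dist_sqr z w.
have [s00|sn0] := eqVneq (sqdist z w) 0.
  have /eqP : pseudo_dist z w ^+ 2 = 0 by rewrite E s00 mul0r.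
  rewrite sqrf_eq0 => /eqP ->.
  by rewrite /kern s00 !invr0 mulr0 addr0 ln1 mul0r ln0.
have sp : 0 < sqdist z w by rewrite lt0r sn0.
have pp : 0 < pseudo_dist z w.
  by rewrite lt0r p0 andbT -sqrf_eq0 E gt_eqF// divr_gt0// addr_gt0.
rewrite /kern.
have -> : 1 + defect z * defect w / sqdist z w = ((pseudo_dist z w)^-1) ^+ 2.
  by rewrite exprVn E invf_div; field.
by rewrite lnXn ?invr_gt0// -mulr_natr; field.
Qed.

Lemma kern_ge0 z w : disk z -> disk w -> 0 <= kern z w.
Proof.
move=> /diskE dz /diskE dw; rewrite divr_ge0// ln_ge0// lerDl.
by rewrite divr_ge0 ?sqdist_ge0// mulr_ge0// ltW.
Qed.

Lemma measurable_kern : measurable_fun setT (fun p : plane R * plane R => kern p.1 p.2).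
Proof.
rewrite /kern; apply: measurable_funM => //.
apply: measurableT_comp; first exact: measurable_ln.
rewrite /defect /sqdist.
have m11 : measurable_fun setT (fun p : plane R * plane R => p.1.1).
  exact: (measurableT_comp measurable_fst measurable_fst).
have m12 : measurable_fun setT (fun p : plane R * plane R => p.1.2).
  exact: (measurableT_comp measurable_snd measurable_fst).
have m21 : measurable_fun setT (fun p : plane R * plane R => p.2.1).
  exact: (measurableT_comp measurable_fst measurable_snd).
have m22 : measurable_fun setT (fun p : plane R * plane R => p.2.2).
  exact: (measurableT_comp measurable_snd measurable_snd).
by measurability.
Qed.

(** Two points of the disk satisfy |z - w|^2 < 4, so defects bounded below keep the kernel away from
    0. The diagonal is excluded because the kernel is 0 there. *)
Lemma kern_lower (q : R) z w : 0 < q -> disk z -> disk w -> q <= defect z -> q <= defect w ->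
  z <> w -> ln (1 + q ^+ 2 / 4) / 2 <= kern z w.
Proof.
move=> q0 dz dw qz qw zw; rewrite /kern ler_pM2r//.
have s0 := sqdist_gt0 zw; have s4 := sqdist_lt4 dz dw.
have hz : 0 < defect z by exact/diskE.
have hw : 0 < defect w by exact/diskE.
rewrite ler_ln ?posrE; last 2 first.
- by rewrite addr_gt0// divr_gt0// exprn_gt0.
- by rewrite addr_gt0// divr_gt0// mulr_gt0.
rewrite lerD2l ler_pM// ?sqr_ge0//.
  by rewrite expr2 ler_pM// ltW.
by rewrite lef_pV2 ?posrE// ltW.
Qed.

(** A logarithm is dominated by any negative power of the distance; the bound uses one coordinate
    only, so that it can be integrated one variable at a time. *)
Lemma kern_upper z w : disk z -> disk w -> z.1 <> w.1 ->
  kern z w ^+ 2 <= 16 * Num.sqrt (`|z.1 - w.1|^-1).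
Proof.
move=> dz dw zw1; set d := `|z.1 - w.1|.
have d0 : 0 < d by rewrite normr_gt0 subr_eq0; exact/eqP.
set y := d^-1; have y0 : 0 < y by rewrite invr_gt0.
(* r is the power -1/4 of the distance of the first coordinates: its square, the power -1/2, is
   integrable at 0 on the line. *)
set r := Num.sqrt (Num.sqrt y).
have r0 : 0 < r by rewrite !sqrtr_gt0.
have r2 : r ^+ 2 = Num.sqrt y by rewrite sqr_sqrtr// sqrtr_ge0.
have r4 : r ^+ 4 = y by rewrite (exprM r 2 2) r2 sqr_sqrtr// ltW.
have zw : z <> w by move=> e; apply: zw1; rewrite e.
have s0 := sqdist_gt0 zw.
have hz : 0 < defect z by exact/diskE.
have hw : 0 < defect w by exact/diskE.
suff K : kern z w <= 4 * r.
  have -> : 16 * Num.sqrt y = (4 * r) ^+ 2 by rewrite exprMn r2 -natrX.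
  by rewrite ler_pXn2r// ?nnegrE ?kern_ge0// mulr_ge0// ltW.
rewrite /kern ler_pdivrMr//.
have -> : 4 * r * 2 = ln (expR r ^+ 8).
  by rewrite lnXn ?expR_gt0// expRK -mulr_natr; ring.
rewrite ler_ln ?posrE; last 2 first.
- by rewrite addr_gt0// divr_gt0// mulr_gt0.
- by rewrite exprn_gt0// expR_gt0.
(* The chain is exp(r)^8 >= (1 + r)^8 >= 1 + r^8 = 1 + y^2, the middle inequality being 1 + a^2 <=
   (1 + a)^2 applied three times. *)
apply: (@le_trans _ _ ((1 + r) ^+ 8)); last first.
  rewrite ler_pXn2r ?nnegrE ?expR_ge0 ?expR_ge1Dx//.
  by rewrite addr_ge0// ltW.
apply: (@le_trans _ _ (1 + y ^+ 2)).
  rewrite lerD2l -(mul1r (y ^+ 2)) ler_pM//.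
  - by rewrite mulr_ge0// ltW.
  - by rewrite invr_ge0 ltW.
  - by rewrite mulr_ile1 ?defect_le1// ltW.
  - rewrite /y exprVn lef_pV2 ?posrE ?exprn_gt0// /d real_normK ?num_real//.
    by rewrite /sqdist lerDl sqr_ge0.
rewrite -r4 -exprM/=.
have sq (a : R) : 0 <= a -> 1 + a ^+ 2 <= (1 + a) ^+ 2.
  by move=> a0; rewrite sqrrD expr1n mul1r lerD2r lerDl mulrn_wge0.
have rr := ltW r0.
rewrite (exprM r 4 2) (exprM (1 + r) 4 2) (exprM r 2 2) (exprM (1 + r) 2 2).
apply: le_trans (sq _ _) _; first by rewrite exprn_ge0// exprn_ge0.
rewrite ler_pXn2r ?nnegrE ?exprn_ge0 ?addr_ge0 ?exprn_ge0//.
apply: le_trans (sq _ _) _; first by rewrite exprn_ge0.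
by rewrite ler_pXn2r ?nnegrE ?exprn_ge0 ?addr_ge0 ?exprn_ge0// sq.
Qed.

Variables (n : plane R) (v : R).
Hypothesis nv : n.1 ^+ 2 + n.2 ^+ 2 = 1 + v ^+ 2.

Local Notation h := (height n v).
Local Notation den := (refl_den n v).
Local Notation sigma := (refl n v).

Lemma kern_refl z w : disk z -> disk w -> kern (sigma z) (sigma w) = kern z w.
Proof.
move=> dz dw; rewrite /kern.
have z0 : den z != 0 by rewrite gt_eqF// refl_den_gt0.
have w0 : den w != 0 by rewrite gt_eqF// refl_den_gt0.
rewrite sqdist_refl// !defect_refl//; congr (ln (1 + _) / 2).
have [->|s0] := eqVneq (sqdist z w) 0; first by rewrite mul0r !invr0 !mulr0.
by field; rewrite s0 z0 w0.
Qed.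

Lemma kern_refl_r z w : disk z -> disk w -> kern z (sigma w) =
  ln (1 + defect z * defect w / (sqdist z w + h z * h w)) / 2.
Proof.
move=> dz dw; rewrite /kern.
have z0 : den z != 0 by rewrite gt_eqF// refl_den_gt0.
have w0 : den w != 0 by rewrite gt_eqF// refl_den_gt0.
rewrite sqdist_refl_r// !defect_refl//; congr (ln (1 + _) / 2).
have [->|s0] := eqVneq (sqdist z w + h z * h w) 0; first by rewrite mul0r !invr0 !mulr0.
by field; rewrite s0 w0.
Qed.

(** Quantitative form of [kern_le]: replacing [sigma w] by w removes the product of heights from the
    denominator inside the logarithm, and [q] makes the resulting gain uniform. *)
Lemma kern_gain (q : R) z w : 0 < q -> disk z -> disk w ->
  q <= defect z -> q <= defect w -> q <= defect (sigma w) -> 0 <= h z * h w -> z <> w ->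
  kern z (sigma w) + q ^+ 3 / 40 * (h z * h w) <= kern z w.
Proof.
move=> q0 dz dw qz qw qsw hh zw.
have w0 := refl_den_gt0 nv dw; have wn0 : den w != 0 by rewrite gt_eqF.
rewrite kern_refl_r// /kern.
have a0 := sqdist_gt0 zw.
have aHE := sqdist_refl_r nv wn0 z.
have qwE := defect_refl nv wn0.
have a4 := sqdist_lt4 dz dw.
have b4 := sqdist_lt4 dz (disk_refl nv dw).
have z1 := defect_le1 z; have w1 := defect_le1 w.
(* [refl_den] is the ratio of the defects of w and [sigma w], at most 1 / q. *)
have dw4 : den w <= q^-1.
  have : q * den w <= 1.
    apply: le_trans w1; have -> : defect w = defect (sigma w) * den w by rewrite qwE divfK.
    by rewrite ler_wpM2r// ltW.
  by rewrite mulrC -ler_pdivlMr ?div1r.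
set a := sqdist z w in a0 aHE a4 *; set H := h z * h w in hh aHE *.
set Q := defect z * defect w.
have Q2 : q ^+ 2 <= Q by rewrite expr2 ler_pM// ltW.
have Q0 : 0 < Q by rewrite (lt_le_trans _ Q2)// exprn_gt0.
have Q1 : Q <= 1 by rewrite mulr_ile1// (le_trans (ltW q0)).
have aH : a + H <= 4 / q.
  have -> : a + H = sqdist z (sigma w) * den w by rewrite aHE divfK.
  by rewrite ler_pM ?sqdist_ge0// ltW.
have aH0 : 0 < a + H by rewrite ltr_wpDr.
have aQ0 : 0 < a + Q by exact: addr_gt0.
have A0 : 0 < 1 + Q / a by rewrite addr_gt0// divr_gt0.
have B0 : 0 < 1 + Q / (a + H) by rewrite addr_gt0// divr_gt0.
(* ln t <= t - 1 at the ratio t of the two arguments. *)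
have L : ln (1 + Q / (a + H)) - ln (1 + Q / a) <= - (Q * H / ((a + H) * (a + Q))).
  have -> : - (Q * H / ((a + H) * (a + Q))) = (1 + Q / (a + H)) / (1 + Q / a) - 1.
    by field; rewrite !gt_eqF// addr_gt0.
  rewrite -ln_div ?posrE//; set t := _ / _; have t0 : 0 < t by rewrite divr_gt0.
  have := @le_ln1Dx R (t - 1); rewrite subrKC; apply.
  by rewrite ltrBrDr addNr.
(* Q >= q^2, a + H <= 4 / q and a + Q <= 5 give the constant q^3 / 20; the factor 1/2 in [kern]
   turns it into q^3 / 40. *)
have G : q ^+ 3 / 20 * H <= Q * H / ((a + H) * (a + Q)).
  have -> : Q * H / ((a + H) * (a + Q)) = Q / ((a + H) * (a + Q)) * H by field; rewrite !gt_eqF// addr_gt0.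
  rewrite ler_wpM2r// ler_pdivlMr ?mulr_gt0//.
  have q3 : 0 <= q ^+ 3 / 20 by rewrite divr_ge0// exprn_ge0// ltW.
  apply: (@le_trans _ _ (q ^+ 3 / 20 * (4 / q * 5))).
    rewrite ler_wpM2l// ler_pM//; [exact: ltW|by rewrite addr_ge0// ltW|].
    by move: a4 Q1; clear; lra.
  by rewrite (_ : _ * _ = q ^+ 2)//; field; rewrite gt_eqF.
have -> : q ^+ 3 / 40 * H = (q ^+ 3 / 20 * H) / 2 by field.
by rewrite -mulrDl ler_pM2r// -lerBrDl (le_trans G)// -lerN2 opprB.
Qed.

Lemma kern_le z w : disk z -> disk w -> 0 <= h z * h w -> z <> w ->
  kern z (sigma w) <= kern z w.
Proof.
move=> dz dw hh zw.
rewrite kern_refl_r// /kern ler_pM2r//.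
have s0 := sqdist_gt0 zw.
have hz : 0 < defect z by exact/diskE.
have hw : 0 < defect w by exact/diskE.
have hp := mulr_gt0 hz hw.
have t0 : 0 < sqdist z w + h z * h w by rewrite ltr_wpDr.
rewrite ler_ln ?posrE ?addr_gt0 ?divr_gt0// lerD2l ler_pM2l// lef_pV2// ?posrE//.
by rewrite lerDl.
Qed.

End kernel.

(** * Geodesics and their polarizers *)
Section plane_topology.
Context (R : realType).
Implicit Types (n z w : plane R) (v : R).

(** The sigma-algebra is the product of the Borel ones, so an open set is written as a countable
    union of boxes with rational corners. *)
Lemma open_plane_measurable (O : set (plane R)) : open O -> measurable O.
Proof.
move=> oO.
pose box (q : rat * rat * (rat * rat)) : set (plane R) :=
  (`](ratr q.1.1 : R), ratr q.1.2[%classic : set R) `*` (`](ratr q.2.1 : R), ratr q.2.2[%classic : set R).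
have mbox q : measurable (box q) by apply: measurableX; exact: measurable_itv.
have -> : O = \bigcup_(q in [set q | box q `<=` O]) box q.
  apply/seteqP; split=> [z Oz|z [q qO /qO]//].
  have : nbhs z O by exact: open_nbhs_nbhs.
  rewrite -nbhs_ballE => -[e /= e0 zO].
  have sq (x : R) : exists q : rat * rat,
      [/\ ratr q.1 < x, x < ratr q.2, x - e < ratr q.1 & ratr q.2 < x + e].
    have [|a] := @rat_in_itvoo R (x - e) x; first by rewrite ltrBlDr ltrDl.
    have [|b] := @rat_in_itvoo R x (x + e); first by rewrite ltrDl.
    by rewrite !in_itv/= => /andP[? ?] /andP[? ?]; exists (a, b).
  have [q1 [q11 q12 q13 q14]] := sq z.1.
  have [q2 [q21 q22 q23 q24]] := sq z.2.
  exists (q1, q2); last by split; rewrite /= in_itv/=; apply/andP.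
  move=> w [/=]; rewrite !in_itv/= => /andP[w11 w12] /andP[w21 w22]; apply: zO.
  by split; rewrite /ball/= ltr_norml; apply/andP; split; lra.
rewrite bigcup_mkcond; apply: countable_bigcupT_measurable; first exact: countableP.
by move=> q; case: ifPn.
Qed.

Lemma starshaped_connected (S : set (plane R)) (p : plane R) :
  S p -> (forall z t, S z -> 0 <= t <= 1 ->
    S (p.1 + t * (z.1 - p.1), p.2 + t * (z.2 - p.2))) -> connected S.
Proof.
move=> Sp star.
pose f (z : plane R) (t : R) : plane R := (p.1 + t * (z.1 - p.1), p.2 + t * (z.2 - p.2)).
have -> : S = \bigcup_(z in S) (f z @` `[0, 1]).
  apply/seteqP; split=> [z Sz|z [w Sw [t]]].
    exists z => //; exists 1; first by rewrite /= in_itv/= ler01 lexx.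
    by rewrite /f !mul1r !subrKC; case: z {Sz}.
  by rewrite /= in_itv/= => t01 <-; exact: star.
apply: bigcup_connected.
  exists p => z Sz; exists 0; first by rewrite /= in_itv/= lexx ler01.
  by rewrite /f !mul0r !addr0; case: p {f star Sp}.
move=> z Sz; apply: connected_continuous_connected; first exact: segment_connected.
apply: continuous_subspaceT => t.
have cg (a b : R) : continuous (fun t : R => a + t * b : R).
  move=> u; apply: cvgD; first exact: cvg_cst.
  by apply: cvgM; [exact: cvg_id|exact: cvg_cst].
exact: (cvg_pair (cg p.1 (z.1 - p.1) t) (cg p.2 (z.2 - p.2) t)).
Qed.

Lemma continuous_height n v : continuous (height n v : plane R -> R).
Proof.
have c1 : continuous (fun z : plane R => z.1 : R) by move=> z; exact: cvg_fst.
have c2 : continuous (fun z : plane R => z.2 : R) by move=> z; exact: cvg_snd.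
move=> z; apply: cvgB.
  apply: cvgM; first exact: cvg_cst.
  by apply: cvgD; (apply: cvgM; first exact: cvg_cst); [exact: c1|exact: c2].
apply: cvgM; first exact: cvg_cst.
apply: cvgD; [apply: cvgD; first exact: cvg_cst|]; rewrite /=.
  by apply: (@continuousM _ _ (fun z : plane R => z.1) (fun z : plane R => z.1)); exact: c1.
by apply: (@continuousM _ _ (fun z : plane R => z.2) (fun z : plane R => z.2)); exact: c2.
Qed.

(** The height cannot change sign on a connected set avoiding the geodesic, and the positive side is
    itself connected, being star-shaped. *)
Lemma polarizer_side n v (x : plane R) : 
  disk x -> 0 < height n v x ->
  connected_component (@disk R `\` (@disk R `&` [set z | height n v z = 0])) x =
  @disk R `&` [set z | 0 < height n v z].
Proof.
move=> dx hx; set C := connected_component _ _.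
have Cx : C x by apply: connected_component_refl; split=> // -[_ /= h0]; move: hx; rewrite h0 ltxx.
apply/seteqP; split.
  move=> z Cz; have [dz nz] := connected_component_sub Cz.
  split=> //=; rewrite ltNge; apply/negP => hz.
  have /connected_intervalP : connected (height n v @` C).
    apply: connected_continuous_connected; first exact: component_connected.
    exact/continuous_subspaceT/continuous_height.
  move=> /(_ (height n v z) (height n v x)) /(_ _ _ 0) [].
  - by exists z.
  - by exists x.
  - by rewrite hz ltW.
  move=> y Cy hy; have [dy] := connected_component_sub Cy.
  by apply.
have key : connected (@disk R `&` [set z | 0 < height n v z]).
  have cvx (a b t : R) : 0 < a -> 0 < b -> 0 <= t <= 1 -> 0 < (1 - t) * a + t * b.
    move=> a0 b0 /andP[t0 t1]; have [->|tn0] := eqVneq t 0; first by rewrite subr0 mul1r mul0r addr0.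
    by rewrite ltr_wpDl ?mulr_ge0 ?subr_ge0// ?ltW// mulr_gt0// lt0r tn0.
  (* For v >= 0 the height is concave, so the side is convex and star-shaped about x. *)
  have [v0|v0] := leP 0 v.
    apply: (@starshaped_connected _ x) => // z t [dz /= hz] t01.
    have tt : 0 <= t * (1 - t) * sqdist z x.
      by case/andP: t01 => *; rewrite mulr_ge0 ?sqdist_ge0// mulr_ge0// subr_ge0.
    split.
      apply/diskE; rewrite (_ : defect _ = (1 - t) * defect x + t * defect z + t * (1 - t) * sqdist z x).
        by rewrite ltr_wpDr// cvx//; exact/diskE.
      by rewrite /defect /sqdist/=; ring.
    rewrite /= (_ : height _ _ _ = (1 - t) * height n v x + t * height n v z + v * (t * (1 - t) * sqdist z x)).
      by apply: ltr_wpDr; [exact: mulr_ge0|exact: cvx].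
    by rewrite /height /sqdist/=; ring.
  (* For v < 0 the side lies outside a circle and need not be convex, but it contains the origin and
     is star-shaped about it. *)
  apply: (@starshaped_connected _ (0, 0)).
    split; first by apply/diskE; rewrite /defect/= expr0n/= !subr0.
    by rewrite /= /height/= expr0n/= !mulr0 !addr0 mulr0 mulr1 sub0r oppr_gt0.
  move=> z t [/diskE dz /= hz] t01; have /andP[t0 t1] := t01.
  have z2 : 0 <= z.1 ^+ 2 + z.2 ^+ 2 by rewrite addr_ge0// sqr_ge0.
  split.
    apply/diskE; rewrite (_ : defect _ = (1 - t) * 1 + t * defect z + t * (1 - t) * (z.1 ^+ 2 + z.2 ^+ 2)).
      by rewrite ltr_wpDr ?cvx// !mulr_ge0// subr_ge0.
    by rewrite /defect /=; ring.
  rewrite /= (_ : height _ _ _ = (1 - t) * (- v * (1 - t * (z.1 ^+ 2 + z.2 ^+ 2))) + t * height n v z).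
    rewrite cvx// mulr_gt0 ?oppr_gt0// subr_gt0.
    by move: dz; rewrite /defect => dz; apply: (@le_lt_trans _ _ (z.1 ^+ 2 + z.2 ^+ 2)); [rewrite ler_piMl|lra].
  by rewrite /height /=; ring.
apply: connected_component_max => // z [dz /= hz]; split=> // -[_ /= h0].
by move: hz; rewrite h0 ltxx.
Qed.

End plane_topology.

Section geodesics.
Context (R : realType).
Implicit Types (n z w c : plane R) (v r t a : R) (G : set (plane R)).

Lemma unit_angle0 (a b : R) : a ^+ 2 + b ^+ 2 = 1 -> 0 <= b ->
  exists2 t : R, 0 <= t <= pi & a = cos t /\ b = sin t.
Proof.
move=> ab b0.
have a1 : -1 <= a <= 1.
  by rewrite -ler_norml -(@expr_le1 _ 2)// real_normK ?num_real//; have := sqr_ge0 b; lra.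
exists (acos a); first by rewrite acos_ge0// acos_lepi.
rewrite sin_acos// acosK ?in_itv//=; split => //.
have -> : 1 - a ^+ 2 = b ^+ 2 by lra.
by rewrite sqrtr_sqr ger0_norm.
Qed.

Lemma unit_angle (a b : R) : a ^+ 2 + b ^+ 2 = 1 ->
  exists t : R, a = cos t /\ b = sin t.
Proof.
move=> ab; have [b0|b0] := leP 0 b.
  by have [t _ ?] := unit_angle0 ab b0; exists t.
have [||t _ [at_ bt]] := @unit_angle0 a (- b); rewrite ?sqrrN ?oppr_ge0 ?(ltW b0)//.
by exists (- t); rewrite cosN sinN -bt opprK.
Qed.

Lemma line0_angle t : exists2 t', 0 <= t' < pi & line0 t' = line0 t.
Proof.
have [t' t'01 [e e0 [ct st]]] : exists2 t', 0 <= t' < pi & exists2 e : R, e != 0 &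
    cos t' = e * cos t /\ sin t' = e * sin t.
  have cs := cos2Dsin2 t.
  have key (e : R) : e ^+ 2 = 1 -> 0 <= e * sin t -> exists2 t', 0 <= t' < pi &
      exists2 e : R, e != 0 & cos t' = e * cos t /\ sin t' = e * sin t.
    move=> e2 es; have [||t' /andP[t0 tpi] [ct st]] := @unit_angle0 (e * cos t) (e * sin t) => //.
      by rewrite !exprMn e2 !mul1r.
    have en0 : e != 0 by rewrite -sqrf_eq0 e2 oner_neq0.
    have [tp|tp] := eqVneq t' pi; last first.
      by exists t'; [rewrite t0 lt_neqAle tp|exists e].
    (* The angle pi is outside the admissible range; the angle 0 gives the same line with the
       opposite direction. *)
    exists 0; first by rewrite lexx pi_gt0.
    exists (- e); first by rewrite oppr_eq0.
    by rewrite !mulNr ct st tp cos0 sin0 cospi sinpi opprK oppr0.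
  have [s0|s0] := leP 0 (sin t).
    by apply: (key 1); rewrite ?expr1n ?mul1r.
  by apply: (key (-1)); rewrite ?sqrrN ?expr1n// mulN1r oppr_ge0 ltW.
exists t' => //.
apply/seteqP; split=> z [s ->].
  by exists (s * e); rewrite ct st !mulrA.
exists (s / e); rewrite ct st; congr (_, _); field => //.
Qed.

Lemma line0E t : line0 t = [set z | height (- sin t, cos t) 0 z = 0].
Proof.
have cs := cos2Dsin2 t.
apply/seteqP; split=> z /=.
  by move=> [s ->]; rewrite /height/=; ring.
rewrite /height/= => h0; exists (z.1 * cos t + z.2 * sin t).
have h0' : - sin t * z.1 + cos t * z.2 = 0 by move: h0; rewrite mul0r subr0; lra.
rewrite [LHS]surjective_pairing; congr (_, _).
  transitivity (z.1 * (cos t ^+ 2 + sin t ^+ 2) + (- sin t * z.1 + cos t * z.2) * sin t).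
    by rewrite cs h0' mul0r addr0 mulr1.
  ring.
transitivity (z.2 * (cos t ^+ 2 + sin t ^+ 2) - (- sin t * z.1 + cos t * z.2) * cos t).
  by rewrite cs h0' mul0r subr0 mulr1.
ring.
Qed.

Lemma reflection_line G : diameter_angle G !=set0 ->
  exists t, G = @disk R `&` line0 t /\
   forall z, reflection G z = refl (- sin t, cos t) 0 z.
Proof.
move=> ne; have /(xgetPex 0) : exists t, diameter_angle G t by [].
set t := xget 0 _ => -[_ Gt]; exists t; split => // w.
rewrite /reflection asboolT// -/t.
have cs := cos2Dsin2 t.
have c2 : cos t ^+ 2 = 1 - sin t ^+ 2 by rewrite -cs; ring.
have sc : sin t ^+ 2 + cos t ^+ 2 = 1 by rewrite addrC.
rewrite /pt /refl /refl_den /height/= !mul0r !subr0 sqrrN sc !divr1.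
have -> : cos (2 * t) = 1 - 2 * sin t ^+ 2.
  by rewrite (_ : 2 * t = t + t) ?cosD -?expr2 ?c2; ring.
have -> : sin (2 * t) = 2 * sin t * cos t.
  by rewrite (_ : 2 * t = t + t) ?sinD; ring.
congr (_, _); first by ring.
transitivity (2 * sin t * cos t * w.1 + w.2 - 2 * cos t ^+ 2 * w.2); [rewrite c2|]; ring.
Qed.

End geodesics.

Local Notation rot := Defs.rot.

Section circle_geodesics.
Context (R : realType).
Implicit Types (z w : plane R) (t a : R).

Lemma circleP (c : plane R) (r : R) z : 0 < r ->
  circle c r z <-> (z.1 - c.1) ^+ 2 + (z.2 - c.2) ^+ 2 = r ^+ 2.
Proof.
move=> r0; rewrite /circle/= /modulus/=; split=> [<-|->].
  by rewrite sqr_sqrtr// addr_ge0// sqr_ge0.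
by rewrite sqrtr_sqr ger0_norm// ltW.
Qed.

Lemma rotE t z : rot t z = (z.1 * cos t - z.2 * sin t, z.1 * sin t + z.2 * cos t).
Proof. by rewrite /rot /pt/=; congr (_, _); ring. Qed.

Lemma orthogonal_unit_circle (c : plane R) (r : R) : 0 < r ->
  orthogonal_circles c (0, 0) r 1 -> c.1 ^+ 2 + c.2 ^+ 2 = 1 + r ^+ 2.
Proof.
move=> r0 [[p [cp up]] /(_ p cp up)/= o].
move/circleP : cp => /(_ r0) cp; move/circleP : up => /(_ ltr01)/= up.
by rewrite expr1n in up; rewrite -cp; nra.
Qed.

Variables (c : plane R) (r : R).
Hypotheses (r_gt0 : 0 < r) (cr : c.1 ^+ 2 + c.2 ^+ 2 = 1 + r ^+ 2).

Local Notation G := (@disk R `&` circle c r).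

Lemma circle_height :
  circle c r = [set z | height (c.1 / r, c.2 / r) r^-1 z = 0].
Proof.
have rn0 : r != 0 by rewrite gt_eqF.
have E z : height (c.1 / r, c.2 / r) r^-1 z =
    (r ^+ 2 - ((z.1 - c.1) ^+ 2 + (z.2 - c.2) ^+ 2)) / r.
  have -> : r ^+ 2 = c.1 ^+ 2 + c.2 ^+ 2 - 1 by rewrite cr; ring.
  by rewrite /height/=; field.
apply/seteqP; split=> z.
  by move=> /circleP -/(_ r_gt0) zr; rewrite /= E zr subrr mul0r.
rewrite /= E => /eqP; rewrite mulf_eq0 invr_eq0 (negbTE rn0) orbF subr_eq0 => /eqP zr.
exact/circleP.
Qed.

Lemma circle_memE z : circle c r z <-> 1 + z.1 ^+ 2 + z.2 ^+ 2 = 2 * (c.1 * z.1 + c.2 * z.2).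
Proof.
split => [/circleP -/(_ r_gt0) e|e]; first by move: cr e; lra.
by apply/circleP => //; move: cr e; lra.
Qed.

Let c1 t := c.1 * cos t - c.2 * sin t.
Let c2 t := c.1 * sin t + c.2 * cos t.

Lemma rot_mem t w : (rot t @` G) w <->
  w.1 ^+ 2 + w.2 ^+ 2 < 1 /\ 1 + w.1 ^+ 2 + w.2 ^+ 2 = 2 * (c1 t * w.1 + c2 t * w.2).
Proof.
have cs := cos2Dsin2 t.
have N (x y : R) : (x * cos t - y * sin t) ^+ 2 + (x * sin t + y * cos t) ^+ 2 = x ^+ 2 + y ^+ 2.
  transitivity ((x ^+ 2 + y ^+ 2) * (cos t ^+ 2 + sin t ^+ 2)); last by rewrite cs mulr1.
  by ring.
split.
  move=> [z [/diskE dz /circle_memE cz] <-]; rewrite rotE/= -addrA N.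
  split; first by move: dz; rewrite /defect; lra.
  rewrite addrA cz /c1 /c2.
  transitivity (2 * (c.1 * z.1 + c.2 * z.2) * (cos t ^+ 2 + sin t ^+ 2)); last by ring.
  by rewrite cs mulr1.
move=> [w1 cw].
exists (w.1 * cos t + w.2 * sin t, - w.1 * sin t + w.2 * cos t).
  have N2 : (w.1 * cos t + w.2 * sin t) ^+ 2 + (- w.1 * sin t + w.2 * cos t) ^+ 2 = w.1 ^+ 2 + w.2 ^+ 2.
    transitivity ((w.1 ^+ 2 + w.2 ^+ 2) * (cos t ^+ 2 + sin t ^+ 2)); last by rewrite cs mulr1.
    by ring.
  split; first by apply/diskE; rewrite /defect/= -addrA -opprD N2 subr_gt0.
  by apply/circle_memE; rewrite /= -addrA N2 addrA cw /c1 /c2; ring.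
rewrite rotE/= [RHS]surjective_pairing; congr (_, _).
  transitivity (w.1 * (cos t ^+ 2 + sin t ^+ 2)); last by rewrite cs mulr1.
  by ring.
transitivity (w.2 * (cos t ^+ 2 + sin t ^+ 2)); last by rewrite cs mulr1.
by ring.
Qed.


Lemma normalizing_nonempty : exists p, normalizing G p.
Proof.
set m := Num.sqrt (1 + r ^+ 2).
have m2 : m ^+ 2 = 1 + r ^+ 2 by rewrite sqr_sqrtr// addr_ge0// sqr_ge0.
have m0 : 0 < m by rewrite sqrtr_gt0 ltr_pwDl// sqr_ge0.
have mn0 : m != 0 by rewrite gt_eqF.
(* Rotation by minus the argument of the centre, which moves it to the point m = |c| of the positive
   real axis. *)
have [t [ct st]] : exists t : R, c.1 / m = cos t /\ - c.2 / m = sin t.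
  by apply: unit_angle; rewrite !expr_div_n sqrrN -mulrDl cr m2 divff// gt_eqF// ltr_pwDl// sqr_ge0.
have c2t : c2 t = 0 by rewrite /c2 -ct -st; field.
have c1t : c1 t = m.
  rewrite /c1 -ct -st; transitivity ((c.1 ^+ 2 + c.2 ^+ 2) / m); first by field.
  by rewrite cr -m2; field.
have mr : r < m by rewrite -(@ltr_pXn2r _ 2)// ?nnegrE ?ltW// m2 ltrDr.
(* The rotated circle meets the real axis at m - r and m + r; orthogonality makes their product 1,
   so only m - r lies in the disk. *)
have a1 : (m - r) * (m + r) = 1 by rewrite -subr_sqr m2 addrK.
have mr1 : 1 < m + r.
  have : 1 < m by rewrite -(@ltr_pXn2r _ 2)// ?nnegrE ?ltW// m2 expr1n ltrDl exprn_gt0.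
  by move: r_gt0; lra.
exists (t, m - r); split.
- have mr0 : 0 < m + r by exact: lt_trans mr1.
  by rewrite subr_gt0 mr/= -(ltr_pM2r mr0) a1 mul1r.
- move=> z /rot_mem; rewrite c2t mul0r addr0 => -[z1 cz].
  by apply/rot_mem; rewrite /= sqrrN c2t mul0r addr0.
- apply/seteqP; split=> z /=.
    move=> [/rot_mem]; rewrite c1t c2t mul0r addr0 => -[z1 cz] z2.
    rewrite [LHS]surjective_pairing z2; congr (_, _).
    move: z1 cz; rewrite z2 expr0n/= !addr0 => z1 cz.
    have : (z.1 - (m - r)) * (z.1 - (m + r)) = 0.
      by transitivity (z.1 ^+ 2 - 2 * (m * z.1) + (m - r) * (m + r)); [ring|rewrite a1; lra].
    move=> /eqP; rewrite mulf_eq0 !subr_eq0 => /orP[/eqP//|/eqP e].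
    by move: z1; rewrite e; nra.
  move=> ->; split=> //=; apply/rot_mem; rewrite /= c1t c2t mul0r addr0 expr0n/= !addr0.
  by split; [nra|rewrite -[in LHS]a1; ring].
Qed.

(** [reflection] picks an unspecified element of [normalizing G], so every element must determine
    the centre: the symmetry puts the rotated centre on the real axis, and passing through a places
    it at (1 + a^2) / (2 a). *)
Lemma normalizingP t a : normalizing G (t, a) ->
  [/\ 0 < a < 1, c.1 = (1 + a ^+ 2) / (2 * a) * cos t &
      c.2 = - ((1 + a ^+ 2) / (2 * a)) * sin t].
Proof.
move=> [a01 sym real]; have /andP[a0 a1] := a01.
have cs := cos2Dsin2 t.
have [/rot_mem/= []] : ((rot t @` G) `&` [set z | z.2 = 0]) (a, 0) by rewrite real.
rewrite expr0n/= mulr0 !addr0 => aa ca _.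
have an0 : a != 0 by rewrite gt_eqF.
have c1E : c1 t = (1 + a ^+ 2) / (2 * a) by rewrite ca; field.
have c1p : 0 < c1 t by rewrite c1E divr_gt0 ?mulr_gt0// ltr_pwDl// sqr_ge0.
have c2E : c2 t = 0.
  (* the mirror image of a in the axis of the circle is also on it *)
  set N := c1 t ^+ 2 + c2 t ^+ 2.
  have N0 : N != 0 by rewrite gt_eqF// ltr_wpDr ?sqr_ge0// exprn_gt0.
  have [p [pN pc p2]] : exists p : plane R, [/\ p.1 ^+ 2 + p.2 ^+ 2 = a ^+ 2,
      c1 t * p.1 + c2 t * p.2 = a * c1 t & p.2 = 2 * a * c1 t * c2 t / N].
    exists (2 * a * c1 t * c1 t / N - a, 2 * a * c1 t * c2 t / N).
    by split => //=; rewrite /N; field.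
  have /sym/rot_mem/= : (rot t @` G) p.
    by apply/rot_mem; rewrite pc -addrA pN ca; split => //; ring.
  rewrite sqrrN -addrA pN => -[_ e].
  have : c2 t * p.2 = 0 by move: e pc ca; lra.
  rewrite p2 => /eqP; rewrite !mulf_eq0 invr_eq0 (negbTE N0) (gt_eqF c1p) (negbTE an0) pnatr_eq0/= orbF orbb.
  by move/eqP.
split => //.
  rewrite -c1E -[LHS]mulr1 -cs.
  transitivity (c1 t * cos t + c2 t * sin t); first by rewrite /c1 /c2; ring.
  by rewrite c2E mul0r addr0.
rewrite -c1E -[LHS]mulr1 -cs.
transitivity (- c1 t * sin t + c2 t * cos t); first by rewrite /c1 /c2; ring.
by rewrite c2E mul0r addr0.
Qed.

End circle_geodesics.

Section geodesic_reflection.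
Context (R : realType).
Implicit Types (n z w c : plane R) (t a r v : R).

(** The right side is the inversion b + (b^2 - 1) (z - b) / |z - b|^2, where b is the Euclidean
    centre of the geodesic through a that is orthogonal to the real axis. *)
Lemma mobius_conjugate (a b x y : R) : 0 < a < 1 -> 2 * a * b = 1 + a ^+ 2 ->
  x ^+ 2 + y ^+ 2 < 1 ->
  mobius (- a) (- conjc (mobius a (Complex x y))) =
  Complex ((b - x - b ^+ 2 * x + b * (x ^+ 2 + y ^+ 2)) / ((b - x) ^+ 2 + y ^+ 2)) ((b ^+ 2 - 1) * y / ((b - x) ^+ 2 + y ^+ 2)).
Proof.
move=> /andP[a0 a1] ab xy; set s := (b - x) ^+ 2 + y ^+ 2.
have an0 : a != 0 by rewrite gt_eqF.
have x1 : x < 1 by have := sqr_ge0 y; nra.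
have b1 : 1 < b.
  have a2 : 0 < 2 * a by rewrite mulr_gt0.
  have a3 : 0 < (1 - a) ^+ 2 by rewrite exprn_gt0// subr_gt0.
  by rewrite -(ltr_pM2l a2) ab mulr1; nra.
have s0 : s != 0.
  by rewrite /s gt_eqF// ltr_wpDr ?sqr_ge0// exprn_gt0// subr_gt0 (lt_trans x1).
pose A : R[i] := Complex a 0; pose Z : R[i] := Complex x (- y).
have AN : Complex (- a) 0 = - A by rewrite /A; simpc.
have cA : conjc A = A by rewrite /A/= oppr0.
have cZ : conjc (Complex x y) = Z by [].
have A0 : A != 0 by rewrite eq_complex/= (negbTE an0).
have d1 : 1 - A * Z != 0.
  rewrite /A /Z; simpc; rewrite eq_complex/= negb_and; apply/orP; left.
  rewrite subr_eq0 eq_sym lt_eqF//;  nra.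
have d2 : 1 + A * A - (A + A) * Z != 0.
  rewrite /A /Z; simpc; rewrite eq_complex/= negb_and; apply/orP; left.
   have := sqr_ge0 (1 - a); nra.
have -> : mobius (- a) (- conjc (mobius a (Complex x y))) =
   (A + A - (1 + A * A) * Z) / (1 + A * A - (A + A) * Z).
  have e1 : conjc (Complex x y - A) = Z - A by rewrite /A /Z; apply/eqP; rewrite eq_complex/=; apply/andP; split; apply/eqP; ring.
  have e2 : conjc (1 - A * Complex x y) = 1 - A * Z by rewrite /A /Z; apply/eqP; rewrite eq_complex/=; apply/andP; split; apply/eqP; ring.
  have e3 (u w : R[i]) : conjc (u / w) = conjc u / conjc w by exact: (fmorph_div (complex_conjc__canonical__GRing_RMorphism R)).
  rewrite /mobius AN -/A e3 e1 e2.
  by field; rewrite d2 d1.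
apply: (canLR (mulfK d2)).
have aa : 1 + a * a = 2 * a * b by rewrite ab.
rewrite /A /Z; simpc; apply/eqP; rewrite eq_complex/=; apply/andP; split; apply/eqP.
  rewrite aa.
  rewrite (_ : a + a - 2 * a * b * x = 2 * a * (1 - b * x)); last by ring.
  by move: s0; rewrite /s => s0; field.
by rewrite aa; move: s0; rewrite /s => s0; field.
Qed.

Lemma reflection_circle (c : plane R) (r : R) G : 0 < r -> c.1 ^+ 2 + c.2 ^+ 2 = 1 + r ^+ 2 ->
  G = @disk R `&` circle c r ->
  forall z, disk z -> reflection G z = refl (c.1 / r, c.2 / r) r^-1 z.
Proof.
move=> r0 cr GE z dz.
have rn0 : r != 0 by rewrite gt_eqF.
(* A diameter contains the origin, which never lies on a circle orthogonal to the unit circle. *)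
rewrite /reflection asboolF; last first.
  move=> [t [_ Gt]]; have : G (0, 0).
    rewrite Gt; split; first by apply/diskE; rewrite /defect/= expr0n/= !subr0.
    by exists 0; rewrite !mul0r.
  rewrite GE => -[_ /(circle_memE r0 cr)/=]; rewrite expr0n/= !mulr0 !addr0 mulr0 => /eqP.
  by rewrite oner_eq0.
have := normalizing_nonempty r0 cr; rewrite -GE => /(xgetPex (0, 0)).
move: (xget _ _) => [t a]; rewrite [in normalizing _]GE => /(normalizingP r0 cr) [a01 c1E c2E].
have /andP[a0 a1] := a01.
have an0 : a != 0 by rewrite gt_eqF.
move: c1E c2E; set b := (1 + a ^+ 2) / (2 * a) => c1E c2E.
have ab : 2 * a * b = 1 + a ^+ 2 by rewrite /b; field.
clearbody b.
have cs := cos2Dsin2 t.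
have r2 : r ^+ 2 = b ^+ 2 - 1.
  have -> : r ^+ 2 = c.1 ^+ 2 + c.2 ^+ 2 - 1 by rewrite cr; ring.
  rewrite c1E c2E; transitivity (b ^+ 2 * (cos t ^+ 2 + sin t ^+ 2) - 1); first by ring.
  by rewrite cs mulr1.
pose x := z.1 * cos t - z.2 * sin t; pose y := z.1 * sin t + z.2 * cos t.
have z1E : z.1 = x * cos t + y * sin t.
  rewrite -[LHS]mulr1 -cs /x /y; ring.
have z2E : z.2 = - x * sin t + y * cos t.
  rewrite -[LHS]mulr1 -cs /x /y; ring.
have zN : x ^+ 2 + y ^+ 2 = z.1 ^+ 2 + z.2 ^+ 2.
  by rewrite -[RHS]mulr1 -cs /x /y; ring.
have xy1 : x ^+ 2 + y ^+ 2 < 1 by rewrite zN; move/diskE: dz; rewrite /defect; lra.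
have -> : cis t * cplx z = Complex x y.
  by rewrite /cis /cplx; apply/eqP; rewrite eq_complex/=; apply/andP; split; apply/eqP; rewrite /x /y; ring.
rewrite (mobius_conjugate a01 ab xy1).
have nv : (c.1 / r) ^+ 2 + (c.2 / r) ^+ 2 = 1 + r^-1 ^+ 2.
  by rewrite !expr_div_n -mulrDl cr exprVn; field.
have hE : height (c.1 / r, c.2 / r) r^-1 z = (2 * b * x - 1 - (x ^+ 2 + y ^+ 2)) / r.
  by rewrite zN /height /= c1E c2E /x; field.
have sE : refl_den (c.1 / r, c.2 / r) r^-1 z = ((b - x) ^+ 2 + y ^+ 2) / r ^+ 2.
  rewrite refl_denE//= hE.
  have -> : (b - x) ^+ 2 + y ^+ 2 = r ^+ 2 + 1 - 2 * b * x + (x ^+ 2 + y ^+ 2) by rewrite r2; ring.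
  by field.
have s0 : (b - x) ^+ 2 + y ^+ 2 != 0.
  have := refl_den_gt0 (n := (c.1 / r, c.2 / r)) nv dz; rewrite sE.
  by move=> h; apply/eqP => e; move: h; rewrite e mul0r ltxx.
rewrite /pt /refl hE sE/= z1E z2E c1E c2E cosN sinN.
move: x y s0 {z1E z2E zN xy1 hE sE} => x y s0.
congr (_, _).
  transitivity ((r ^+ 2 * (x * cos t + y * sin t) - (2 * b * x - 1 - (x ^+ 2 + y ^+ 2)) * (b * cos t))
    / ((b - x) ^+ 2 + y ^+ 2)); last by field; rewrite rn0.
  by rewrite r2; field.
transitivity ((r ^+ 2 * (- x * sin t + y * cos t) - (2 * b * x - 1 - (x ^+ 2 + y ^+ 2)) * (- b * sin t))
    / ((b - x) ^+ 2 + y ^+ 2)); last by field; rewrite rn0.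
by rewrite r2; field.
Qed.

(** From here on the geometry enters through (n, v) alone. The normal is determined up to sign, and
    the polarizer fixes that sign. *)
Lemma geodesicP G H : geodesic G -> polarizer G H ->
  exists n v, [/\ n.1 ^+ 2 + n.2 ^+ 2 = 1 + v ^+ 2,
    (forall z, disk z -> reflection G z = refl n v z) &
    H = @disk R `&` [set z | 0 < height n v z]].
Proof.
move=> gG.
have [n [v [nv rE GE]]] : exists n v, [/\ n.1 ^+ 2 + n.2 ^+ 2 = 1 + v ^+ 2,
    (forall z, disk z -> reflection G z = refl n v z) &
    G = @disk R `&` [set z | height n v z = 0]].
  case: gG => [[t Gt]|[c [r [r0 o GE]]]].
    have [t' t'01 tt'] := line0_angle t.
    have [|u [Gu ru]] := @reflection_line R G.
      by exists t'; split => //; rewrite tt'.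
    exists (- sin u, cos u), 0; split => //; last by rewrite Gu line0E.
    by rewrite /= sqrrN expr0n addr0 addrC cos2Dsin2.
  have cr := orthogonal_unit_circle r0 o.
  have rn0 : r != 0 by rewrite gt_eqF.
  exists (c.1 / r, c.2 / r), r^-1; split.
  - by rewrite /= !expr_div_n -mulrDl cr exprVn; field.
  - exact: reflection_circle.
  - by rewrite GE circle_height.
move=> [x [dx nGx] ->]; rewrite [in connected_component _ _]GE.
have hx : height n v x != 0 by apply/eqP => h0; apply: nGx; rewrite GE.
have [h0|h0] := ltP 0 (height n v x).
  by exists n, v; split => //; exact: polarizer_side.
(* On the negative side the opposite normal is taken; the height changes sign and the reflection
   stays the same. *)
have hN z : height (- n.1, - n.2) (- v) z = - height n v z by rewrite /height/=; ring.
exists (- n.1, - n.2), (- v); split.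
- by rewrite /= !sqrrN.
- move=> z dz; rewrite rE// /refl hN.
  have -> : refl_den (- n.1, - n.2) (- v) z = refl_den n v z by rewrite /refl_den/=; ring.
  by rewrite /= !mulrNN.
- rewrite -(@polarizer_side R (- n.1, - n.2) (- v) x)//; last first.
    by rewrite hN oppr_gt0 lt_neqAle hx.
  congr (connected_component (_ `\` (_ `&` _)) _).
  by apply/seteqP; split=> z /=; rewrite hN => /eqP; rewrite ?oppr_eq0 => /eqP// ->; rewrite oppr0.
Qed.

End geodesic_reflection.

(** * The hyperbolic measure *)
Section hyperbolic_measure.
Local Open Scope ereal_scope.
Context (R : realType).
Local Notation mu := (@hyp_measure R).
Local Notation D := (@disk R).
Implicit Types (n z w : plane R) (v : R) (f : plane R -> \bar R).

Definition disk_density (z : plane R) : R := (hyp_density z * \1_D z)%R.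

Lemma measurable_disk_density : measurable_fun setT disk_density.
Proof.
apply: measurable_funM; first exact: measurable_hyp_density.
by apply: measurable_indic; exact: measurable_disk.
Qed.

Lemma disk_density_ge0 z : (0 <= disk_density z)%R.
Proof. by rewrite mulr_ge0// hyp_density_ge0. Qed.

Lemma ge0_integral_hyp f : measurable_fun setT f -> (forall z, 0 <= f z) ->
  \int[mu]_z f z = \int[area R]_z (f z * (disk_density z)%:E).
Proof.
move=> mf f0; rewrite (@ge0_integral_density _ _ _ (area R) mu disk_density)//.
- exact: measurable_disk_density.
- exact: disk_density_ge0.
- move=> A mA; rewrite /= /hyp_measure integral_mkcondr.
  apply: eq_integral => z _; rewrite patchE /disk_density indicE.
  by case: ifPn => _; rewrite ?mulr1 ?mulr0.
Qed.

Lemma hyp_measure_diskC : mu (~` D) = 0.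
Proof. by rewrite /hyp_measure setICl integral_set0. Qed.

Lemma hyp_densityE z : hyp_density z = (pi^-1 * (defect z ^+ 2)^-1)%R.
Proof. by rewrite /hyp_density modulus_sqr /defect opprD addrA. Qed.

Lemma ge0_integral_hyp_disk f : measurable_fun setT f -> (forall z, 0 <= f z) ->
  \int[mu]_(z in D) f z = \int[mu]_z f z.
Proof.
move=> mf f0; rewrite [RHS](ge0_negligible_integral _ _ _ _ hyp_measure_diskC)//.
  by rewrite setTD setCK.
by apply: measurableC; exact: measurable_disk.
Qed.

(** By [defect_refl] the density of the measure gains the factor [refl_den] squared, which cancels
    the Jacobian of [ge0_integral_area_refl]. *)
Lemma ge0_integral_hyp_refl n v f : (n.1 ^+ 2 + n.2 ^+ 2 = 1 + v ^+ 2)%R ->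
  measurable_fun setT f -> (forall z, 0 <= f z) ->
  \int[mu]_(z in D) f (refl n v z) = \int[mu]_(z in D) f z.
Proof.
move=> nv mf f0.
have mr := measurable_refl n v.
have mfr : measurable_fun setT (fun z => f (refl n v z)) by exact: measurableT_comp.
rewrite !ge0_integral_hyp_disk// !ge0_integral_hyp//.
have md := measurable_disk_density.
rewrite -[RHS](ge0_integral_area_refl nv); last 2 first.
- by apply: emeasurable_funM => //; exact/measurable_EFinP.
- by move=> z; rewrite mule_ge0// lee_fin disk_density_ge0.
apply: eq_integral => z _; rewrite -muleA -EFinM; congr (_ * EFin _).
rewrite /disk_density !indicE.
have [d0|d0] := eqVneq (refl_den n v z) 0%R.
  rewrite d0 expr0n/= invr0 mulr0 memNset ?mulr0//.
  by move=> dz; have := refl_den_gt0 nv dz; rewrite d0 ltxx.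
have dp : (0 < refl_den n v z)%R by rewrite lt0r d0 addr_ge0// sqr_ge0.
have -> : (refl n v z \in D) = (z \in D).
  apply/idP/idP => /set_mem/diskE dz; apply/mem_set/diskE; move: dz;
  by rewrite defect_refl// pmulr_lgt0 ?invr_gt0.
case: (boolP (z \in D)) => zD; last by rewrite !mulr0 mul0r.
have q0 : (defect z != 0)%R by have /set_mem/diskE/lt0r_neq0 := zD.
have pi0 : (pi != 0 :> R)%R by rewrite gt_eqF ?pi_gt0.
rewrite !mulr1 !hyp_densityE defect_refl//; move: (@pi R) pi0 => p p0.
by field; rewrite q0 d0 p0.
Qed.

Lemma hyp_measure_null A : measurable A -> area R A = 0 -> mu A = 0.
Proof.
move=> mA A0; apply/eqP; rewrite eq_le measure_ge0 andbT.
rewrite /= /hyp_measure (@ae_eq_integral _ _ _ (area R) _ (cst 0))//.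
- by rewrite integral0.
- by apply: measurableI => //; exact: measurable_disk.
- apply: measurable_funTS; apply/measurable_EFinP; exact: measurable_hyp_density.
- exists A; split => // z /= /not_implyP[[Az _] _] //.
Qed.

Lemma measurable_plane_set1 z : measurable [set z].
Proof.
have -> : [set z] = [set z.1] `*` [set z.2].
  apply/seteqP; split => [_ ->//|w [/= a b]].
  by case: w z a b => [? ?] [? ?] /= -> ->.
by apply: measurableX; exact: measurable_set1.
Qed.

Lemma area_rect (A B : set (measurableTypeR R)) : measurable A -> measurable B ->
  area R (A `*` B) = lebesgue_measure A * lebesgue_measure B.
Proof. by move=> mA mB; exact: product_measure1E. Qed.

Lemma hyp_measure_set1 z : mu [set z] = 0.
Proof.
have e : [set z] = [set z.1] `*` [set z.2].
  apply/seteqP; split => [_ ->//|w [/= a b]].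
  by case: w z a b => [? ?] [? ?] /= -> ->.
apply: hyp_measure_null; first exact: measurable_plane_set1.
rewrite e area_rect; [|exact: measurable_set1..].
by have /= -> := lebesgue_measure_set1 z.1; rewrite mul0e.
Qed.

Lemma area_le_hyp A : measurable A -> A `<=` D -> (pi^-1)%:E * area R A <= mu A.
Proof.
move=> mA AD; rewrite /= /hyp_measure setIidl//.
have p0 : (0 <= pi^-1 :> R)%R by rewrite invr_ge0 pi_ge0.
rewrite -(integral_cst _ mA); apply: ge0_le_integral => //.
- by apply: measurable_funTS; apply/measurable_EFinP; exact: measurable_hyp_density.
- move=> z /AD/diskE dz; rewrite lee_fin hyp_densityE ler_peMr//.
  by rewrite invf_ge1 ?exprn_gt0// exprn_ile1 ?defect_le1// ltW.
Qed.

Lemma area_null A : measurable A -> A `<=` D -> mu A = 0 -> area R A = 0.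
Proof.
move=> mA AD A0; apply/eqP; rewrite eq_le measure_ge0 andbT.
have := area_le_hyp mA AD; rewrite A0 pmule_rle0// lte_fin invr_gt0; exact: pi_gt0.
Qed.

(** A closed Euclidean disk about the origin. Containment in some core with q > 0 is the form in
    which hyperbolic boundedness is used. *)
Definition core (q : R) : set (plane R) := [set z | (q <= defect z)%R].

Lemma measurable_core q : measurable (core q).
Proof.
have md : measurable_fun setT (@defect R) by rewrite /defect; measurability.
rewrite -[core q]setTI (_ : core q = @defect R @^-1` `[q, +oo[).
  exact: md.
by apply/seteqP; split => z /=; rewrite in_itv/= andbT.
Qed.

Lemma core_disk q : (0 < q)%R -> core q `<=` D.
Proof. by move=> q0 z qz; apply/diskE; rewrite (lt_le_trans q0). Qed.

Lemma area_box_fin (a : R) : area R (`[(- a)%R, a]%classic `*` `[(- a)%R, a]%classic) < +oo.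
Proof.
rewrite area_rect; [|exact: measurable_itv..].
rewrite /= !lebesgue_measure_itv/=.
by case: ifPn => _; rewrite -?EFinB -?EFinM ?mul0e ltry.
Qed.

Lemma core_box q : (0 < q)%R -> core q `<=` `[(-1)%R, 1%R]%classic `*` `[(-1)%R, 1%R]%classic.
Proof.
move=> q0 z /(core_disk q0)/diskE; rewrite /defect => dz.
have n1 (x y : R) : (0 < 1 - x ^+ 2 - y ^+ 2 -> -1 <= x <= 1)%R.
  by move=> xy; have := sqr_ge0 y => y0; apply/andP; split; nra.
split; rewrite /= in_itv/=; first exact: (n1 _ z.2).
by apply: (n1 _ z.1); rewrite addrAC.
Qed.

Lemma density_core q z : (0 < q)%R -> core q z -> (hyp_density z <= pi^-1 / q ^+ 2)%R.
Proof.
move=> q0 qz; rewrite hyp_densityE ler_wpM2l ?invr_ge0 ?pi_ge0//.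
have dz := lt_le_trans q0 qz.
by rewrite lef_pV2 ?posrE ?exprn_gt0// ler_pXn2r// nnegrE ltW.
Qed.

Lemma hyp_core_fin q : (0 < q)%R -> mu (core q) < +oo.
Proof.
move=> q0; rewrite /= /hyp_measure setIidl; last exact: core_disk.
have mc := measurable_core q.
apply: (@le_lt_trans _ _ (\int[area R]_(z in core q) cst (pi^-1 / q ^+ 2)%:E z)).
  apply: ge0_le_integral => //.
  - by move=> z _; rewrite lee_fin hyp_density_ge0.
  - by apply: measurable_funTS; apply/measurable_EFinP; exact: measurable_hyp_density.
  - by move=> z qz; rewrite lee_fin density_core.
rewrite integral_cst// lte_mul_pinfty ?lee_fin ?divr_ge0 ?invr_ge0 ?pi_ge0 ?sqr_ge0//.
apply: le_lt_trans (area_box_fin 1); apply: le_measure; rewrite ?inE//.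
- by apply: measurableX; exact: measurable_itv.
- exact: core_box.
Qed.

(** Required by Tonelli. The complement of the disk is null for the measure and joins each core so
    that the sets cover the plane. *)
Lemma hyp_sigma_finite : sigma_finite setT mu.
Proof.
exists (fun k => core k.+1%:R^-1 `|` ~` D).
  apply/seteqP; split => // z _.
  have [dz|nz] := pselect (D z); last by exists 0%N => //; right.
  have /diskE dz0 := dz.
  have [k _ kd] := near_infty_natSinv_lt (PosNum dz0).
  by exists k => //; left; rewrite /core/= ltW//; apply: kd => /=.
move=> k; split.
  by apply: measurableU; [exact: measurable_core|apply: measurableC; exact: measurable_disk].
apply: (@le_lt_trans _ _ (mu (core k.+1%:R^-1) + mu (~` D))).
  by apply: measureU2; [exact: measurable_core|apply: measurableC; exact: measurable_disk].
rewrite [X in _ + X]hyp_measure_diskC adde0; apply: hyp_core_fin.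
by rewrite invr_gt0.
Qed.

HB.instance Definition _ := @Measure_isSigmaFinite.Build _ _ _ mu hyp_sigma_finite.

End hyperbolic_measure.

(** * Integrability of the inverse square root near 0 *)

Section rsqrt_integral.
Context (R : realType).
Local Notation lam := (@lebesgue_measure R).

Let F (x : R) : R := (-2) * (Num.sqrt x)^-1.

Let dF (x : R) : 0 < x -> is_derive x (1 : R) F (x * Num.sqrt x)^-1.
Proof.
move=> x0.
have s0 : Num.sqrt x != 0 by rewrite gt_eqF// sqrtr_gt0.
have dV := is_deriveV s0 (is_derive1_sqrt x0).
have dZ := is_deriveZ (-2) dV.
apply: is_derive_eq; rewrite /GRing.scale/=.
have -> : x * Num.sqrt x = Num.sqrt x ^+ 3 by rewrite exprSr sqr_sqrtr// ltW.
by field.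
Qed.

Let cF (x : R) : 0 < x -> {for x, continuous F}.
Proof.
move=> /dF[d _]; exact/differentiable_continuous/derivable1_diffP.
Qed.

Let cf (x : R) : 0 < x -> {for x, continuous (fun x : R => (x * Num.sqrt x)^-1)}.
Proof.
move=> x0; apply: continuousV; first by rewrite mulf_neq0// gt_eqF// sqrtr_gt0.
by apply: continuousM; [exact: cvg_id|exact: sqrt_continuous].
Qed.

Let integral_cy :
  (\int[lam]_(x in `[1%R, +oo[) ((x * Num.sqrt x)^-1)%:E = 2%:E)%E.
Proof.
rewrite (@ge0_continuous_FTC2y _ _ F _ 0).
- by rewrite -EFinB /F sqrtr1 invr1 mulr1 sub0r opprK.
- by move=> x x1; rewrite invr_ge0 mulr_ge0 ?sqrtr_ge0// (le_trans ler01).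
- apply: continuous_in_subspaceT => x /[!inE] /=; rewrite in_itv/= andbT => ax.
  by apply: cf; rewrite (lt_le_trans ltr01).
- rewrite -(mulr0 (-2)); apply: cvgM; first exact: cvg_cst.
  have /(gtr0_cvgV0 (f := @Num.sqrt R)) H : \forall x \near +oo%R, 0 < Num.sqrt x :> R.
    by near=> x; rewrite sqrtr_gt0.
  apply/H/cvgryPge => A.
  have A0 : 0 <= Num.max A 0 by rewrite le_max lexx orbT.
  near=> x.
  have Ax : Num.max A 0 ^+ 2 <= x by near: x; apply: nbhs_pinfty_ge; exact: num_real.
  apply: (@le_trans _ _ (Num.max A 0)); first by rewrite le_max lexx.
  by rewrite -(ger0_norm A0) -sqrtr_sqr ler_sqrt// (le_trans _ Ax)// sqr_ge0.
- by move=> x x1; have [] := @dF x (lt_trans ltr01 x1).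
- by apply: cvg_at_right_filter; apply: cF.
- move=> x; rewrite in_itv/= andbT => x1; rewrite derive1E; apply: derive_val.
  by apply: dF; exact: lt_trans x1.
Unshelve. all: by end_near.
Qed.

Lemma measurable_sqrtr : measurable_fun setT (@Num.sqrt R).
Proof. by apply: continuous_measurable_fun; exact: sqrt_continuous. Qed.

(* Dominates the square of the kernel: |z - w| >= |z.1 - w.1| bounds it by an
   integrable function of one coordinate. *)
Definition rsqrt_cut (s : R) : R := (Num.sqrt `|s|^-1) * \1_`[(-2)%R, 2%R] s.

Lemma measurable_rsqrt_cut : measurable_fun setT rsqrt_cut.
Proof.
apply: measurable_funM; last by apply: measurable_indic; exact: measurable_itv.
apply: measurableT_comp; first exact: measurable_sqrtr.
by apply: measurable_funV; exact: normr_measurable.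
Qed.

Lemma rsqrt_cut_ge0 s : 0 <= rsqrt_cut s.
Proof. by rewrite mulr_ge0// sqrtr_ge0. Qed.

(** An inversion moves the singularity at 0 to infinity, where the integrand decays like |x|^(-3/2)
    and the improper fundamental theorem applies. *)
Lemma integral_rsqrt_cut_lty : (\int[lam]_s (rsqrt_cut s)%:E < +oo)%E.
Proof.
have mP : measurable_fun setT (fun s => (rsqrt_cut s)%:E).
  by apply/measurable_EFinP; exact: measurable_rsqrt_cut.
have P0 s : (0 <= (rsqrt_cut s)%:E)%E by rewrite lee_fin rsqrt_cut_ge0.
(* The substitution s = 2 / x turns the cut |s| <= 2 into |x| >= 1. *)
rewrite -(ge0_integral_inversion (ltr0Sn _ 1) mP P0).
pose psi : R -> \bar R := (fun x => ((x * Num.sqrt x)^-1)%:E) \_ `[1%R, +oo[.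
have mpsi : measurable_fun setT psi.
  apply/(measurable_restrictT _ _).1; first exact: measurable_itv.
  apply/measurable_funTS/measurable_EFinP; apply: measurable_funV.
  by apply: measurable_funM => //; exact: measurable_sqrtr.
have psi0 x : (0 <= psi x)%E.
  rewrite /psi patchE; case: ifPn => //; rewrite mem_setE/= in_itv/= andbT => x1.
  by rewrite lee_fin invr_ge0 mulr_ge0 ?sqrtr_ge0// (le_trans ler01).
have mpsiN : measurable_fun setT (fun x : R => psi (- x)).
  by apply: measurableT_comp => //; exact: measurable_funN.
apply: (@le_lt_trans _ _ (\int[lam]_x (2%:E * (psi x + psi (- x)%R)))%E).
  apply: ge0_le_integral => //.
  - by move=> x _; rewrite mule_ge0// lee_fin divr_ge0 ?sqr_ge0.
  - apply: emeasurable_funM; last by apply/measurable_EFinP; measurability.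
    apply/measurable_EFinP; apply: (measurableT_comp measurable_rsqrt_cut); measurability.
  - by apply: emeasurable_funM => //; exact: emeasurable_funD.
  move=> x _.
  have psiE : (psi `|x|%R <= psi x + psi (- x)%R)%E.
    by case: (ger0P x) => _; [rewrite leeDl|rewrite leeDr].
  apply: (@le_trans _ _ (2%:E * psi `|x|%R)%E); last by rewrite lee_wpmul2l// lee_fin.
  rewrite -EFinM /rsqrt_cut indicE mem_setE/= in_itv/= -ler_norml normrM normfV (@ger0_norm _ 2)//.
  have [->|x0] := eqVneq x 0.
    by rewrite expr0n/= invr0 mulr0 mulr0 mule_ge0// lee_fin.
  have n0 : 0 < `|x| by rewrite normr_gt0.
  rewrite ler_pdivrMr// ler_pMr//.
  case: (leP 1 `|x|) => x1; last by rewrite mulr0 mul0r mule_ge0// lee_fin.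
  rewrite mulr1 /psi patchE mem_setE/= in_itv/= x1/= -EFinM lee_fin invf_div.
  have -> : x ^+ 2 = `|x| ^+ 2 by rewrite real_normK ?num_real.
  move: (`|x|) n0 => y y0 {x1 psiE x0}.
  have sE : 2 * (y * Num.sqrt y)^-1 = Num.sqrt y * (2 / y ^+ 2).
    have s0 : Num.sqrt y != 0 by rewrite gt_eqF// sqrtr_gt0.
    have -> : y = Num.sqrt y ^+ 2 by rewrite sqr_sqrtr// ltW.
    rewrite sqrtr_sqr ger0_norm ?sqrtr_ge0//; by field.
  rewrite sE ler_wpM2r ?divr_ge0 ?sqr_ge0// ler_sqrt//; last exact: ltW.
  by rewrite ler_pdivrMr// ler_peMr ?ltW// ltr1n.
rewrite ge0_integralZl//; last 2 first.
- exact: emeasurable_funD.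
- by move=> x _; rewrite adde_ge0.
rewrite ge0_integralD// ge0_integral_oppr// /psi -integral_mkcond integral_cy.
by rewrite -EFinD -EFinM ltry.
Qed.

End rsqrt_integral.

Section kernel_bound.
Local Open Scope ereal_scope.
Context (R : realType).
Local Notation mu := (@hyp_measure R).
Local Notation D := (@disk R).
Local Notation lam := (@lebesgue_measure R).
Implicit Types (z w : plane R).

Lemma measurable_kern_r z : measurable_fun setT (kern z).
Proof.
have := @measurable_kern R; set k := (fun p => _) => mk.
by apply: (measurableT_comp mk (g := fun w => (z, w))); measurability.
Qed.

(** The bound is uniform in z because the majorant depends on w.1 - z.1 only and Lebesgue measure is
    translation invariant; on a core the hyperbolic density is bounded. *)
Lemma kern_sq_bound (q : R) : (0 < q)%R -> exists2 C : R, (0 <= C)%R &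
  forall z, D z -> \int[mu]_(w in core q) (kern z w ^+ 2)%:E <= C%:E.
Proof.
move=> q0; set M := (16 * (pi^-1 / q ^+ 2))%R.
have M0 : (0 <= M)%R by rewrite mulr_ge0// divr_ge0 ?sqr_ge0// invr_ge0 pi_ge0.
set c := \int[lam]_s (rsqrt_cut s)%:E.
have c0 : 0 <= c by apply: integral_ge0 => s _; rewrite lee_fin rsqrt_cut_ge0.
have cfin : c \is a fin_num by rewrite ge0_fin_numE// integral_rsqrt_cut_lty.
exists (M * (fine c * 2))%R; first by rewrite mulr_ge0// mulr_ge0// fine_ge0.
move=> z dz.
have mc := measurable_core q.
have mk := measurable_kern_r z.
have mf : measurable_fun setT ((fun w => (kern z w ^+ 2)%:E) \_ (@core R q)).
  apply/(measurable_restrictT _ _).1 => //; apply: measurable_funTS.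
  by apply/measurable_EFinP; exact: measurable_funX.
have f0 w : 0 <= ((fun w => (kern z w ^+ 2)%:E) \_ (@core R q)) w.
  by apply: erestrict_ge0 => *; rewrite lee_fin sqr_ge0.
have mr : measurable_fun setT (fun x : R => rsqrt_cut (x - z.1)%R).
  by apply: (measurableT_comp (@measurable_rsqrt_cut R)); measurability.
have mi : measurable_fun setT (\1_(`[(-1)%R, 1%R]%classic) : R -> R).
  by apply: measurable_indic; exact: measurable_itv.
pose G (w : plane R) : \bar R := (M * (rsqrt_cut (w.1 - z.1) * \1_(`[(-1)%R, 1%R]%classic) w.2))%:E.
have mG : measurable_fun setT G.
  apply/measurable_EFinP; apply: measurable_funM => //; apply: measurable_funM.
    by apply: (measurableT_comp mr); measurability.
  by apply: (measurableT_comp mi); measurability.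
have G0 w : 0 <= G w by rewrite lee_fin mulr_ge0// mulr_ge0// rsqrt_cut_ge0.
rewrite integral_mkcond ge0_integral_hyp//.
(* [kern_upper] fails on the vertical line through z, a null set. *)
have line0 : area R ([set z.1] `*` setT) = 0.
  rewrite area_rect//.
  by have /= -> := lebesgue_measure_set1 z.1; rewrite mul0e.
have md := @measurable_disk_density R.
apply: (@le_trans _ _ (\int[area R]_w G w)).
  apply: ae_ge0_le_integral => //.
  - by move=> w _; rewrite mule_ge0// lee_fin disk_density_ge0.
  - by apply: emeasurable_funM => //; exact/measurable_EFinP.
  exists ([set z.1] `*` setT); split => //.
    by apply: measurableX => //; exact: measurable_set1.
  move=> w /=; apply: contra_notP => wz _.
  rewrite patchE; case: ifPn => [/set_mem wq|_]; last by rewrite mul0e.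
  have dw := core_disk q0 wq.
  rewrite -EFinM /G lee_fin /disk_density indicE mem_set// mulr1.
  have [w1 w2] := core_box q0 wq.
  rewrite [(\1_ _ w.2)%R]indicE mem_set// mulr1 /M /rsqrt_cut indicE mem_set ?mulr1.
    rewrite [leRHS]mulrAC; apply: ler_pM; rewrite ?sqr_ge0 ?hyp_density_ge0//.
    rewrite distrC; apply: kern_upper => // e; apply: wz; split => //=.
    exact: density_core.
  have q1 : core (defect z) z by rewrite /core/=.
  have [] := core_box (proj1 (diskE z) dz) q1.
  by move: w1; rewrite /= !in_itv/= => /andP[? ?] /andP[? ?] _; apply/andP; split; lra.
rewrite ge0_integral_area//.
(* The second coordinate ranges over [-1, 1] and contributes the factor 2. *)
have E x : \int[lam]_y G (x, y) = (M * rsqrt_cut (x - z.1) * 2)%:E.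
  under eq_integral do rewrite /G/= mulrA EFinM.
  rewrite ge0_integralZl//; last 2 first.
  - exact/measurable_EFinP.
  - by rewrite lee_fin mulr_ge0// rsqrt_cut_ge0.
  rewrite integral_indic//= setIT lebesgue_measure_itv/= lte_fin ifT; last by lra.
  by rewrite -EFinB -EFinM; congr EFin; ring.
under eq_integral do rewrite E mulrAC EFinM.
rewrite ge0_integralZl//; last 3 first.
- exact/measurable_EFinP.
- by move=> x _; rewrite lee_fin rsqrt_cut_ge0.
- by rewrite lee_fin mulr_ge0.
have mP : measurable_fun setT (fun s : R => (rsqrt_cut s)%:E).
  by apply/measurable_EFinP; exact: measurable_rsqrt_cut.
have P0 s : 0 <= (rsqrt_cut s)%:E :> \bar R by rewrite lee_fin rsqrt_cut_ge0.
have -> : \int[lam]_(x in setT) (rsqrt_cut (x - z.1))%:E = c.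
  rewrite /c -(ge0_integral_affine (- z.1) (oner_neq0 R) mP P0) normr1 mul1e.
  by apply: eq_integral => x _; rewrite mul1r.
rewrite -(fineK cfin) -EFinM lee_fin.
by rewrite mulrAC mulrA.
Qed.

End kernel_bound.

(** * Quadratic form of the kernel and capacity *)
Section double_integral.
Local Open Scope ereal_scope.
Context (R : realType).
Local Notation mu := (@hyp_measure R).
Local Notation D := (@disk R).
Implicit Types (z w : plane R) (f g : plane R * plane R -> R) (a b : plane R -> R).

Definition double_int f : \bar R := \int[mu]_z \int[mu]_w (f (z, w))%:E.

Definition nnmeas d (T : measurableType d) (f : T -> R) :=
  measurable_fun setT f /\ forall x, (0 <= f x)%R.

Lemma nnmeasD d (T : measurableType d) (f g : T -> R) :
  nnmeas f -> nnmeas g -> nnmeas (fun x => f x + g x)%R.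
Proof.
move=> [mf f0] [mg g0]; split; first exact: measurable_funD.
by move=> x; rewrite addr_ge0.
Qed.

Lemma nnmeasM d (T : measurableType d) (f g : T -> R) :
  nnmeas f -> nnmeas g -> nnmeas (fun x => f x * g x)%R.
Proof.
move=> [mf f0] [mg g0]; split; first exact: measurable_funM.
by move=> x; rewrite mulr_ge0.
Qed.

Lemma nnmeas_cst d (T : measurableType d) (c : R) : (0 <= c)%R ->
  nnmeas (fun _ : T => c).
Proof. by move=> c0; split => //; exact: measurable_cst. Qed.

Lemma nnmeas_comp d d' (T : measurableType d) (T' : measurableType d')
    (h : T' -> T) (f : T -> R) :
  measurable_fun setT h -> nnmeas f -> nnmeas (fun x => f (h x)).
Proof. by move=> mh [mf f0]; split => //; exact: measurableT_comp. Qed.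

Lemma nnmeas_fst a : nnmeas a -> nnmeas (fun p : plane R * plane R => a p.1).
Proof. exact: nnmeas_comp (@measurable_fst _ _ _ _). Qed.

Lemma nnmeas_snd a : nnmeas a -> nnmeas (fun p : plane R * plane R => a p.2).
Proof. exact: nnmeas_comp (@measurable_snd _ _ _ _). Qed.

Lemma nnmeas_pair f z : nnmeas f -> nnmeas (fun w => f (z, w)).
Proof. by apply: nnmeas_comp; measurability. Qed.

Lemma nnmeasE d (T : measurableType d) (f : T -> R) : nnmeas f ->
  measurable_fun setT (fun x => (f x)%:E) /\ (forall x, 0 <= (f x)%:E).
Proof. by move=> [mf f0]; split; [exact/measurable_EFinP|]. Qed.

Lemma nnmeas_inner f : nnmeas f ->
  measurable_fun setT (fun z => \int[mu]_w (f (z, w))%:E) /\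
  forall z, 0 <= \int[mu]_w (f (z, w))%:E.
Proof.
move=> /nnmeasE[mf f0]; split.
  pose m2 : {sigma_finite_measure set (plane R) -> \bar R} := mu.
  have := @measurable_fun_fubini_tonelli_F _ _ (plane R) (plane R) R m2 (fun p => (f p)%:E) mf f0.
  by rewrite /fubini_F.
by move=> z; apply: integral_ge0 => w _; exact: f0.
Qed.

Lemma hyp_integralD a b : nnmeas a -> nnmeas b ->
  \int[mu]_z (a z + b z)%:E = \int[mu]_z (a z)%:E + \int[mu]_z (b z)%:E.
Proof.
move=> /nnmeasE[ma a0] /nnmeasE[mb b0].
by under eq_integral do rewrite EFinD; rewrite ge0_integralD.
Qed.

Lemma hyp_integralZl (c : R) a : (0 <= c)%R -> nnmeas a ->
  \int[mu]_z (c * a z)%:E = c%:E * \int[mu]_z (a z)%:E.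
Proof.
move=> c0 /nnmeasE[ma a0].
by under eq_integral do rewrite EFinM; rewrite ge0_integralZl.
Qed.

Lemma hyp_integral_refl n v a : (n.1 ^+ 2 + n.2 ^+ 2 = 1 + v ^+ 2)%R -> nnmeas a ->
  \int[mu]_z (a (refl n v z))%:E = \int[mu]_z (a z)%:E.
Proof.
move=> nv na; have [ma a0] := nnmeasE na.
have [mar ar0] := nnmeasE (nnmeas_comp (measurable_refl n v) na).
rewrite -ge0_integral_hyp_disk// (ge0_integral_hyp_refl (f := fun z => (a z)%:E) nv)//.
by rewrite ge0_integral_hyp_disk.
Qed.

Lemma negligible_diskC (P : plane R -> Prop) :
  (forall z, D z -> P z) -> {ae mu, forall z, P z}.
Proof.
move=> DP; exists (~` D); split.
- by apply: measurableC; exact: measurable_disk.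
- exact: hyp_measure_diskC.
- by move=> z /= nP Dz; apply: nP; exact: DP.
Qed.

Lemma le_hyp_integral a b : nnmeas a -> nnmeas b ->
  (forall z, D z -> (a z <= b z)%R) ->
  \int[mu]_z (a z)%:E <= \int[mu]_z (b z)%:E.
Proof.
move=> /nnmeasE[ma a0] /nnmeasE[mb b0] ab; apply: ae_ge0_le_integral => //.
by apply: negligible_diskC => z /ab; rewrite lee_fin.
Qed.

Lemma double_intD f g : nnmeas f -> nnmeas g ->
  double_int (fun p => f p + g p)%R = double_int f + double_int g.
Proof.
move=> nf ng; have [mf f0] := nnmeas_inner nf; have [mg g0] := nnmeas_inner ng.
rewrite /double_int; under eq_integral do rewrite (hyp_integralD (nnmeas_pair _ nf) (nnmeas_pair _ ng)).
by rewrite ge0_integralD.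
Qed.

Lemma double_intZ (c : R) f : (0 <= c)%R -> nnmeas f ->
  double_int (fun p => c * f p)%R = c%:E * double_int f.
Proof.
move=> c0 nf; have [mf f0] := nnmeas_inner nf.
rewrite /double_int; under eq_integral do rewrite (hyp_integralZl c0 (nnmeas_pair _ nf)).
by rewrite ge0_integralZl.
Qed.

(** For fixed z two values of w are null and may be excluded: w = z, where [kern z w] has its junk
    value, and w = [h z]. With [h] the reflection, the latter is where [kern z (sigma w)] has it. *)
Lemma double_int_le (h : plane R -> plane R) f g : nnmeas f -> nnmeas g ->
  (forall z w, D z -> D w -> w <> z -> w <> h z -> (f (z, w) <= g (z, w))%R) ->
  double_int f <= double_int g.
Proof.
move=> nf ng fg; have [mf f0] := nnmeas_inner nf; have [mg g0] := nnmeas_inner ng.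
apply: ae_ge0_le_integral => //.
apply: negligible_diskC => z Dz _.
have [mfz fz0] := nnmeasE (nnmeas_pair z nf).
have [mgz gz0] := nnmeasE (nnmeas_pair z ng).
have m1 (x : plane R) : measurable [set x] by exact: measurable_plane_set1.
have mDC : measurable (~` D) by apply: measurableC; exact: measurable_disk.
have m2 : measurable ([set z] `|` [set h z]) by exact: measurableU.
have u2 : mu ([set z] `|` [set h z]) = 0.
  apply/eqP; rewrite eq_le measure_ge0 andbT; apply: (@le_trans _ _ (mu [set z] + mu [set h z])); first exact: measureU2.
  by rewrite !hyp_measure_set1 adde0.
apply: ae_ge0_le_integral => //.
exists (~` D `|` ([set z] `|` [set h z])); split.
- exact: measurableU.
- apply/eqP; rewrite eq_le measure_ge0 andbT; apply: (@le_trans _ _ (mu (~` D) + mu ([set z] `|` [set h z]))); first exact: measureU2.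
  by rewrite u2 hyp_measure_diskC adde0.
- move=> w /=; apply: contra_notP => /not_orP[/contrapT Dw /not_orP[wz whz]] _.
  by rewrite lee_fin fg.
Qed.

Lemma double_int_refl_l n v f : (n.1 ^+ 2 + n.2 ^+ 2 = 1 + v ^+ 2)%R -> nnmeas f ->
  double_int (fun p => f (refl n v p.1, p.2)) = double_int f.
Proof.
move=> nv nf; have [mf f0] := nnmeas_inner nf.
have mr := measurable_refl n v.
rewrite /double_int/= -[RHS](ge0_integral_hyp_disk mf f0).
rewrite -(ge0_integral_hyp_refl (f := fun z => \int[mu]_w (f (z, w))%:E) nv)//.
rewrite ge0_integral_hyp_disk//.
exact: (measurableT_comp mf mr).
Qed.

Lemma double_int_refl_r n v f : (n.1 ^+ 2 + n.2 ^+ 2 = 1 + v ^+ 2)%R -> nnmeas f ->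
  double_int (fun p => f (p.1, refl n v p.2)) = double_int f.
Proof.
move=> nv nf; rewrite /double_int/=; apply: eq_integral => z _.
by rewrite (hyp_integral_refl (a := fun w => f (z, w)) nv)//; exact: nnmeas_pair.
Qed.

Lemma double_int_prod a b : nnmeas a -> nnmeas b ->
  double_int (fun p => a p.1 * b p.2)%R = \int[mu]_z (a z)%:E * \int[mu]_z (b z)%:E.
Proof.
move=> na nb; rewrite /double_int/=.
under eq_integral do rewrite (hyp_integralZl (na.2 _) nb).
have [ma a0] := nnmeasE na; have [mb b0] := nnmeasE nb.
rewrite muleC -ge0_integralZl//; last exact: integral_ge0.
by apply: eq_integral => z _; rewrite muleC.
Qed.

Definition dkern (p : plane R * plane R) : R := (kern p.1 p.2 * \1_D p.1 * \1_D p.2)%R.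

Lemma nnmeas_dkern : nnmeas dkern.
Proof.
have mD : measurable_fun setT (\1_D : plane R -> R).
  by apply: measurable_indic; exact: measurable_disk.
split.
  apply: measurable_funM; last by apply: (measurableT_comp mD); exact: measurable_snd.
  apply: measurable_funM; first exact: measurable_kern.
  by apply: (measurableT_comp mD); exact: measurable_fst.
move=> [z w]; rewrite /dkern/= !indicE.
have [/set_mem zD|_] := boolP (z \in D); last by rewrite mulr0 mul0r.
have [/set_mem wD|_] := boolP (w \in D); last by rewrite mulr0.
by rewrite !mulr1 kern_ge0.
Qed.

Lemma dkernE z w : D z -> D w -> dkern (z, w) = kern z w.
Proof. by move=> dz dw; rewrite /dkern/= !indicE !mem_set// !mulr1. Qed.

End double_integral.

Section le_integral.
Import HBNNSimple.

(** The negative part of [f] only lowers the left side, and simple functions below its positive part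
    lie below [g]. This compares the signed inner integrals in [log_energy] as they stand. *)
Lemma le_integral_nonneg d (T : measurableType d) (R : realType)
    (mu : {measure set T -> \bar R}) (D : set T) (f g : T -> \bar R) :
  (forall x, D x -> f x <= g x)%E -> (forall x, D x -> 0 <= g x)%E ->
  (\int[mu]_(x in D) f x <= \int[mu]_(x in D) g x)%E.
Proof.
move=> fg g0; rewrite integralE.
apply: (@le_trans _ _ (\int[mu]_(x in D) f^\+ x)%E).
  by rewrite -[leRHS]sube0 leeB// integral_ge0.
rewrite !ge0_integralE//; apply: ereal_sup_le => _ [h /= hf <-].
exists h => // x; apply: le_trans (hf x) _.
rewrite !patchE; case: ifPn => // /set_mem Dx.
by rewrite funeposE ge_max fg ?g0.
Qed.

End le_integral.

Section capacity.
Local Open Scope ereal_scope.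
Context (R : realType).
Local Notation mu := (@hyp_measure R).
Local Notation D := (@disk R).
Implicit Types (A : set (plane R)) (U V W : plane R -> R).

Definition kernel_form U : \bar R := double_int (fun p => dkern p * U p.1 * U p.2)%R.

(** Up to null sets, because [polarize] is controlled only inside the disk and the domains compared
    in [tau_h_sub] are nested only almost everywhere. *)
Definition supported A U := {ae mu, forall z, ~ A z -> U z = 0%R}.

Definition sqnorm U : \bar R := \int[mu]_z (U z ^+ 2)%:E.

Lemma nnmeas_sqr U : nnmeas U -> nnmeas (fun z => U z ^+ 2)%R.
Proof. by move=> [mU U0]; split; [exact: measurable_funX|move=> z; exact: sqr_ge0]. Qed.

Lemma nnmeas_kernM U V : nnmeas U -> nnmeas V ->
  nnmeas (fun p => dkern p * U p.1 * V p.2)%R.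
Proof.
move=> nU nV; apply: nnmeasM; last exact: nnmeas_snd.
by apply: nnmeasM; [exact: nnmeas_dkern|exact: nnmeas_fst].
Qed.

Lemma supported_int A U V : measurable A -> nnmeas V ->
  supported A U -> (forall z, U z = 0%R -> V z = 0%R) ->
  \int[mu]_(z in A) (V z)%:E = \int[mu]_z (V z)%:E.
Proof.
move=> mA /nnmeasE[mV V0] sU UV; rewrite integral_mkcond.
apply: ge0_ae_eq_integral => //.
- by apply/(measurable_restrictT _ _).1 => //; exact: measurable_funTS.
- by move=> z _; exact: erestrict_ge0.
apply: filterS sU => z sz _; rewrite patchE; case: ifPn => //.
by rewrite notin_setE => /sz/UV ->.
Qed.

Lemma tau_h_ge A U : measurable A -> A `<=` D -> nnmeas U -> supported A U ->
  sqnorm U = 1 -> (2^-1)%:E * kernel_form U <= tau_h A.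
Proof.
move=> mA AD nU sU U1.
have nU2 := nnmeas_sqr nU.
have sqA : \int[mu]_(z in A) (U z ^+ 2)%:E = 1.
  by rewrite (supported_int mA nU2 sU)// => z ->; rewrite expr0n.
apply: ereal_sup_ubound; exists U; split; [|exact: sqA|].
  split; first exact: measurable_funTS nU.1.
  apply/integrableP; split.
    by apply: measurable_funTS; exact: (nnmeasE nU2).1.
  under eq_integral do rewrite gee0_abs ?lee_fin ?sqr_ge0//.
  by rewrite sqA ltry.
apply: (congr1 (fun x => (2^-1)%:E * x)); apply/esym.
have inner z : A z -> \int[mu]_(w in A) (ln (pseudo_dist z w)^-1 * U z * U w)%:E =
    \int[mu]_w (dkern (z, w) * U z * U w)%:E.
  move=> Az; rewrite -(supported_int mA (nnmeas_pair z (nnmeas_kernM nU nU)) sU).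
    apply: eq_integral => w /set_mem Aw /=.
    by rewrite dkernE ?ln_pseudo_dist//; exact: AD.
  by move=> w /= ->; rewrite mulr0.
transitivity (\int[mu]_(z in A) \int[mu]_w (dkern (z, w) * U z * U w)%:E).
  by apply: eq_integral => z /set_mem Az; exact: inner.
have [mF F0] := nnmeas_inner (nnmeas_kernM nU nU).
rewrite integral_mkcond; apply: ge0_ae_eq_integral => //.
- by apply/(measurable_restrictT _ _).1 => //; exact: measurable_funTS.
- by move=> z _; apply: erestrict_ge0 => ? _; exact: F0.
apply: filterS sU => z sz _; rewrite patchE; case: ifPn => //.
rewrite notin_setE => /sz/= ->; rewrite integral0_eq// => w _.
by rewrite mulr0 mul0r.
Qed.

(** The kernel is nonnegative, so replacing u by |u| keeps the norm and does not lower the energy.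
    Upper bounds thus need testing only on nonnegative functions vanishing off A. *)
Lemma tau_h_le A (M : \bar R) : measurable A -> A `<=` D ->
  (forall U, nnmeas U -> (forall z, ~ A z -> U z = 0%R) -> sqnorm U = 1 ->
     (2^-1)%:E * kernel_form U <= M) -> tau_h A <= M.
Proof.
move=> mA AD UM; apply: ge_ereal_sup => _ [u [[mu_ _] u1 ->]].
pose U : plane R -> R := (fun z => `|u z|)%R \_ A.
have nU : nnmeas U.
  split; last by move=> z; rewrite /U patchE; case: ifPn.
  apply/(measurable_restrictT _ _).1 => //.
  exact: measurableT_comp.
have UA z : A z -> U z = `|u z|%R by move=> Az; rewrite /U patchE mem_set.
have UC z : ~ A z -> U z = 0%R by move=> Az; rewrite /U patchE memNset.
have sU : supported A U by apply: aeW => z; exact: UC.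
apply: le_trans (UM U nU UC _).
  apply: lee_wpmul2l; first by rewrite lee_fin invr_ge0.
  have [mF F0] := nnmeas_inner (nnmeas_kernM nU nU).
  apply: (@le_trans _ _ (\int[mu]_(z in A) \int[mu]_w (dkern (z, w) * U z * U w)%:E)).
    apply: le_integral_nonneg => // z Az.
    rewrite -(supported_int mA (nnmeas_pair z (nnmeas_kernM nU nU)) sU)/=; last first.
      by move=> w /= ->; rewrite mulr0.
    apply: le_integral_nonneg => w Aw; rewrite lee_fin.
      rewrite dkernE; [|exact: AD..]; rewrite ln_pseudo_dist; [|exact: AD..].
      rewrite !UA// -[leLHS]mulrA -[leRHS]mulrA -normrM ler_wpM2l ?ler_norm//.
      by apply: kern_ge0; exact: AD.
    exact: (nnmeas_kernM nU nU).2.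
  rewrite /kernel_form /double_int; apply: ge0_subset_integral => //.
rewrite /sqnorm -(supported_int mA (nnmeas_sqr nU) sU); last first.
  by move=> z ->; rewrite expr0n.
rewrite -u1; apply: eq_integral => z /set_mem Az.
by rewrite UA// real_normK// num_real.
Qed.

End capacity.

(** * Polarization *)
(* The difference of the two sides is 0 or (s - t) |a - a'| |b - b'|. *)
Lemma rearrangement_two (R : realDomainType) (a a' b b' s t : R) : t <= s ->
  s * (a * b + a' * b') + t * (a' * b + a * b') <=
  s * (Num.max a a' * Num.max b b' + Num.min a a' * Num.min b b')
  + t * (Num.min a a' * Num.max b b' + Num.max a a' * Num.min b b').
Proof.
move=> ts; have ts0 : 0 <= s - t by rewrite subr_ge0.
case: (leP a a') => aa; case: (leP b b') => bb; rewrite -subr_ge0.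
- by rewrite (_ : _ - _ = 0)//; ring.
- rewrite (_ : _ - _ = (s - t) * ((a' - a) * (b - b'))); last by ring.
  by rewrite mulr_ge0// mulr_ge0 ?subr_ge0// ltW.
- rewrite (_ : _ - _ = (s - t) * ((a - a') * (b' - b))); last by ring.
  by rewrite mulr_ge0// mulr_ge0 ?subr_ge0// ltW.
- by rewrite (_ : _ - _ = 0)//; ring.
Qed.

Section polarized_function.
Local Open Scope ereal_scope.
Context (R : realType).
Local Notation mu := (@hyp_measure R).
Local Notation D := (@disk R).
Implicit Types (z w : plane R) (A : set (plane R)) (U : plane R -> R).
Variables (n : plane R) (v : R).
Hypothesis nv : (n.1 ^+ 2 + n.2 ^+ 2 = 1 + v ^+ 2)%R.
Local Notation h := (height n v).
Local Notation sigma := (refl n v).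

(* On the geodesic itself [sigma z = z], so both branches agree there. *)
Definition polarize U z : R :=
  if (0 < h z)%R then Num.max (U z) (U (sigma z)) else Num.min (U z) (U (sigma z)).

Let mr : measurable_fun setT sigma. Proof. exact: measurable_refl. Qed.
Let mh : measurable_fun setT h. Proof. exact: measurable_height. Qed.

Lemma measurable_upper : measurable [set z | (0 < h z)%R].
Proof.
rewrite (_ : [set z | (0 < h z)%R] = setT `&` h @^-1` `]0%R, +oo[).
  exact: mh.
by rewrite setTI; apply/seteqP; split=> z /=; rewrite in_itv/= andbT.
Qed.

Lemma nnmeas_polarize U : nnmeas U -> nnmeas (polarize U).
Proof.
move=> nU; have nUs := nnmeas_comp mr nU; split.
  apply: measurable_fun_ifT.
  - apply: (measurable_fun_bool true).
    rewrite setTI; exact: measurable_upper.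
  - by apply: measurable_maxr; [exact: nU.1|exact: nUs.1].
  - by apply: measurable_minr; [exact: nU.1|exact: nUs.1].
move=> z; rewrite /polarize; case: ifPn => _.
  by rewrite le_max nU.2.
by rewrite le_min nU.2 nUs.2.
Qed.

Lemma refl_fixed z : h z = 0%R -> sigma z = z.
Proof.
move=> hz; have den1 : refl_den n v z = 1%R by rewrite refl_denE// hz mulr0 subr0.
by rewrite /refl den1 hz !mul0r !subr0 !divr1; case: z {hz den1}.
Qed.

Lemma polarizeP U z : D z ->
  ((0 < h z)%R /\ polarize U z = Num.max (U z) (U (sigma z)) /\
     polarize U (sigma z) = Num.min (U z) (U (sigma z))) \/
  ((h z <= 0)%R /\ polarize U z = Num.min (U z) (U (sigma z)) /\
     polarize U (sigma z) = Num.max (U z) (U (sigma z))).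
Proof.
move=> dz; have d0 := refl_den_gt0 nv dz; have dn0 : refl_den n v z != 0%R by rewrite gt_eqF.
have inv := refl_involutive nv dn0; have hs := height_refl nv dn0.
have [z0|z0] := ltP 0%R (h z); [left|right]; split => //.
  rewrite /polarize z0 hs inv ifF; first by rewrite minC.
  by apply/negbTE; rewrite -leNgt mulNr oppr_le0 divr_ge0// ltW.
rewrite /polarize ifF; last by apply/negbTE; rewrite -leNgt.
split => //; have [h0|h0] := eqVneq (h z) 0%R.
  by rewrite !refl_fixed// h0 ltxx maxxx minxx.
rewrite hs ifT; first by rewrite inv maxC.
by rewrite divr_gt0// oppr_gt0 lt_neqAle h0.
Qed.

(** Polarization permutes the two values at z and [sigma z], so after averaging over the reflection
    the integrands agree on the disk. *)
Lemma sqnorm_polarize U : nnmeas U -> sqnorm (polarize U) = sqnorm U.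
Proof.
move=> nU; have nP := nnmeas_polarize nU.
have nU2 := nnmeas_sqr nU; have nP2 := nnmeas_sqr nP.
have sumE W : nnmeas W -> \int[mu]_z (2^-1 * (W z ^+ 2 + W (sigma z) ^+ 2))%:E = sqnorm W.
  move=> nW; have nW2 := nnmeas_sqr nW; have nWs2 := nnmeas_comp mr nW2.
  rewrite hyp_integralZl//; last exact: nnmeasD.
  rewrite hyp_integralD// (hyp_integral_refl (a := fun z => W z ^+ 2)%R nv)// -/(sqnorm W).
  rewrite -mule2n -mule_natl muleA -EFinM mulVf// mul1e//.
have e z : D z -> (polarize U z ^+ 2 + polarize U (sigma z) ^+ 2 = U z ^+ 2 + U (sigma z) ^+ 2)%R.
  by move=> /(polarizeP U)[[_ [-> ->]]|[_ [-> ->]]]; case: (leP (U z)) => _ //; rewrite addrC.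
have half0 : (0 <= 2^-1 :> R)%R by rewrite invr_ge0.
have nn (W : plane R -> R) : nnmeas W -> nnmeas (fun z => 2^-1 * (W z ^+ 2 + W (sigma z) ^+ 2))%R.
  move=> nW; have nW2 := nnmeas_sqr nW; have nWs2 := nnmeas_comp mr nW2.
  by apply: nnmeasM; [exact: nnmeas_cst|exact: nnmeasD].
rewrite -[LHS]sumE// -[RHS]sumE//; apply/eqP; rewrite eq_le; apply/andP.
by split; (apply: le_hyp_integral; [exact: nn|exact: nn|move=> z dz; rewrite e]).
Qed.

(** The rearrangement inequality compares sums over the four reflected pairs, not single values; the
    invariance of the measure makes this sum cost only a factor 4 in the integral. *)
Definition sym4 (F : plane R * plane R -> R) (p : plane R * plane R) : R :=
  (F (p.1, p.2) + F (sigma p.1, p.2) + (F (p.1, sigma p.2) + F (sigma p.1, sigma p.2)))%R.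

Let mr1 : measurable_fun setT (fun p : plane R * plane R => (sigma p.1, p.2)).
Proof.
apply: measurable_fun_pair; last exact: measurable_snd.
by apply: (measurableT_comp mr); exact: measurable_fst.
Qed.

Let mr2 : measurable_fun setT (fun p : plane R * plane R => (p.1, sigma p.2)).
Proof.
apply: measurable_fun_pair; first exact: measurable_fst.
by apply: (measurableT_comp mr); exact: measurable_snd.
Qed.

Lemma nnmeas_sym4 F : nnmeas F -> nnmeas (sym4 F).
Proof.
move=> nF.
have n0 : nnmeas (fun p => F (p.1, p.2)) by apply: nnmeas_comp nF; measurability.
have n1 := nnmeas_comp mr1 nF; have n2 := nnmeas_comp mr2 nF.
have n3 := nnmeas_comp mr2 n1.
by apply: nnmeasD; apply: nnmeasD.
Qed.

Lemma double_int_sym4 F : nnmeas F -> double_int (sym4 F) = 4%:E * double_int F.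
Proof.
move=> nF.
have n0 : nnmeas (fun p => F (p.1, p.2)) by apply: nnmeas_comp nF; measurability.
have n1 := nnmeas_comp mr1 nF; have n2 := nnmeas_comp mr2 nF.
have n3 := nnmeas_comp mr2 n1.
rewrite /sym4 double_intD; [|exact: nnmeasD..].
rewrite !double_intD// (double_int_refl_r nv n1)//= (double_int_refl_l nv nF) (double_int_refl_r nv nF).
have -> : double_int (fun p => F (p.1, p.2)) = double_int F by [].
have -> : 4%:E = 1 + 1 + (1 + 1) :> \bar R by rewrite -!EFinD; congr EFin; ring.
by rewrite !ge0_muleDl ?mul1e// adde_ge0.
Qed.

Lemma sym4_kern U z w : D z -> D w ->
  (sym4 (fun p => dkern p * U p.1 * U p.2) (z, w) =
   kern z w * (U z * U w + U (sigma z) * U (sigma w))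
   + kern z (sigma w) * (U (sigma z) * U w + U z * U (sigma w)))%R.
Proof.
move=> dz dw; have dsz := disk_refl nv dz; have dsw := disk_refl nv dw.
have wn0 : refl_den n v w != 0%R by rewrite gt_eqF// refl_den_gt0.
rewrite /sym4/= !dkernE// kern_refl//.
have -> : kern (sigma z) w = kern z (sigma w).
  by rewrite -{1}(refl_involutive nv wn0) kern_refl.
by ring.
Qed.

Lemma sym4_polarize_le U z w : nnmeas U -> D z -> D w -> w <> z -> w <> sigma z ->
  (sym4 (fun p => dkern p * U p.1 * U p.2) (z, w) <=
   sym4 (fun p => dkern p * polarize U p.1 * polarize U p.2) (z, w))%R.
Proof.
move=> nU dz dw wz wsz; rewrite !sym4_kern//.
have dsw := disk_refl nv dw.
have wn0 : refl_den n v w != 0%R by rewrite gt_eqF// refl_den_gt0.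
have zn0 : refl_den n v z != 0%R by rewrite gt_eqF// refl_den_gt0.
have zw : z <> w by move=> e; apply: wz.
have zsw : z <> sigma w by move=> e; apply: wsz; rewrite e refl_involutive.
have same : (0 <= h z * h w -> kern z (sigma w) <= kern z w)%R.
  by move=> hh; exact: kern_le.
(* If z and w lie on opposite sides, then z and [sigma w] lie on the same side. *)
have opp : (h z * h w <= 0 -> kern z w <= kern z (sigma w))%R.
  move=> hh; rewrite -{1}(refl_involutive nv wn0); apply: kern_le => //.
  rewrite height_refl// mulrA mulrN pmulr_lge0 ?invr_gt0 ?refl_den_gt0// oppr_ge0//.
have [[hz [-> ->]]|[hz [-> ->]]] := polarizeP U dz;
have [[hw [-> ->]]|[hw [-> ->]]] := polarizeP U dw.
- have /same ts := ltW (mulr_gt0 hz hw).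
  exact: rearrangement_two.
(* With the two kernel values in the opposite order, exchanging U at z and [sigma z] restores the
   pattern of the inequality. *)
- have /opp ts := mulr_ge0_le0 (ltW hz) hw.
  rewrite [leLHS]addrC [leRHS]addrC.
  have := rearrangement_two (U (sigma z)) (U z) (U w) (U (sigma w)) ts.
  by rewrite [Num.max (U (sigma z)) _]maxC [Num.min (U (sigma z)) _]minC; lra.
- have /opp ts := mulr_le0_ge0 hz (ltW hw).
  rewrite [leLHS]addrC [leRHS]addrC.
  have := rearrangement_two (U (sigma z)) (U z) (U w) (U (sigma w)) ts.
  by rewrite [Num.max (U (sigma z)) _]maxC [Num.min (U (sigma z)) _]minC; lra.
- have /same ts := mulr_le0 hz hw.
  have := rearrangement_two (U z) (U (sigma z)) (U w) (U (sigma w)) ts.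
  by lra.
Qed.

Lemma kernel_form_polarize_le U : nnmeas U -> kernel_form U <= kernel_form (polarize U).
Proof.
move=> nU; have nP := nnmeas_polarize nU.
have nF := nnmeas_kernM nU nU; have nG := nnmeas_kernM nP nP.
have : 4%:E * kernel_form U <= 4%:E * kernel_form (polarize U).
  rewrite -(double_int_sym4 nF) -(double_int_sym4 nG); apply: (double_int_le (h := sigma)); [exact: nnmeas_sym4..|].
  by move=> z w *; exact: sym4_polarize_le.
by rewrite lee_pmul2l.
Qed.

End polarized_function.

(** The arithmetic of [near_maximizer]: T is the supremum, k a lower bound of the kernel, d the form
    of u, x its integral, p = <u, v>, and V, V2 are the integral and squared norm of v. *)
Lemma perturbation_bound (R : realFieldType) (T k C V V2 : R) :
  0 < T -> 0 < k -> 0 < C -> 0 < V -> 0 <= V2 ->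
  exists t e p0 : R, [/\ 0 < t, 0 < e, 0 < p0 & forall x p d : R,
    d <= C * x -> T - e <= d / 2 ->
    (d + 2 * (t * k) * (x * V)) / 2 <= T * (1 + 2 * t * p + t ^+ 2 * V2) ->
    p0 <= p].
Proof.
move=> T0 k0 C0 V0 V20.
(* With e <= T / 2 the hypotheses give C x >= T, so K bounds k x V from below. *)
set K := k * T * V / C.
have K0 : 0 < K by rewrite divr_gt0// !mulr_gt0.
have W0 : 0 < V2 + 1 by rewrite ltr_wpDl.
(* Chosen so that T t^2 (V2 + 1) = t K / 4. This and e <= t K / 4 use half of the gain t K, and the
   other half forces 2 T p >= K / 2. *)
set t := K / (4 * T * (V2 + 1)).
have t0 : 0 < t by rewrite divr_gt0// !mulr_gt0.
exists t, (Num.min (T / 2) (t * K / 4)), (K / (4 * T)).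
split => //; [by rewrite lt_min !divr_gt0// mulr_gt0|by rewrite divr_gt0// mulr_gt0|].
move=> x p d dx Td q.
have e1 : Num.min (T / 2) (t * K / 4) <= T / 2 by rewrite ge_min lexx.
have e2 : Num.min (T / 2) (t * K / 4) <= t * K / 4 by rewrite ge_min lexx orbT.
have xT : T <= C * x by lra.
have kx : K <= k * x * V.
  rewrite /K ler_pdivrMr// (_ : k * x * V * C = k * (C * x) * V); last by ring.
  by rewrite ler_pM2r// ler_pM2l.
have tV : T * (t ^+ 2 * V2) <= t * (K / 4).
  have -> : t * (K / 4) = T * (t ^+ 2 * (V2 + 1)).
    have -> : K = t * (4 * T * (V2 + 1)) by rewrite /t divfK// gt_eqF// !mulr_gt0.
    by field.
  by rewrite ler_pM2l// ler_wpM2l ?sqr_ge0// lerDl.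
have tk : t * K <= t * (k * x * V) by rewrite ler_pM2l.
have : t * (K / 2) <= t * (2 * T * p).
  move: q; nra.
rewrite ler_pM2l// => Kp.
by rewrite ler_pdivrMr ?mulr_gt0//; lra.
Qed.

(** * Uniform lower bounds for near-maximizers *)

Section lower_bounds.
Local Open Scope ereal_scope.
Context (R : realType).
Local Notation mu := (@hyp_measure R).
Local Notation D := (@disk R).
Implicit Types (z w : plane R) (U V W : plane R -> R).

Lemma hyp_integral_eq0 (a : plane R -> R) : nnmeas a ->
  (\int[mu]_z (a z)%:E = 0 <-> {ae mu, forall z, a z = 0%R}).
Proof.
move=> na; have [ma a0] := nnmeasE na.
have abs : \int[mu]_z `|(a z)%:E| = \int[mu]_z (a z)%:E.
  by apply: eq_integral => z _; rewrite gee0_abs.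
have [H1 H2] := ae_eq_integral_abs mu measurableT ma; split.
  rewrite -abs => /H1; apply: filterS => z /(_ I)[]//.
move=> h; rewrite -abs; apply: H2; apply: filterS h => z az _ /=.
by rewrite az.
Qed.

Variables (A : set (plane R)) (q : R).
Hypotheses (q0 : (0 < q)%R) (mA : measurable A) (Aq : A `<=` core q).

Let AD : A `<=` D. Proof. exact: subset_trans Aq (core_disk q0). Qed.

Let i1 : plane R -> R := \1_(@core R q).

Let n1 : nnmeas i1.
Proof. by split; [apply: measurable_indic; exact: measurable_core|]. Qed.

Let int_i1 : \int[mu]_z (i1 z)%:E = mu (core q).
Proof. by rewrite integral_indic ?setIT//; exact: measurable_core. Qed.

Lemma integral_le_sqnorm U : nnmeas U -> (forall z, ~ A z -> U z = 0%R) ->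
  \int[mu]_z (U z)%:E <= (2^-1)%:E * (mu (core q) + sqnorm U).
Proof.
move=> nU UA; have nU2 := nnmeas_sqr nU.
rewrite -int_i1 -hyp_integralD// -hyp_integralZl ?invr_ge0//; last exact: nnmeasD.
apply: le_hyp_integral => //; first by apply: nnmeasM; [apply: nnmeas_cst; rewrite invr_ge0|exact: nnmeasD].
move=> z _; have [Az|nAz] := pselect (A z).
  rewrite /i1 indicE mem_set; last exact: Aq.
  by have := sqr_ge0 (1 - U z)%R; rewrite /=; nra.
by rewrite UA// expr0n/= addr0 mulr_ge0// invr_ge0.
Qed.

(** The inner integral of kernel times U is bounded uniformly in z, since 2 kern U <= kern^2 + U^2
    and both squares have bounded integrals. *)
Lemma kernel_form_le_int : exists2 C : R, (0 < C)%R & forall U, nnmeas U ->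
  (forall z, ~ A z -> U z = 0%R) -> sqnorm U = 1 ->
  kernel_form U <= C%:E * \int[mu]_z (U z)%:E.
Proof.
have [C C0 Ck] := kern_sq_bound q0.
exists (2^-1 * (C + 1))%R; first by rewrite mulr_gt0// ltr_wpDl.
move=> U nU UA U1.
have nU2 := nnmeas_sqr nU.
have nF := nnmeas_kernM nU nU.
have [mF F0] := nnmeas_inner nF.
have mc := @measurable_core R q.
have K0 : (0 <= 2^-1 * (C + 1) :> R)%R by rewrite mulr_ge0// addr_ge0.
rewrite -hyp_integralZl//.
rewrite /kernel_form /double_int; apply: ae_ge0_le_integral => //.
- by move=> z _; rewrite lee_fin mulr_ge0// nU.2.
- by apply/measurable_EFinP; apply: measurable_funM => //; exact: nU.1.
apply: negligible_diskC => z dz _.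
have nk : nnmeas (fun w => dkern (z, w)) by exact: nnmeas_pair (@nnmeas_dkern R).
have nkc : nnmeas (fun w => kern z w ^+ 2 * i1 w)%R.
  apply: nnmeasM => //; split; last by move=> w; exact: sqr_ge0.
  by apply: measurable_funX; exact: measurable_kern_r.
have -> : \int[mu]_w (dkern (z, w) * U z * U w)%:E =
    (U z)%:E * \int[mu]_w (dkern (z, w) * U w)%:E.
  rewrite -hyp_integralZl ?nU.2//; last exact: nnmeasM.
  by apply: eq_integral => w _; rewrite mulrCA mulrA.
rewrite EFinM muleC lee_wpmul2r ?lee_fin ?nU.2//.
apply: (@le_trans _ _ (\int[mu]_w (2^-1 * (kern z w ^+ 2 * i1 w + U w ^+ 2))%:E)).
  apply: le_hyp_integral; first exact: nnmeasM.
    by apply: nnmeasM; [apply: nnmeas_cst; rewrite invr_ge0|exact: nnmeasD].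
  move=> w dw; have [Aw|nAw] := pselect (A w).
    rewrite dkernE// /i1 indicE mem_set; last exact: Aq.
    by have := sqr_ge0 (kern z w - U w)%R; rewrite /=; nra.
  rewrite UA// expr0n/= addr0 mulr0 mulr_ge0 ?invr_ge0// mulr_ge0 ?sqr_ge0//.
rewrite hyp_integralZl ?invr_ge0//; last exact: nnmeasD.
rewrite hyp_integralD// [X in _ + X]U1 EFinM lee_wpmul2l ?lee_fin ?invr_ge0// EFinD leeD2r//.
apply: le_trans (Ck z dz); rewrite [leRHS]integral_mkcond.
rewrite le_eqVlt; apply/orP; left; apply/eqP; apply: eq_integral => w _.
by rewrite patchE /i1 indicE; case: ifPn => _; rewrite ?mulr1 ?mulr0.
Qed.

Lemma tau_h_upper : exists C : R, tau_h A <= C%:E.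
Proof.
have [C C0 H] := kernel_form_le_int.
have fc := hyp_core_fin q0.
exists (2^-1 * (C * (2^-1 * (fine (mu (core q)) + 1))))%R.
apply: tau_h_le => // U nU UA U1.
rewrite EFinM lee_wpmul2l ?lee_fin ?invr_ge0//.
apply: le_trans (H U nU UA U1) _.
rewrite EFinM lee_wpmul2l ?lee_fin ?(ltW C0)//.
apply: le_trans (integral_le_sqnorm nU UA) _; rewrite U1 EFinM EFinD fineK//.
by rewrite ge0_fin_numE.
Qed.

Lemma kernel_form_tau_h U (s : R) : nnmeas U -> (forall z, ~ A z -> U z = 0%R) ->
  (0 < s)%R -> sqnorm U = s%:E -> (2^-1)%:E * kernel_form U <= s%:E * tau_h A.
Proof.
move=> nU UA s0 Us.
set r := (Num.sqrt s)^-1%R.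
have r0 : (0 <= r)%R by rewrite invr_ge0 sqrtr_ge0.
have r2 : (r ^+ 2 = s^-1)%R by rewrite exprVn sqr_sqrtr// ltW.
pose W z := (r * U z)%R.
have nW : nnmeas W by apply: nnmeasM => //; exact: nnmeas_cst.
have sn0 : (s != 0)%R by rewrite gt_eqF.
have W1 : sqnorm W = 1.
  rewrite /sqnorm; transitivity (\int[mu]_z (r ^+ 2 * U z ^+ 2)%:E).
    by apply: eq_integral => z _; rewrite exprMn.
  rewrite hyp_integralZl ?sqr_ge0//; last exact: nnmeas_sqr.
  by rewrite [X in _ * X]Us -EFinM r2 mulVf.
have Wd : kernel_form W = (s^-1)%:E * kernel_form U.
  have s1 : (0 <= s^-1)%R by rewrite invr_ge0 ltW.
  rewrite /kernel_form -(double_intZ s1 (nnmeas_kernM nU nU)).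
  by congr double_int; apply/funext => p; rewrite -r2 /W; ring.
have sW : supported A W by apply: aeW => z /UA Uz; rewrite /W Uz mulr0.
have := tau_h_ge mA AD nW sW W1; rewrite Wd => H.
have -> : (2^-1)%:E * kernel_form U = s%:E * ((2^-1)%:E * ((s^-1)%:E * kernel_form U)).
  by rewrite [RHS]muleCA [X in _ = _ * X]muleA -EFinM mulfV// mul1e.
by rewrite lee_wpmul2l// lee_fin ltW.
Qed.

Lemma kern_core_lower : exists2 k : R, (0 < k)%R &
  forall z w, A z -> A w -> z <> w -> (k <= kern z w)%R.
Proof.
exists (ln (1 + q ^+ 2 / 4) / 2)%R.
  by rewrite divr_gt0// ln_gt0// ltrDl divr_gt0// exprn_gt0.
move=> z w Az Aw zw; apply: kern_lower => //; try exact: AD; exact: Aq.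
Qed.

(* The bound comes from [kernel_form W <= 2 * tau * sqnorm W] at W = U + t V. *)
Lemma near_maximizer V : nnmeas V -> (forall z, ~ A z -> V z = 0%R) ->
  sqnorm V < +oo -> 0 < \int[mu]_z (V z)%:E ->
  exists T e p : R, [/\ tau_h A = T%:E, (0 < e)%R, (0 < p)%R &
    forall U, nnmeas U -> (forall z, ~ A z -> U z = 0%R) -> sqnorm U = 1 ->
     (T - e)%:E <= (2^-1)%:E * kernel_form U -> p%:E <= \int[mu]_z (U z * V z)%:E].
Proof.
move=> nV VA Vfin Vpos.
have nV2 := nnmeas_sqr nV.
have [C C0 HC] := kernel_form_le_int.
have [k k0 Hk] := kern_core_lower.
have fc := hyp_core_fin q0.
have half0 : (0 <= 2^-1 :> R)%R by rewrite invr_ge0.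
have int_ge0 (a : plane R -> R) : nnmeas a -> 0 <= \int[mu]_z (a z)%:E.
  by move=> na; apply: integral_ge0 => z _; rewrite lee_fin na.2.
have V2fin : sqnorm V \is a fin_num by rewrite ge0_fin_numE// int_ge0.
have fin_int U : nnmeas U -> (forall z, ~ A z -> U z = 0%R) -> sqnorm U \is a fin_num ->
    \int[mu]_z (U z)%:E \is a fin_num.
  move=> nU UA Uf; rewrite ge0_fin_numE ?int_ge0//.
  apply: le_lt_trans (integral_le_sqnorm nU UA) _.
  by rewrite lte_mul_pinfty// ?lee_fin// lte_add_pinfty// -ge0_fin_numE// int_ge0//; exact: nnmeas_sqr.
have V1fin := fin_int V nV VA V2fin.
set V1 := fine (\int[mu]_z (V z)%:E); set V2 := fine (sqnorm V).
have V1E : \int[mu]_z (V z)%:E = V1%:E by rewrite fineK.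
have V2E : sqnorm V = V2%:E by rewrite fineK.
have V10 : (0 < V1)%R by rewrite -lte_fin -V1E.
have V20 : (0 < V2)%R.
  rewrite -lte_fin -V2E lt0e int_ge0// andbT; apply/eqP => /(hyp_integral_eq0 nV2) V0.
  move: Vpos; rewrite (_ : \int[mu]_z (V z)%:E = 0) ?ltxx//.
  apply/(hyp_integral_eq0 nV); apply: filterS V0 => z /eqP; rewrite sqrf_eq0 => /eqP.
  exact.
have crossn (a b : plane R -> R) : nnmeas a -> nnmeas b -> nnmeas (fun p : plane R * plane R => a p.1 * b p.2)%R.
  by move=> na nb; apply: nnmeasM; [exact: nnmeas_fst|exact: nnmeas_snd].
have kpt (U U' : plane R -> R) z w : nnmeas U -> nnmeas U' -> (forall z, ~ A z -> U z = 0%R) ->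
    (forall z, ~ A z -> U' z = 0%R) -> w <> z ->
    (k * (U z * U' w) <= dkern (z, w) * U z * U' w)%R.
  move=> nU nU' UA UA' wz.
  have [Az|nAz] := pselect (A z); last by rewrite UA// !(mulr0, mul0r).
  have [Aw|nAw] := pselect (A w); last by rewrite UA'// !(mulr0, mul0r).
  rewrite -mulrA ler_wpM2r ?mulr_ge0 ?nU.2 ?nU'.2// dkernE; [|exact: AD..].
  by apply: Hk => // e; apply: wz.
(* V itself is a competitor with positive energy, since the kernel exceeds k off the diagonal. *)
have Tpos : 0 < tau_h A.
  have h1 : (k * (V1 * V1))%:E <= kernel_form V.
    rewrite EFinM [X in _ * X]EFinM -V1E -(double_int_prod nV nV) -(double_intZ (ltW k0) (crossn _ _ nV nV)).
    apply: (double_int_le (h := id)).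
    - by apply: nnmeasM; [apply: nnmeas_cst; exact: ltW|exact: crossn].
    - exact: nnmeas_kernM.
    - by move=> z w _ _ wz _; exact: kpt.
  have h2 := kernel_form_tau_h nV VA V20 V2E.
  have : 0 < V2%:E * tau_h A.
    apply: lt_le_trans h2; rewrite mule_gt0 ?lte_fin ?invr_gt0//.
    by apply: lt_le_trans h1; rewrite lte_fin !mulr_gt0.
  by rewrite pmule_rgt0 ?lte_fin.
have [M HM] := tau_h_upper.
have Tfin : tau_h A \is a fin_num.
  by rewrite ge0_fin_numE ?(ltW Tpos)// (le_lt_trans HM)// ltry.
set T := fine (tau_h A).
have TE : tau_h A = T%:E by rewrite fineK.
have T0 : (0 < T)%R by rewrite -lte_fin -TE.
have [t [e [p0 [t0 e0 p00 H]]]] := perturbation_bound T0 k0 C0 V10 (ltW V20).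
exists T, e, p0; split => // U nU UA U1 Ud.
have nU2 := nnmeas_sqr nU.
have U1fin : sqnorm U \is a fin_num by rewrite U1.
have xfin := fin_int U nU UA U1fin.
set x := fine (\int[mu]_z (U z)%:E).
have xE : \int[mu]_z (U z)%:E = x%:E by rewrite fineK.
have nUV : nnmeas (fun z => U z * V z)%R by exact: nnmeasM.
have pfin : \int[mu]_z (U z * V z)%:E \is a fin_num.
  rewrite ge0_fin_numE ?int_ge0//.
  apply: (@le_lt_trans _ _ (\int[mu]_z (2^-1 * (U z ^+ 2 + V z ^+ 2))%:E)).
    apply: le_hyp_integral => //; first by apply: nnmeasM; [exact: nnmeas_cst|exact: nnmeasD].
    by move=> z _; have := sqr_ge0 (U z - V z)%R; nra.
  rewrite hyp_integralZl//; last exact: nnmeasD.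
  rewrite hyp_integralD// [X in X + _]U1 [X in _ + X]V2E -EFinD -EFinM ltry//.
set p := fine (\int[mu]_z (U z * V z)%:E).
have pE : \int[mu]_z (U z * V z)%:E = p%:E by rewrite fineK.
have nF := nnmeas_kernM nU nU.
have d0 : 0 <= kernel_form U by apply: integral_ge0 => z _; exact: (nnmeas_inner nF).2.
have dC := HC U nU UA U1.
have dfin : kernel_form U \is a fin_num.
  by rewrite ge0_fin_numE// (le_lt_trans dC)// xE -EFinM ltry.
set d := fine (kernel_form U).
have dE : kernel_form U = d%:E by rewrite fineK.
rewrite pE lee_fin; apply: (H x p d).
- by rewrite -lee_fin EFinM -dE -xE.
- by rewrite mulrC -lee_fin EFinM -dE.
pose W z := (U z + t * V z)%R.
have ntV : nnmeas (fun z => t * V z)%R.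
  by apply: nnmeasM => //; apply: nnmeas_cst; exact: ltW.
have nW : nnmeas W by exact: nnmeasD.
have WA z : ~ A z -> W z = 0%R by move=> nAz; rewrite /W UA// VA// mulr0 addr0.
have W2 : sqnorm W = (1 + 2 * t * p + t ^+ 2 * V2)%:E.
  have t2 : (0 <= 2 * t)%R by rewrite mulr_ge0// ltW.
  have tt : (0 <= t ^+ 2)%R by exact: sqr_ge0.
  have na : nnmeas (fun z => 2 * t * (U z * V z))%R by apply: nnmeasM => //; exact: nnmeas_cst.
  have nb : nnmeas (fun z => t ^+ 2 * V z ^+ 2)%R by apply: nnmeasM => //; exact: nnmeas_cst.
  rewrite /sqnorm.
  transitivity (\int[mu]_z (U z ^+ 2 + (2 * t * (U z * V z) + t ^+ 2 * V z ^+ 2))%:E).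
    by apply: eq_integral => z _; congr EFin; rewrite /W; ring.
  rewrite hyp_integralD//; last exact: nnmeasD.
  rewrite hyp_integralD// !hyp_integralZl// [X in X + _]U1 pE [X in _ + (_ + _ * X)]V2E.
  by rewrite -!EFinM -!EFinD; congr EFin; ring.
have W20 : (0 < 1 + 2 * t * p + t ^+ 2 * V2)%R.
  have p_ge0 : (0 <= p)%R by rewrite -lee_fin -pE int_ge0.
  have a1 : (0 <= 2 * t * p)%R by rewrite mulr_ge0// mulr_ge0// ltW.
  have a2 : (0 <= t ^+ 2 * V2)%R by rewrite mulr_ge0 ?sqr_ge0// ltW.
  by rewrite -addrA ltr_pwDl// addr_ge0.
have nFW := nnmeas_kernM nW nW.
have tk0 : (0 <= t * k)%R by rewrite mulr_ge0// ltW.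
have ncross : nnmeas (fun p : plane R * plane R => U p.1 * V p.2 + V p.1 * U p.2)%R.
  by apply: nnmeasD; exact: crossn.
(* In the form of U + t V the two cross terms are bounded below by k times products of integrals,
   and the nonnegative t^2 term is dropped. *)
have dW : (d + 2 * (t * k) * (x * V1))%:E <= kernel_form W.
  have -> : (d + 2 * (t * k) * (x * V1))%:E =
      double_int (fun p => dkern p * U p.1 * U p.2 + t * k * (U p.1 * V p.2 + V p.1 * U p.2))%R.
    rewrite double_intD//; last by apply: nnmeasM => //; exact: nnmeas_cst.
    rewrite double_intZ// double_intD; [|exact: crossn..].
    rewrite !double_int_prod// xE V1E -/(kernel_form U) dE -!(EFinM, EFinD).
    by congr EFin; ring.
  apply: (double_int_le (h := id)) => //.
    by apply: nnmeasD => //; apply: nnmeasM => //; exact: nnmeas_cst.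
  move=> z w _ _ wz _; rewrite /W/=.
  have k1 := kpt U V z w nU nV UA VA wz.
  have k2 := kpt V U z w nV nU VA UA wz.
  have k3 : (0 <= dkern (z, w) * V z * V w)%R by exact: (nnmeas_kernM nV nV).2 (z, w).
  have -> : (dkern (z, w) * (U z + t * V z) * (U w + t * V w) =
     dkern (z, w) * U z * U w + (t * (dkern (z, w) * U z * V w) + t * (dkern (z, w) * V z * U w))
     + t ^+ 2 * (dkern (z, w) * V z * V w))%R by ring.
  apply: ler_wpDr; first by rewrite mulr_ge0 ?sqr_ge0.
  rewrite lerD2l.
  rewrite -mulrA !mulrDr; apply: lerD; by rewrite ler_pM2l.
have := kernel_form_tau_h nW WA W20 W2; rewrite TE -EFinM => h.
have := le_trans (lee_wpmul2l _ dW) h.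
rewrite -EFinM !lee_fin invr_ge0 => /(_ (ler0n _ 2)) ?.
by rewrite mulrC [leRHS]mulrC.
Qed.

End lower_bounds.

(** * Polarization of the domain and monotonicity of the supremum *)

Section polarized_domain.
Local Open Scope ereal_scope.
Context (R : realType).
Local Notation mu := (@hyp_measure R).
Local Notation D := (@disk R).
Implicit Types (z w : plane R) (U V : plane R -> R) (N : set (plane R)).

(** Fix z0 in A. A bound M on the distance to z0 gives 1 - p >= exp(-M), and the product of the
    defects of z0 and w is (1 - p^2) |1 - conj(z0) w|^2, whose last factor is bounded below. *)
Lemma hyp_bounded_core (A : set (plane R)) : A `<=` D -> hyp_bounded A ->
  exists2 q : R, (0 < q)%R & A `<=` core q.
Proof.
move=> AD [M HM]; have [[z0 Az0]|A0] := pselect (A !=set0); last first.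
  by exists 1%R => // z Az; exfalso; apply: A0; exists z.
have /diskE d0 := AD _ Az0.
set eta := expR (- M).
have eta0 : (0 < eta)%R by exact: expR_gt0.
exists (eta * defect z0 / 4)%R; first by rewrite divr_gt0// mulr_gt0.
move=> w Aw; have /diskE dw := AD _ Aw.
have := HM _ _ Az0 Aw; have := pseudo_dist_sqr z0 w.
rewrite /hyp_dist /artanh; set p := pseudo_dist z0 w => p2.
have p0 : (0 <= p)%R by exact: sqrtr_ge0.
have Q0 : (0 < defect z0 * defect w)%R by rewrite mulr_gt0.
have s0 := sqdist_ge0 z0 w.
have sQ : (0 < sqdist z0 w + defect z0 * defect w)%R by rewrite ltr_wpDl.
have p1 : (p < 1)%R.
  by rewrite -(@expr_lt1 _ 2)// p2 ltr_pdivrMr// mul1r ltrDl.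
rewrite mulrCA mulfV// mulr1 => pM.
have ep : (eta <= 1 - p)%R.
  have b0 : (0 < (1 + p) / (1 - p))%R by rewrite divr_gt0 ?subr_gt0// ltr_pwDl.
  have : ((1 + p) / (1 - p) <= expR M)%R by rewrite -(lnK (x := (1 + p) / (1 - p))%R) ?posrE// ler_expR.
  rewrite ler_pdivrMr ?subr_gt0// => h1.
  have e1 : (expR M * eta = 1)%R by rewrite /eta -expRD subrr expR0.
  have h2 : (1 <= expR M * (1 - p))%R by rewrite (le_trans _ h1)// lerDl.
  by rewrite -(ler_pM2l (expR_gt0 M)) e1.
have pp : (p ^+ 2 <= 1 - eta)%R.
  apply: (@le_trans _ _ p); last by lra.
  by rewrite expr2 ler_piMl// ltW.
(* The right side is |1 - conj(z0) w|^2, and its real part 1 - z0 . w is at least half the defect of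
   z0. *)
have low : (defect z0 ^+ 2 / 4 <= sqdist z0 w + defect z0 * defect w)%R.
  have -> : (sqdist z0 w + defect z0 * defect w =
      (1 - (z0.1 * w.1 + z0.2 * w.2)) ^+ 2 + (z0.1 * w.2 - z0.2 * w.1) ^+ 2)%R.
    by rewrite /sqdist /defect; ring.
  rewrite ler_wpDr ?sqr_ge0//.
  have -> : (defect z0 ^+ 2 / 4 = (defect z0 / 2) ^+ 2)%R by field.
  rewrite ler_pXn2r ?nnegrE//.
  - have := sqr_ge0 (z0.1 - w.1)%R; have := sqr_ge0 (z0.2 - w.2)%R.
    by move: dw; rewrite /defect; nra.
  - by rewrite divr_ge0// ltW.
  - have := sqr_ge0 (z0.1 - w.1)%R; have := sqr_ge0 (z0.2 - w.2)%R.
    by move: dw d0; rewrite /defect; nra.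
rewrite /core/= -(ler_pM2l d0).
have : (eta * (sqdist z0 w + defect z0 * defect w) <= defect z0 * defect w)%R.
  move: pp; rewrite p2 ler_pdivrMr// mulrBl mul1r; lra.
apply: le_trans.
have -> : (defect z0 * (eta * defect z0 / 4) = eta * (defect z0 ^+ 2 / 4))%R by field.
by rewrite ler_pM2l.
Qed.

Lemma ae_null N : measurable N -> {ae mu, forall z, ~ N z} -> mu N = 0.
Proof.
move=> mN [B [mB B0 NB]]; apply/eqP; rewrite eq_le measure_ge0 andbT -B0.
apply: le_measure; rewrite ?inE// => z Nz; apply: NB => /=; exact.
Qed.

Lemma null_ae N : measurable N -> mu N = 0 -> {ae mu, forall z, ~ N z}.
Proof. by move=> mN N0; exists N; split => // z /= /contrapT. Qed.

Variables (n : plane R) (v : R).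
Hypothesis nv : (n.1 ^+ 2 + n.2 ^+ 2 = 1 + v ^+ 2)%R.
Local Notation h := (height n v).
Local Notation sigma := (refl n v).

Lemma null_refl_ae N : measurable N -> mu N = 0 -> {ae mu, forall z, ~ N (sigma z)}.
Proof.
move=> mN N0.
have nN : nnmeas (\1_N : plane R -> R) by split; [exact: measurable_indic|].
have : \int[mu]_z (\1_N (sigma z))%:E = 0.
  by rewrite (hyp_integral_refl nv nN) integral_indic// setIT.
have nNs := nnmeas_comp (measurable_refl n v) nN.
move/(hyp_integral_eq0 nNs); apply: filterS => z.
by rewrite indicE => + Nz; rewrite mem_set// => /eqP; rewrite oner_eq0.
Qed.

Lemma kernel_form_refl U : nnmeas U -> kernel_form (fun z => U (sigma z)) = kernel_form U.
Proof.
move=> nU; have mr := measurable_refl n v.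
have nUs := nnmeas_comp mr nU.
have nF := nnmeas_kernM nU nU.
have nG := nnmeas_kernM nUs nUs.
have mr1 : measurable_fun setT (fun p : plane R * plane R => (sigma p.1, p.2)).
  apply: measurable_fun_pair; last exact: measurable_snd.
  by apply: (measurableT_comp mr); exact: measurable_fst.
have mr2 : measurable_fun setT (fun p : plane R * plane R => (p.1, sigma p.2)).
  apply: measurable_fun_pair; first exact: measurable_fst.
  by apply: (measurableT_comp mr); exact: measurable_snd.
have n1 := nnmeas_comp mr1 nF; have n2 := nnmeas_comp mr2 n1.
rewrite [RHS]/kernel_form -(double_int_refl_l nv nF) -(double_int_refl_r nv n1)/=.
by apply/eqP; rewrite eq_le; apply/andP; split; apply: (double_int_le (h := id)) => //;
  move=> z w dz dw _ _ /=; rewrite !dkernE ?kern_refl//; exact: disk_refl.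
Qed.

Lemma sqnorm_refl U : nnmeas U -> sqnorm (fun z => U (sigma z)) = sqnorm U.
Proof. by move=> nU; rewrite /sqnorm (hyp_integral_refl (a := fun z => U z ^+ 2)%R nv)//; exact: nnmeas_sqr. Qed.

Variables (A : set (plane R)).
Hypotheses (mA : measurable A) (AD : A `<=` D).

(** The image of A written as a preimage, which is measurable at once; the disk is intersected
    because the reflection is an involution there. *)
Definition reflected : set (plane R) := D `&` sigma @^-1` A.
Definition upper : set (plane R) := D `&` [set z | (0 < h z)%R].
Definition polarized : set (plane R) := ((A `|` reflected) `&` upper) `|` (A `&` reflected).

Lemma measurable_reflected : measurable reflected.
Proof.
apply: measurableI; first exact: measurable_disk.
by rewrite -[X in measurable X]setTI; exact: measurable_refl.
Qed.

Lemma measurable_upper_half : measurable upper.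
Proof. by apply: measurableI; [exact: measurable_disk|exact: measurable_upper]. Qed.

Lemma measurable_polarized : measurable polarized.
Proof.
have mS := measurable_reflected; have mH := measurable_upper_half.
by apply: measurableU; apply: measurableI => //; exact: measurableU.
Qed.

Lemma polarized_disk : polarized `<=` D.
Proof. by move=> z [[_ []]|[/AD]]. Qed.

Lemma supported_polarize U : nnmeas U -> (forall z, ~ A z -> U z = 0%R) ->
  supported polarized (polarize n v U).
Proof.
move=> nU UA; apply: negligible_diskC => z dz nPz.
have [Az|nAz] := pselect (A z); have [As|nAs] := pselect (A (sigma z)).
- by exfalso; apply: nPz; right.
- rewrite /polarize (UA _ nAs); case: ifPn => hz.
    by exfalso; apply: nPz; left; split; [left|].
  by rewrite (min_idPr (nU.2 z)).
- rewrite /polarize (UA _ nAz); case: ifPn => hz.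
    by exfalso; apply: nPz; left; split; [right|].
  by rewrite (min_idPl (nU.2 _)).
- by rewrite /polarize !UA// maxxx minxx if_same.
Qed.

Lemma tau_h_polarized : tau_h A <= tau_h polarized.
Proof.
apply: tau_h_le => // U nU UA U1.
have nP := nnmeas_polarize n v nU.
apply: (@le_trans _ _ ((2^-1)%:E * kernel_form (polarize n v U))).
  by rewrite lee_wpmul2l ?lee_fin ?invr_ge0// kernel_form_polarize_le.
apply: tau_h_ge => //; [exact: measurable_polarized|exact: polarized_disk| |].
  exact: supported_polarize.
by rewrite sqnorm_polarize.
Qed.

Lemma tau_h_sub (B : set (plane R)) : measurable B -> B `<=` D -> mu (B `\` A) = 0 ->
  tau_h B <= tau_h A.
Proof.
move=> mB BD BA; apply: tau_h_le => // U nU UB U1.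
apply: tau_h_ge => //.
apply: filterS (null_ae (measurableD mB mA) BA) => z nBA nAz.
by apply: UB => Bz; apply: nBA.
Qed.

(** A competitor on B composed with the reflection is one on A: by invariance its norm and its form
    are unchanged. *)
Lemma tau_h_sub_reflected (B : set (plane R)) : measurable B -> B `<=` D ->
  mu (B `\` reflected) = 0 -> tau_h B <= tau_h A.
Proof.
move=> mB BD BA; apply: tau_h_le => // U nU UB U1.
have nUs := nnmeas_comp (measurable_refl n v) nU.
rewrite -(kernel_form_refl nU); apply: tau_h_ge => //; last by rewrite sqnorm_refl.
have mS := measurable_reflected.
have aD : {ae mu, forall z, D z} by exact: negligible_diskC.
apply: filterS2 aD (null_refl_ae (measurableD mB mS) BA) => z dz nN nAz.
apply: UB => Bz; apply: nN; split => // -[_ /=].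
by rewrite refl_involutive// gt_eqF// refl_den_gt0.
Qed.

End polarized_domain.

(** * Strict increase when both exchange sets have positive measure *)

Section strict_gain.
Local Open Scope ereal_scope.
Context (R : realType).
Local Notation mu := (@hyp_measure R).
Local Notation D := (@disk R).
Implicit Types (z w : plane R) (U V : plane R -> R) (N : set (plane R)).
Variables (n : plane R) (v : R).
Hypothesis nv : (n.1 ^+ 2 + n.2 ^+ 2 = 1 + v ^+ 2)%R.
Local Notation h := (height n v).
Local Notation sigma := (refl n v).
Variables (A : set (plane R)) (q : R).
Hypotheses (q0 : (0 < q)%R) (mA : measurable A) (Aq : A `<=` core q).
Hypothesis Asq : forall z, A z -> core q (sigma z).

Local Notation S := (reflected n v A).
Local Notation P := (polarized n v A).
Local Notation H := (@upper R n v).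

Let AD : A `<=` D. Proof. exact: subset_trans Aq (core_disk q0). Qed.

(** The set B1 of the overview, where polarization adds points to the polarizer; [retained] is B2,
    whose points lie in the polarizer from the start and have their mirror images outside A. *)
Definition gained := (H `&` S) `\` A.
Definition retained := (H `&` A) `\` S.

Lemma measurable_gained : measurable gained.
Proof.
by apply: measurableD => //; apply: measurableI; [exact: measurable_upper_half|exact: measurable_reflected].
Qed.

Lemma measurable_retained : measurable retained.
Proof.
by apply: measurableD; [apply: measurableI => //; exact: measurable_upper_half|exact: measurable_reflected].
Qed.

(** The gain in [kern_gain] is proportional to the product of the heights, so each of the two
    integrals carries one height. *)
Let weight N z : R := (h z * \1_N z)%R.

Let nnmeas_weight N : measurable N -> N `<=` H -> nnmeas (weight N).
Proof.
move=> mN NH; split.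
  by apply: measurable_funM; [exact: measurable_height|exact: measurable_indic].
move=> z; rewrite /weight indicE; case: (boolP (z \in N)) => [/set_mem/NH[_ /= hz]|_].
  by rewrite mulr1 ltW.
by rewrite mulr0.
Qed.

Let n1 : nnmeas (weight gained).
Proof. by apply: nnmeas_weight; [exact: measurable_gained|move=> z [[]]]. Qed.

Let n2 : nnmeas (weight retained).
Proof. by apply: nnmeas_weight; [exact: measurable_retained|move=> z [[]]]. Qed.

(** For z in [gained] and w in [retained], U vanishes at z and [sigma w]. The remaining values, at
    [sigma z] and w, interact across the geodesic before polarization and on one side after it,
    which is the case of [kern_gain]. All other pairs use [sym4_polarize_le]. *)
Lemma kernel_form_polarize_gain U : nnmeas U -> (forall z, ~ A z -> U z = 0%R) ->
  4%:E * kernel_form U + (q ^+ 3 / 40)%:E *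
    (\int[mu]_z (weight gained z * U (sigma z))%:E * \int[mu]_z (weight retained z * U z)%:E)
  <= 4%:E * kernel_form (polarize n v U).
Proof.
move=> nU UA; have nP := nnmeas_polarize n v nU.
have nF := nnmeas_kernM nU nU; have nG := nnmeas_kernM nP nP.
have nUs := nnmeas_comp (measurable_refl n v) nU.
have nphi : nnmeas (fun z => weight gained z * U (sigma z))%R by exact: nnmeasM.
have npsi : nnmeas (fun z => weight retained z * U z)%R by exact: nnmeasM.
have c0 : (0 <= q ^+ 3 / 40)%R by rewrite divr_ge0// exprn_ge0// ltW.
have nX : nnmeas (fun p : plane R * plane R =>
    (weight gained p.1 * U (sigma p.1)) * (weight retained p.2 * U p.2))%R.
  by apply: nnmeasM; [exact: nnmeas_fst nphi|exact: nnmeas_snd npsi].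
rewrite -(double_int_prod nphi npsi) -(double_intZ c0 nX) -!(double_int_sym4 nv)//.
rewrite -double_intD; [|exact: nnmeas_sym4|by apply: nnmeasM => //; exact: nnmeas_cst].
apply: (double_int_le (h := sigma)).
- by apply: nnmeasD; [exact: nnmeas_sym4|apply: nnmeasM => //; exact: nnmeas_cst].
- exact: nnmeas_sym4.
move=> z w dz dw wz wsz; rewrite [X in (_ + X <= _)%R]/=.
have base := sym4_polarize_le nv nU dz dw wz wsz.
have [gz|ngz] := pselect (gained z); last first.
  by rewrite /weight indicE memNset// !(mulr0, mul0r) addr0.
have [rw|nrw] := pselect (retained w); last first.
  by rewrite [weight retained w]/weight indicE memNset// !(mulr0, mul0r) addr0.
rewrite !sym4_kern//.
have [[[_ /= hz] [_ /= sz]] nAz] := gz; have [[[_ /= hw] Aw] nSw] := rw.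
have nAsw : ~ A (sigma w) by move=> Asw; apply: nSw.
rewrite /weight !indicE !mem_set// !mulr1 (UA _ nAz) (UA _ nAsw).
case: (polarizeP nv U dz) => [[_ [-> ->]]|[hz' _]]; last by move: hz; rewrite ltNge hz'.
case: (polarizeP nv U dw) => [[_ [-> ->]]|[hw' _]]; last by move: hw; rewrite ltNge hw'.
rewrite (UA _ nAz) (UA _ nAsw).
rewrite (max_idPr (nU.2 (sigma z))) (max_idPl (nU.2 w)) (min_idPl (nU.2 (sigma z))) (min_idPr (nU.2 w)).
rewrite !(mulr0, mul0r, addr0, add0r).
have qz : (q <= defect z)%R.
  have := Asq sz; rewrite /core/= refl_involutive// gt_eqF// refl_den_gt0//.
have zw : z <> w by move=> e; apply: wz.
have K := kern_gain nv q0 dz dw qz (Aq Aw) (Asq Aw) (ltW (mulr_gt0 hz hw)) zw.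
have := ler_wpM2r (mulr_ge0 (nU.2 (sigma z)) (nU.2 w)) K.
by rewrite mulrDl; apply: le_trans; rewrite lerD2l le_eqVlt; apply/orP; left; apply/eqP; ring.
Qed.

(** Bounds the height by 2 n . z <= |n|^2 + |z|^2 and |z| < 1, so that the test functions have
    finite norm. *)
Let c : R := (n.1 ^+ 2 + n.2 ^+ 2 + 1 + 2 * `|v|)%R.

Let height_le z : D z -> (h z <= c)%R.
Proof.
move=> /diskE; rewrite /defect /height /c => dz.
have a := sqr_ge0 (n.1 - z.1)%R; have b := sqr_ge0 (n.2 - z.2)%R.
have e : (- v * (1 + z.1 ^+ 2 + z.2 ^+ 2) <= `|v| * 2)%R.
  apply: (@le_trans _ _ (`|v| * (1 + z.1 ^+ 2 + z.2 ^+ 2))%R).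
    rewrite ler_wpM2r//; last by rewrite -normrN ler_norm.
    by rewrite -addrA addr_ge0// addr_ge0// sqr_ge0.
  by rewrite ler_wpM2l//; lra.
by rewrite mulNr in e; nra.
Qed.

Let c0 : (0 <= c)%R.
Proof. by rewrite /c nv !addr_ge0// ?sqr_ge0// mulr_ge0. Qed.

Let weight_le N z : D z -> N `<=` H -> (weight N z <= c)%R.
Proof.
move=> dz NH; rewrite /weight indicE; case: (boolP (z \in N)) => _; last by rewrite mulr0.
by rewrite mulr1 height_le.
Qed.

Let sqnorm_fin V : nnmeas V -> (forall z, ~ A z -> V z = 0%R) ->
  (forall z, D z -> (V z <= c)%R) -> sqnorm V < +oo.
Proof.
move=> nV VA Vc; have fc := hyp_core_fin q0.
have ni : nnmeas (\1_(@core R q) : plane R -> R).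
  by split; [apply: measurable_indic; exact: measurable_core|].
have c20 : (0 <= c ^+ 2)%R by exact: sqr_ge0.
apply: (@le_lt_trans _ _ (\int[mu]_z (c ^+ 2 * \1_(@core R q) z)%:E)).
  apply: le_hyp_integral; [exact: nnmeas_sqr|by apply: nnmeasM => //; exact: nnmeas_cst|].
  move=> z dz; have [Az|nAz] := pselect (A z).
    rewrite indicE mem_set ?mulr1; last exact: Aq.
    by rewrite ler_pXn2r// ?nnegrE ?nV.2// Vc.
  by rewrite VA// expr0n/= mulr_ge0.
rewrite hyp_integralZl// integral_indic//; last exact: measurable_core.
by rewrite setIT lte_mul_pinfty.
Qed.

Let int_weight_gt0 N : measurable N -> N `<=` H -> mu N <> 0 ->
  0 < \int[mu]_z (weight N z)%:E.
Proof.
move=> mN NH N0; have nw := nnmeas_weight mN NH.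
rewrite lt0e; apply/andP; split; last by apply: integral_ge0 => z _; rewrite lee_fin nw.2.
apply/eqP => /(hyp_integral_eq0 nw) e; apply: N0; apply: ae_null => //.
apply: filterS e => z wz Nz; move: wz; rewrite /weight indicE mem_set// mulr1 => h0.
by have [_ /=] := NH _ Nz; rewrite h0 ltxx.
Qed.

(** If the supremum did not increase, the uniform gain would keep every competitor on A at least e
    below it, which is absurd. *)
Lemma tau_h_polarized_lt : mu gained <> 0 -> mu retained <> 0 -> tau_h A < tau_h P.
Proof.
move=> g0 r0.
have mr := measurable_refl n v.
(* The weight on [gained] carried into A by the reflection; the indicator makes it vanish off A
   outside the disk as well. *)
pose V1 z : R := (weight gained (sigma z) * \1_A z)%R.
have nA : nnmeas (\1_A : plane R -> R) by split; [exact: measurable_indic|].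
have nws := nnmeas_comp mr n1.
have nV1 : nnmeas V1 by exact: nnmeasM.
have V1A z : ~ A z -> V1 z = 0%R by move=> nAz; rewrite /V1 indicE memNset// mulr0.
have V2A z : ~ A z -> weight retained z = 0%R.
  by move=> nAz; rewrite /weight indicE memNset ?mulr0// => -[[]].
have V1E z : D z -> V1 z = weight gained (sigma z).
  move=> dz; rewrite /V1; have [Az|nAz] := pselect (A z).
    by rewrite [X in (_ * X)%R]indicE mem_set// mulr1.
  rewrite [X in (_ * X)%R]indicE memNset// mulr0 /weight indicE memNset ?mulr0//.
  move=> -[[_ [_ As]] _]; move: As; rewrite /= refl_involutive//.
  by rewrite gt_eqF// refl_den_gt0.
have V1c z : D z -> (V1 z <= c)%R.
  by move=> dz; rewrite V1E// weight_le//; [exact: disk_refl|move=> ? [[]]].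
have V2c z : D z -> (weight retained z <= c)%R.
  by move=> dz; rewrite weight_le// => ? [[]].
have V1p : 0 < \int[mu]_z (V1 z)%:E.
  apply: lt_le_trans (_ : \int[mu]_z (weight gained (sigma z))%:E <= _).
    rewrite (hyp_integral_refl nv n1); apply: int_weight_gt0 => //; first exact: measurable_gained.
    by move=> ? [[]].
  by apply: le_hyp_integral => // z dz; rewrite V1E.
have V2p : 0 < \int[mu]_z (weight retained z)%:E.
  apply: int_weight_gt0 => //; first exact: measurable_retained.
  by move=> ? [[]].
have [T [e1 [p1 [TE e10 p10 H1]]]] :=
  near_maximizer q0 mA Aq nV1 V1A (sqnorm_fin nV1 V1A V1c) V1p.
have [T' [e2 [p2 [TE' e20 p20 H2]]]] :=
  near_maximizer q0 mA Aq n2 V2A (sqnorm_fin n2 V2A V2c) V2p.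
have eT : T' = T by apply: EFin_inj; rewrite -TE -TE'.
rewrite {}eT {TE'} in H2.
set g := (q ^+ 3 / 40 * (p1 * p2))%R.
have g0' : (0 < g)%R by rewrite mulr_gt0 ?divr_gt0 ?exprn_gt0// mulr_gt0.
(* Four times the form grows by g, so half the form grows by g / 8; a competitor within g / 16 of
   the supremum would overshoot it. *)
set e := Num.min (Num.min e1 e2) (g / 16)%R.
have e0 : (0 < e)%R by rewrite !lt_min e10 e20 divr_gt0.
rewrite ltNge; apply/negP => PT.
suff : tau_h A <= (T - e)%:E by rewrite TE lee_fin; lra.
apply: tau_h_le => // U nU UA U1; rewrite leNgt; apply/negP => Te.
have e1e : (e <= e1)%R by rewrite /e !ge_min lexx.
have e2e : (e <= e2)%R by rewrite /e !ge_min lexx orbT.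
have e3e : (e <= g / 16)%R by rewrite /e !ge_min lexx orbT.
have q1 : p1%:E <= \int[mu]_z (U z * V1 z)%:E.
  by apply: H1 => //; apply: le_trans (ltW Te); rewrite lee_fin; lra.
have q2 : p2%:E <= \int[mu]_z (U z * weight retained z)%:E.
  by apply: H2 => //; apply: le_trans (ltW Te); rewrite lee_fin; lra.
have nP := nnmeas_polarize n v nU.
have Pup : (2^-1)%:E * kernel_form (polarize n v U) <= T%:E.
  rewrite -TE; apply: le_trans PT; apply: tau_h_ge => //.
  - exact: measurable_polarized.
  - exact: polarized_disk.
  - exact: supported_polarize.
  - by rewrite sqnorm_polarize.
have G := kernel_form_polarize_gain nU UA.
have q1' : p1%:E <= \int[mu]_z (weight gained z * U (sigma z))%:E.
  apply: le_trans q1 _.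
  have nwU : nnmeas (fun z => weight gained z * U (sigma z))%R.
    by apply: nnmeasM => //; exact: nnmeas_comp mr nU.
  rewrite -(hyp_integral_refl nv nwU).
  apply: le_hyp_integral; [exact: nnmeasM|exact: nnmeas_comp mr nwU|].
  move=> z dz /=; rewrite refl_involutive//; last by rewrite gt_eqF// refl_den_gt0.
  by rewrite V1E// mulrC.
have q2' : p2%:E <= \int[mu]_z (weight retained z * U z)%:E.
  by apply: le_trans q2 _; under eq_integral do rewrite mulrC.
have G' : 4%:E * kernel_form U + g%:E <= 4%:E * kernel_form (polarize n v U).
  apply: le_trans G; rewrite leeD2l// EFinM lee_wpmul2l//.
    by rewrite lee_fin divr_ge0// exprn_ge0// ltW.
  by rewrite EFinM lee_pmul// lee_fin ltW.
have dfin (W : plane R -> R) (M : \bar R) : 0 <= kernel_form W ->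
   (2^-1)%:E * kernel_form W < +oo -> kernel_form W \is a fin_num.
  move=> d0; rewrite ge0_fin_numE//; apply: contraTT; rewrite -!leNgt !leye_eq => /eqP ->.
  by rewrite gt0_muley// lte_fin invr_gt0.
have dge0 (W : plane R -> R) : nnmeas W -> 0 <= kernel_form W.
  by move=> nW; apply: integral_ge0 => z _; exact: (nnmeas_inner (nnmeas_kernM nW nW)).2.
have f2 : kernel_form (polarize n v U) \is a fin_num.
  by apply: (dfin _ 0); [exact: dge0|apply: le_lt_trans Pup _; rewrite ltry].
have f1 : kernel_form U \is a fin_num.
  rewrite ge0_fin_numE ?dge0//; apply: le_lt_trans (kernel_form_polarize_le nv nU) _.
  by rewrite -ge0_fin_numE// dge0.
move: Te Pup G'; rewrite -(fineK f1) -(fineK f2).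
move: (fine (kernel_form U)) (fine (kernel_form (polarize n v U))) => x y; rewrite -!EFinM -!EFinD !lte_fin !lee_fin; lra.
Qed.

End strict_gain.

Section reflection_bound.
Variable R : realType.
Implicit Types (n z : plane R) (v : R).

Definition refl_bound n v : R := 2 * (n.1 ^+ 2 + n.2 ^+ 2) + 2 * v ^+ 2.

Lemma refl_bound_ge1 n v : n.1 ^+ 2 + n.2 ^+ 2 = 1 + v ^+ 2 -> 1 <= refl_bound n v.
Proof. by move=> nv; rewrite /refl_bound nv; have := sqr_ge0 v; lra. Qed.

Lemma refl_den_le n v z : disk z -> refl_den n v z <= refl_bound n v.
Proof.
move=> /diskE; rewrite /defect => dz.
have a := sqr_ge0 (n.1 + v * z.1); have b := sqr_ge0 (n.2 + v * z.2).
have e : v ^+ 2 * (z.1 ^+ 2 + z.2 ^+ 2) <= v ^+ 2.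
  by rewrite -[leRHS]mulr1 ler_wpM2l ?sqr_ge0//; lra.
have -> : refl_bound n v = refl_den n v z + (n.1 + v * z.1) ^+ 2 + (n.2 + v * z.2) ^+ 2
    + 2 * (v ^+ 2 - v ^+ 2 * (z.1 ^+ 2 + z.2 ^+ 2)).
  by rewrite /refl_bound /refl_den; ring.
by move: a b e (refl_den n v z); clear => a b e d; lra.
Qed.

(** One [q] serves A and its reflection: [defect_refl] divides the defect by [refl_den], which
    [refl_bound] bounds on the disk. *)
Lemma hyp_bounded_core_refl n v (A : set (plane R)) :
  n.1 ^+ 2 + n.2 ^+ 2 = 1 + v ^+ 2 -> A `<=` @disk R -> hyp_bounded A ->
  exists q : R, [/\ 0 < q, A `<=` core q & forall z, A z -> core q (refl n v z)].
Proof.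
move=> nv AD /(hyp_bounded_core AD) [q q0 Aq].
have B1 := refl_bound_ge1 nv.
have B0 : 0 < refl_bound n v by rewrite (lt_le_trans ltr01).
exists (q / refl_bound n v); split; first by rewrite divr_gt0.
  move=> z /Aq; rewrite /core/=; apply: le_trans.
  by rewrite ler_pdivrMr// ler_peMr// ltW.
move=> z Az; have dz := AD _ Az; have d0 := refl_den_gt0 nv dz.
rewrite /core/= defect_refl ?gt_eqF// ler_pM ?invr_ge0 ?(ltW q0) ?(ltW B0)//.
  exact: Aq.
by rewrite lef_pV2 ?posrE// refl_den_le.
Qed.

End reflection_bound.

(** * Null exchange sets and equality of the domains *)

Section equality_case.
Local Open Scope ereal_scope.
Context (R : realType).
Local Notation mu := (@hyp_measure R).
Local Notation D := (@disk R).
Implicit Types (z w : plane R).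
Variables (n : plane R) (v : R).
Hypothesis nv : (n.1 ^+ 2 + n.2 ^+ 2 = 1 + v ^+ 2)%R.
Local Notation h := (height n v).
Local Notation sigma := (refl n v).
Variable A : set (plane R).
Hypotheses (mA : measurable A) (AD : A `<=` D).
Local Notation S := (reflected n v A).
Local Notation P := (polarized n v A).

Let reflect_lower z : D z -> ~ upper n v z -> sigma z <> z -> upper n v (sigma z).
Proof.
move=> dz nuz sz; have d0 := refl_den_gt0 nv dz.
split; first exact: disk_refl.
rewrite /= height_refl ?gt_eqF// divr_gt0// oppr_gt0 lt_neqAle; apply/andP; split.
  by apply/eqP => /(refl_fixed nv).
by rewrite leNgt; apply/negP => hz; apply: nuz.
Qed.

Let sigmaK z : D z -> sigma (sigma z) = z.
Proof. by move=> dz; rewrite refl_involutive// gt_eqF// refl_den_gt0. Qed.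

(** P \ A lies in [gained], and the reflection carries A \ P into it. Points of the geodesic are
    fixed, so they belong to A exactly when they belong to S. *)
Lemma gained_null : mu (gained n v A) = 0 -> area R (P `+` A) = 0.
Proof.
move=> g0; have mg := measurable_gained n v mA.
have mP := measurable_polarized n v mA.
have PD := @polarized_disk R n v A AD.
have mX : measurable (P `+` A) by apply: measurableU; exact: measurableD.
apply: area_null => //; first by move=> z [[/PD]|[/AD]].
apply: ae_null => //.
have aD : {ae mu, forall z, D z} by exact: negligible_diskC.
apply: filterS3 aD (null_ae mg g0) (null_refl_ae nv mg g0) => z dz ng ngs [[Pz nAz]|[Az nPz]].
  by case: Pz => [[[//|Sz] Hz]|[//]]; apply: ng; split.
have nSz : ~ S z by move=> Sz; apply: nPz; right.
have nAs : ~ A (sigma z) by move=> As; apply: nSz.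
apply: ngs; split => //; split.
  apply: reflect_lower => // [Hz|e]; first by apply: nPz; left; split; [left|].
  by apply: nAs; rewrite e.
by split; [exact: disk_refl|rewrite /= sigmaK].
Qed.

(** The same argument with A and S exchanged: P \ S lies in [retained], and the reflection carries S
    \ P into it. *)
Lemma retained_null : mu (retained n v A) = 0 -> area R (P `+` S) = 0.
Proof.
move=> r0; have mr := measurable_retained n v mA.
have mP := measurable_polarized n v mA.
have mS := measurable_reflected n v mA.
have PD := @polarized_disk R n v A AD.
have mX : measurable (P `+` S) by apply: measurableU; exact: measurableD.
apply: area_null => //; first by move=> z [[/PD]|[[]]].
apply: ae_null => //.
have aD : {ae mu, forall z, D z} by exact: negligible_diskC.
apply: filterS3 aD (null_ae mr r0) (null_refl_ae nv mr r0) => z dz nr nrs [[Pz nSz]|[Sz nPz]].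
  by case: Pz => [[[Az|//] Hz]|[//]]; apply: nr; split.
have nAz : ~ A z by move=> Az; apply: nPz; right.
have [_ As] := Sz.
apply: nrs; split; first split => //.
  apply: reflect_lower => // [Hz|e]; first by apply: nPz; left; split; [right|].
  by apply: nAz; rewrite -e.
by move=> [_]; rewrite /= sigmaK.
Qed.

End equality_case.

Theorem theorem1p2 (R : realType) (Omega G H : set (plane R))
    (Omega_disk : Omega `<=` @disk R) (Omega_open : open Omega)
    (Omega_bounded : hyp_bounded Omega)
    (G_geodesic : geodesic G) (H_polarizer : polarizer G H) :
  (tau_h Omega <= tau_h (polarization G H Omega))%E /\
  (tau_h Omega = tau_h (polarization G H Omega) <->
     area R (polarization G H Omega `+` Omega) = 0%E \/
     area R (polarization G H Omega `+` reflection G @` Omega) = 0%E).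
Proof.
have [n [v [nv rE HE]]] := geodesicP G_geodesic H_polarizer.
have mO := open_plane_measurable Omega_open.
have sK z : disk z -> refl n v (refl n v z) = z.
  by move=> dz; rewrite refl_involutive// gt_eqF// refl_den_gt0.
(* The formula for [reflection] agrees with [refl] on the disk only, which suffices as Omega lies
   there. *)
have SE : reflection G @` Omega = reflected n v Omega.
  apply/seteqP; split=> [_ [z Oz <-]|z [dz Os]].
    have dz := Omega_disk _ Oz; rewrite rE//.
    by split; [exact: disk_refl|rewrite /= sK].
  by exists (refl n v z) => //; rewrite rE ?sK//; exact: disk_refl.
have PE : polarization G H Omega = polarized n v Omega by rewrite /polarization SE HE.
rewrite PE SE.
have mP := measurable_polarized n v mO.
have mS := measurable_reflected n v mO.
have PD := @polarized_disk R n v Omega Omega_disk.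
have le := tau_h_polarized nv mO Omega_disk.
have sub0 (X Y : set (plane R)) : measurable X -> measurable Y ->
    area R (X `+` Y) = 0%E -> hyp_measure (X `\` Y) = 0%E.
  move=> mX mY XY; have mXY := measurableD mX mY.
  apply: hyp_measure_null => //; apply/eqP; rewrite eq_le measure_ge0 andbT -XY.
  apply: le_measure; rewrite ?inE//; last by move=> z; left.
  by apply: measurableU => //; exact: measurableD.
split; first exact: le.
split; last first.
  (* The supremum is insensitive to null sets and to the reflection, which gives the reverse
     inequality. *)
  move=> eq0; apply: le_anti; apply/andP; split; first exact: le.
  case: eq0 => /sub0 eq0.
    by apply: tau_h_sub => //; exact: eq0.
  by apply: (tau_h_sub_reflected nv) => //; exact: eq0.
(* If neither exchange set were null, the strict inequality would contradict equality. *)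
move=> eqt.
have [q [qp Oq Osq]] := hyp_bounded_core_refl nv Omega_disk Omega_bounded.
have [g0|g0] := pselect (hyp_measure (gained n v Omega) = 0%E).
  by left; exact: gained_null.
have [r0|r0] := pselect (hyp_measure (retained n v Omega) = 0%E).
  by right; exact: retained_null.
by have := tau_h_polarized_lt nv qp mO Oq Osq g0 r0; rewrite -eqt ltxx.
Qed.
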